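(* Let $N\ge 1$, let $\Omega\subset\mathbb{R}^N$ be a bounded open domain with $C^1$ boundary and outward unit normal $\nu$, and let $g^\pm\in C^1(\overline\Omega)$ with $g^-(x)<g^+(x)$ for $x\in\overline\Omega$. Let $F\in C(\mathcal{S}(N+1)\times\mathbb{R}^{N+1}\times\mathbb{R}\times\overline\Omega\times[-1,1],\mathbb{R})$ and suppose there is a constant $\alpha>0$ such that, for every $(p,x,y)\in\mathbb{R}^{N+1}\times\overline\Omega\times[-1,1]$, $F(X,p,r,x,y)-\alpha r\le F(Y,p,s,x,y)-\alpha s$ whenever $X,Y\in\mathcal{S}(N+1)$, $r,s\in\mathbb{R}$, $X\ge Y$ and $r\le s$. Let $\gamma_1^\pm\in C(\overline\Omega\times[-1,1],\mathbb{R}^N)$, $\beta^\pm\in C(\overline\Omega\times[-1,1],\mathbb{R})$ and put $\gamma^+=(\gamma_1^+,1)$, $\gamma^-=(\gamma_1^-,-1)$. Assume that there are $\gamma_o\in C^1(\overline\Omega,\mathbb{R}^N)$, $\beta_o\in C^1(\overline\Omega,\mathbb{R})$ with $$\gamma_1^+(x,0)=-\gamma_1^-(x,0)=\gamma_o(x),\qquad \beta^+(x,0)=-\beta^-(x,0)=\beta_o(x)\qquad (x\in\overline\Omega),$$ and $k^\pm\in C(\overline\Omega,\mathbb{R}^N)$, $l^\pm\in C(\overline\Omega,\mathbb{R})$ such that, as $y\to0$, uniformly in $x\in\overline\Omega$, $$\gamma_1^\pm(x,y)=\pm\gamma_o(x)+k^\pm(x)y+o(|y|),\qquad \beta^\pm(x,y)=\pm\beta_o(x)+l^\pm(x)y+o(|y|).$$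 Let $\beta\in C(\partial\Omega\times[-1,1],\mathbb{R})$ and consider, on $\partial_{\mathrm L}\Omega_\varepsilon$, either (O) the oblique condition $\gamma\cdot Du=\beta$, where $\gamma=(\gamma_1,\gamma_2)\in C(\partial\Omega\times[-1,1],\mathbb{R}^{N+1})$ satisfies $\gamma_1(x,y)\cdot\nu(x)>0$ for $(x,y)\in\partial\Omega\times[-1,1]$ and $\gamma_2(x,0)=0$ for $x\in\partial\Omega$; or (D) the Dirichlet condition $u=\beta$. For $\varepsilon>0$ let $S_\varepsilon$ be the set of viscosity solutions of $$F(D^2u,Du,u,x,y)=0\ \text{in }\Omega_\varepsilon,\quad \gamma^+\cdot Du=\beta^+\ \text{on }\partial_{\mathrm T}\Omega_\varepsilon,\quad \gamma^-\cdot Du=\beta^-\ \text{on }\partial_{\mathrm B}\Omega_\varepsilon$$ together with the chosen lateral condition on $\partial_{\mathrm L}\Omega_\varepsilon$, and for $x\in\overline\Omega$ define $$u^+(x)=\lim_{r\to0^+}\sup\{u(\xi,\eta): u\in S_\varepsilon,\ (\xi,\eta)\in\overline{\Omega_\varepsilon},\ 0<\varepsilon<r,\ |\xi-x|<r\},$$ $$u^-(x)=\lim_{r\to0^+}\inf\{u(\xi,\eta): u\in S_\varepsilon,\ (\xi,\eta)\in\overline{\Omega_\varepsilon},\ 0<\varepsilon<r,\ |\xi-x|<r\}.$$ Then, with $G$ the limit operator defined in the context: in case (O), $u^+$ and $u^-$ are respectively a viscosity subsolution and a viscosity supersolution of $$G(D^2u,Du,u,x)=0\ \text{ in }\Omega,\qquad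 \gamma_1(x,0)\cdot Du=\beta(x,0)\ \text{ on }\partial\Omega;$$ in case (D), $u^+$ and $u^-$ are respectively a viscosity subsolution and a viscosity supersolution of $$G(D^2u,Du,u,x)=0\ \text{ in }\Omega,\qquad u=\beta(x,0)\ \text{ on }\partial\Omega.$$
   Context: $\mathcal{S}(k)$ is the space of real symmetric $k\times k$ matrices with the semidefinite order. For compact $K\subset\mathbb{R}^j$, $C^i(K,\mathbb{R}^k)$ denotes restrictions to $K$ of $C^i$ functions on $\mathbb{R}^j$. For $\varepsilon>0$: $\Omega_\varepsilon=\{(x,y)\in\Omega\times\mathbb{R}: \varepsilon g^-(x)<y<\varepsilon g^+(x)\}$, $\partial_{\mathrm T}\Omega_\varepsilon=\{(x,y): x\in\overline\Omega,\ y=\varepsilon g^+(x)\}$, $\partial_{\mathrm B}\Omega_\varepsilon=\{(x,y): x\in\overline\Omega,\ y=\varepsilon g^-(x)\}$, $\partial_{\mathrm L}\Omega_\varepsilon=\{(x,y): x\in\partial\Omega,\ \varepsilon g^-(x)\le y\le\varepsilon g^+(x)\}$. Only small $\varepsilon$ matter, so that $\overline{\Omega_\varepsilon}\subset\overline\Omega\times[-1,1]$, $1-\varepsilon Dg^+\cdot\gamma_1^+>0$ on $\partial_{\mathrm T}\Omega_\varepsilon$ and $1+\varepsilon Dg^-\cdot\gamma_1^->0$ on $\partial_{\mathrm B}\Omega_\varepsilon$. Under the stated hypotheses, the elements of $S_\varepsilon$ are bounded uniformly for all small $\varepsilon$ and $S_\varepsilon\neq\emptyset$, so $u^\pm$ are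 bounded functions on $\overline\Omega$. Limit operator. Vectors are row vectors; $D\gamma_o$ is the matrix with $(i,j)$ entry $\partial(\gamma_o)_i/\partial x_j$; $D\beta_o$ is the row vector with entries $\partial\beta_o/\partial x_i$. Put $$b=\gamma_o(D\gamma_o)^{T}-\frac{g^+k^++g^-k^-}{g^+-g^-},\qquad c=-\gamma_o\cdot D\beta_o+\frac{g^+l^++g^-l^-}{g^+-g^-},$$ and for $(X,p,r,x)\in\mathcal{S}(N)\times\mathbb{R}^N\times\mathbb{R}\times\overline\Omega$ $$G(X,p,r,x)=F\big(A+B+C,\ (p,\beta_o(x)-\gamma_o(x)\cdot p),\ r,\ x,\ 0\big),$$ $$A=\begin{pmatrix}X&-X\gamma_o^{T}\\-\gamma_oX&\gamma_oX\gamma_o^{T}\end{pmatrix},\quad B=\begin{pmatrix}0&-(pD\gamma_o)^{T}\\-pD\gamma_o&b\cdot p\end{pmatrix},\quad C=\begin{pmatrix}0&(D\beta_o)^{T}\\ D\beta_o&c\end{pmatrix},$$ with all functions evaluated at $x$. Viscosity solutions on $\overline{\Omega_\varepsilon}$. A bounded function $u$ on $\overline{\Omega_\varepsilon}$ is a viscosity subsolution if, with $v$ its upper semicontinuous envelope on $\overline{\Omega_\varepsilon}$, whenever $\phi\in C^2(\overline{\Omega_\varepsilon})$ and $v-\phi$ attains its maximum over $\overline{\Omega_\varepsilon}$ at $\hat z$, at least one of the following holds: (a) $F(D^2\phi(\hat z),D\phi(\hat z),v(\hat z),\hat z)\le0$; (b) $\hat z\in\partial_{\mathrm L}\Omega_\varepsilon$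 and $\gamma(\hat z)\cdot D\phi(\hat z)\le\beta(\hat z)$ in case (O), respectively $v(\hat z)\le\beta(\hat z)$ in case (D); (c) $\hat z\in\partial_{\mathrm T}\Omega_\varepsilon$ and $\gamma^+(\hat z)\cdot D\phi(\hat z)\le\beta^+(\hat z)$; (d) $\hat z\in\partial_{\mathrm B}\Omega_\varepsilon$ and $\gamma^-(\hat z)\cdot D\phi(\hat z)\le\beta^-(\hat z)$. Viscosity supersolutions: replace maximum by minimum, $\le$ by $\ge$, upper by lower semicontinuous envelope. A viscosity solution is a bounded function that is both (continuity is not required). Viscosity sub/supersolutions of the limit problems. A bounded function $u$ on $\overline\Omega$ is a viscosity subsolution if, with $v$ its upper semicontinuous envelope on $\overline\Omega$, whenever $\phi\in C^2(\overline\Omega)$ and $v-\phi$ attains its maximum over $\overline\Omega$ at $\hat x$, one has $G(D^2\phi(\hat x),D\phi(\hat x),v(\hat x),\hat x)\le0$, or else $\hat x\in\partial\Omega$ and $\gamma_1(\hat x,0)\cdot D\phi(\hat x)\le\beta(\hat x,0)$ in case (O), respectively $v(\hat x)\le\beta(\hat x,0)$ in case (D). Supersolutions are defined symmetrically (minimum, $\ge$, lower semicontinuous envelope). *)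

(* Defs.v *)
From HB Require Import structures.
From mathcomp Require Export all_boot all_order all_algebra.
From mathcomp Require Export all_classical all_reals all_analysis.
Export Order.TTheory GRing.Theory Num.Theory numFieldNormedType.Exports.

Set Implicit Arguments.
Unset Strict Implicit.
Unset Printing Implicit Defensive.

Local Open Scope classical_set_scope.
Local Open Scope ring_scope.

(* The norm of the normed module ['rV[R]_n] is the sup norm, hence [enorm]. *)
Definition dot {R : realType} {n : nat} (u v : 'rV[R]_n) : R :=
  \sum_(i < n) u 0 i * v 0 i.

Definition enorm {R : realType} {n : nat} (u : 'rV[R]_n) : R :=
  Num.sqrt (dot u u).

Definition symmx {R : realType} {n : nat} (X : 'M[R]_n) : Prop := X^T = X.

(* The semidefinite order X >= Y, used on symmetric matrices only. *)
Definition psd_ge {R : realType} {n : nat} (X Y : 'M[R]_n) : Prop :=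
  forall v : 'rV[R]_n, 0 <= dot (v *m (X - Y)) v.

(* C^k on the whole space.  For k >= 1 and compact K, an element of C^k(K),
   i.e. the restriction to K of a C^k function on the whole space, is given by
   such an extension; only its restriction to K (and its derivatives at points
   of K) is ever used.  Below, K is always the closure of an open set, so that
   these derivatives do not depend on the extension. *)
Fixpoint Ck {R : realType} {V W : normedModType R} (k : nat) (f : V -> W) :
    Prop :=
  match k with
  | 0 => continuous f
  | k'.+1 => (forall x, differentiable f x) /\
             (forall v, Ck k' (fun x => 'D_v f x))
  end.

Definition grad {R : realType} {n : nat} (f : 'rV[R]_n -> R) (x : 'rV[R]_n) :
    'rV[R]_n :=
  \row_(i < n) 'D_(delta_mx 0 i) f x.

Definition hess {R : realType} {n : nat} (f : 'rV[R]_n -> R) (x : 'rV[R]_n) :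
    'M[R]_n :=
  \matrix_(i < n, j < n)
    'D_(delta_mx 0 i) (fun z => 'D_(delta_mx 0 j) f z) x.

(* [jacobian] acts on row vectors from the right, so its (i, j) entry is
   d f_j / d x_i; the matrix Df used here has d f_i / d x_j instead. *)
Definition Dmx {R : realType} {n : nat} (f : 'rV[R]_n -> 'rV[R]_n)
    (x : 'rV[R]_n) : 'M[R]_n :=
  (jacobian f x)^T.

Definition bdry {T : topologicalType} (A : set T) : set T :=
  closure A `\` A°.

Definition bounded_domain {R : realType} {n : nat} (Om : set 'rV[R]_n) : Prop :=
  [/\ Om !=set0, open Om, connected Om & bounded_set Om].

Definition local_defining_function {R : realType} {n : nat}
    (Om : set 'rV[R]_n) (x0 : 'rV[R]_n) (rho : 'rV[R]_n -> R) : Prop :=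
  [/\ Ck 1 rho, grad rho x0 != 0 & \forall x \near x0, Om x <-> rho x < 0].

Definition C1_boundary {R : realType} {n : nat} (Om : set 'rV[R]_n) : Prop :=
  forall x0, bdry Om x0 -> exists rho, local_defining_function Om x0 rho.

Definition outward_unit_normal {R : realType} {n : nat} (Om : set 'rV[R]_n)
    (nu : 'rV[R]_n -> 'rV[R]_n) : Prop :=
  forall x0, bdry Om x0 -> exists2 rho, local_defining_function Om x0 rho &
    nu x0 = (enorm (grad rho x0))^-1 *: grad rho x0.

(* Semicontinuous envelopes on K, at points of K; the neighbourhoods are not
   punctured, so the value u x itself is taken into account. *)
Definition usc_env {R : realType} {n : nat} (K : set 'rV[R]_n)
    (u : 'rV[R]_n -> R) (x : 'rV[R]_n) : R :=
  fine (limf_esup (fun z => (u z)%:E) (within K (nbhs x))).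

Definition lsc_env {R : realType} {n : nat} (K : set 'rV[R]_n)
    (u : 'rV[R]_n -> R) (x : 'rV[R]_n) : R :=
  fine (limf_einf (fun z => (u z)%:E) (within K (nbhs x))).

(* [E X p r z] is the condition required at a point z of maximum (resp.
   minimum), with X, p the second and first derivatives of the test function
   and r the value of the envelope; boundary alternatives are part of E. *)
Definition visc_sub {R : realType} {n : nat} (K : set 'rV[R]_n)
    (E : 'M[R]_n -> 'rV[R]_n -> R -> 'rV[R]_n -> Prop)
    (u : 'rV[R]_n -> R) : Prop :=
  [bounded u z | z in K] /\
  forall (phi : 'rV[R]_n -> R) (z0 : 'rV[R]_n), Ck 2 phi -> K z0 ->
    (forall z, K z -> usc_env K u z - phi z <= usc_env K u z0 - phi z0) ->
    E (hess phi z0) (grad phi z0) (usc_env K u z0) z0.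

Definition visc_super {R : realType} {n : nat} (K : set 'rV[R]_n)
    (E : 'M[R]_n -> 'rV[R]_n -> R -> 'rV[R]_n -> Prop)
    (u : 'rV[R]_n -> R) : Prop :=
  [bounded u z | z in K] /\
  forall (phi : 'rV[R]_n -> R) (z0 : 'rV[R]_n), Ck 2 phi -> K z0 ->
    (forall z, K z -> lsc_env K u z0 - phi z0 <= lsc_env K u z - phi z) ->
    E (hess phi z0) (grad phi z0) (lsc_env K u z0) z0.

(* R^(N+1) is ['rV[R]_(N + 1)]; its points are (x, y) with x in R^N. *)
Definition pt {R : realType} {N : nat} (x : 'rV[R]_N) (y : R) : 'rV[R]_(N + 1) :=
  row_mx x (y%:M : 'rV[R]_1).

Definition xpart {R : realType} {N : nat} (z : 'rV[R]_(N + 1)) : 'rV[R]_N :=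
  lsubmx z.

Definition ypart {R : realType} {N : nat} (z : 'rV[R]_(N + 1)) : R :=
  rsubmx z 0 0.

Section ThinDomain.
Context {R : realType} {N : nat}.
Implicit Types (Om : set 'rV[R]_N) (gp gm : 'rV[R]_N -> R) (eps : R).

Definition thin_domain Om gp gm eps : set 'rV[R]_(N + 1) :=
  [set z | Om (xpart z) /\
           eps * gm (xpart z) < ypart z < eps * gp (xpart z)].

Definition top_bdry Om gp eps : set 'rV[R]_(N + 1) :=
  [set z | closure Om (xpart z) /\ ypart z = eps * gp (xpart z)].

Definition bottom_bdry Om gm eps : set 'rV[R]_(N + 1) :=
  [set z | closure Om (xpart z) /\ ypart z = eps * gm (xpart z)].

Definition lateral_bdry Om gp gm eps : set 'rV[R]_(N + 1) :=
  [set z | bdry Om (xpart z) /\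
           eps * gm (xpart z) <= ypart z <= eps * gp (xpart z)].

(* [Oblique gamma1 gamma2] is gamma . Du = beta with gamma = (gamma1, gamma2);
   [Dirichlet] is u = beta. *)
Inductive lateral_condition : Type :=
  | Oblique of ('rV[R]_N -> R -> 'rV[R]_N) & ('rV[R]_N -> R -> R)
  | Dirichlet.

Definition lateral_sub (L : lateral_condition) (beta : 'rV[R]_N -> R -> R)
    (p : 'rV[R]_(N + 1)) (r : R) (x : 'rV[R]_N) (y : R) : Prop :=
  match L with
  | Oblique gamma1 gamma2 => dot (pt (gamma1 x y) (gamma2 x y)) p <= beta x y
  | Dirichlet => r <= beta x y
  end.

Definition lateral_super (L : lateral_condition) (beta : 'rV[R]_N -> R -> R)
    (p : 'rV[R]_(N + 1)) (r : R) (x : 'rV[R]_N) (y : R) : Prop :=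
  match L with
  | Oblique gamma1 gamma2 => beta x y <= dot (pt (gamma1 x y) (gamma2 x y)) p
  | Dirichlet => beta x y <= r
  end.

Definition lateral_limit_sub (L : lateral_condition)
    (beta : 'rV[R]_N -> R -> R) (p : 'rV[R]_N) (r : R) (x : 'rV[R]_N) : Prop :=
  match L with
  | Oblique gamma1 _ => dot (gamma1 x 0) p <= beta x 0
  | Dirichlet => r <= beta x 0
  end.

Definition lateral_limit_super (L : lateral_condition)
    (beta : 'rV[R]_N -> R -> R) (p : 'rV[R]_N) (r : R) (x : 'rV[R]_N) : Prop :=
  match L with
  | Oblique gamma1 _ => beta x 0 <= dot (gamma1 x 0) p
  | Dirichlet => beta x 0 <= r
  end.

Implicit Types (F : 'M[R]_(N + 1) -> 'rV[R]_(N + 1) -> R -> 'rV[R]_N -> R -> R)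
  (gamma1p gamma1m : 'rV[R]_N -> R -> 'rV[R]_N)
  (betap betam beta : 'rV[R]_N -> R -> R) (L : lateral_condition).

Definition thin_sub_cond Om gp gm F gamma1p gamma1m betap betam L beta eps
    (X : 'M[R]_(N + 1)) (p : 'rV[R]_(N + 1)) (r : R) (z : 'rV[R]_(N + 1)) :
    Prop :=
  let x := xpart z in let y := ypart z in
  [\/ F X p r x y <= 0,
      lateral_bdry Om gp gm eps z /\ lateral_sub L beta p r x y,
      top_bdry Om gp eps z /\ dot (pt (gamma1p x y) 1) p <= betap x y |
      bottom_bdry Om gm eps z /\ dot (pt (gamma1m x y) (- 1)) p <= betam x y].

Definition thin_super_cond Om gp gm F gamma1p gamma1m betap betam L beta eps
    (X : 'M[R]_(N + 1)) (p : 'rV[R]_(N + 1)) (r : R) (z : 'rV[R]_(N + 1)) :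
    Prop :=
  let x := xpart z in let y := ypart z in
  [\/ 0 <= F X p r x y,
      lateral_bdry Om gp gm eps z /\ lateral_super L beta p r x y,
      top_bdry Om gp eps z /\ betap x y <= dot (pt (gamma1p x y) 1) p |
      bottom_bdry Om gm eps z /\ betam x y <= dot (pt (gamma1m x y) (- 1)) p].

Definition thin_solutions Om gp gm F gamma1p gamma1m betap betam L beta eps :
    set ('rV[R]_(N + 1) -> R) :=
  [set u | visc_sub (closure (thin_domain Om gp gm eps))
     (thin_sub_cond Om gp gm F gamma1p gamma1m betap betam L beta eps) u /\
   visc_super (closure (thin_domain Om gp gm eps))
     (thin_super_cond Om gp gm F gamma1p gamma1m betap betam L beta eps) u].

(* Values in [\bar R], so that the definitions do not presuppose that the
   families S eps are nonempty and uniformly bounded. *)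
Definition relaxed_values Om gp gm (S : R -> set ('rV[R]_(N + 1) -> R))
    (x : 'rV[R]_N) (r : R) : set (\bar R) :=
  [set t | exists eps u xi eta,
     [/\ 0 < eps < r, S eps u, closure (thin_domain Om gp gm eps) (pt xi eta),
         enorm (xi - x) < r & t = (u (pt xi eta))%:E]].

Definition upper_relaxed Om gp gm (S : R -> set ('rV[R]_(N + 1) -> R))
    (x : 'rV[R]_N) : \bar R :=
  lim (ereal_sup (relaxed_values Om gp gm S x r) @[r --> 0^'+]).

Definition lower_relaxed Om gp gm (S : R -> set ('rV[R]_(N + 1) -> R))
    (x : 'rV[R]_N) : \bar R :=
  lim (ereal_inf (relaxed_values Om gp gm S x r) @[r --> 0^'+]).

Implicit Types (gammao kp km : 'rV[R]_N -> 'rV[R]_N)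
  (betao lp lm : 'rV[R]_N -> R).

Definition coef_b gp gm gammao kp km (x : 'rV[R]_N) : 'rV[R]_N :=
  gammao x *m (Dmx gammao x)^T
  - (gp x - gm x)^-1 *: (gp x *: kp x + gm x *: km x).

Definition coef_c gp gm gammao betao lp lm (x : 'rV[R]_N) : R :=
  - dot (gammao x) (grad betao x)
  + (gp x * lp x + gm x * lm x) / (gp x - gm x).

Definition limit_operator gp gm F gammao betao kp km lp lm
    (X : 'M[R]_N) (p : 'rV[R]_N) (r : R) (x : 'rV[R]_N) : R :=
  let g := gammao x in
  let A : 'M[R]_(N + 1) :=
    block_mx X (- (X *m g^T)) (- (g *m X)) (g *m X *m g^T) in
  let B : 'M[R]_(N + 1) :=
    block_mx 0 (- (p *m Dmx gammao x)^T)
      (- (p *m Dmx gammao x)) (dot (coef_b gp gm gammao kp km x) p)%:M in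
  let C : 'M[R]_(N + 1) :=
    block_mx 0 (grad betao x)^T
      (grad betao x) (coef_c gp gm gammao betao lp lm x)%:M in
  F (A + B + C) (pt p (betao x - dot g p)) r x 0.

Implicit Type G : 'M[R]_N -> 'rV[R]_N -> R -> 'rV[R]_N -> R.

Definition limit_sub_cond Om G L beta
    (X : 'M[R]_N) (p : 'rV[R]_N) (r : R) (x : 'rV[R]_N) : Prop :=
  G X p r x <= 0 \/ (bdry Om x /\ lateral_limit_sub L beta p r x).

Definition limit_super_cond Om G L beta
    (X : 'M[R]_N) (p : 'rV[R]_N) (r : R) (x : 'rV[R]_N) : Prop :=
  0 <= G X p r x \/ (bdry Om x /\ lateral_limit_super L beta p r x).

(* [up] and [um] must first be shown to be real valued on the closure of Om,
   since [fine] sends infinite values to 0. *)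
Definition relaxed_limits_solve Om gp gm F gamma1p gamma1m betap betam
    gammao betao kp km lp lm L beta : Prop :=
  let S := thin_solutions Om gp gm F gamma1p gamma1m betap betam L beta in
  let G := limit_operator gp gm F gammao betao kp km lp lm in
  let up := upper_relaxed Om gp gm S in
  let um := lower_relaxed Om gp gm S in
  [/\ forall x, closure Om x -> up x \is a fin_num,
      forall x, closure Om x -> um x \is a fin_num,
      visc_sub (closure Om) (limit_sub_cond Om G L beta) (fine \o up) &
      visc_super (closure Om) (limit_super_cond Om G L beta) (fine \o um)].

End ThinDomain.

Arguments lateral_condition : clear implicits.
Arguments Dirichlet {R N}.

(* Main.v *)
Require Import Defs.
From HB Require Import structures.
From mathcomp Require Import ring lra.

Set Implicit Arguments.
Unset Strict Implicit.
Unset Printing Implicit Defensive.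

Local Open Scope classical_set_scope.
Local Open Scope ring_scope.

(** Formally, a solution on the thin domain looks like
    [psi x + y * q x + s x / 2 * y ^ 2], with [psi] the limit.  To leading order the
    conditions on the top and bottom both say that [q = beta0 - gamma0 . D psi], the
    [slope] of [psi].  To first order in [eps] they give two further equations, whose
    compatibility determines [s] ([limit_balance]), and the Hessian of the expression
    above at [y = 0] is then the matrix that appears in the limit operator
    ([limit_operE], [grad_slope]).  The proof makes this expression into a test
    function for the perturbed problem.

    The slope of a C^2 function is only C^1, so [psi x + y * q x] is not an admissible
    test function.  It is replaced by a minimum of smooth ones: up to the error [o(eps)]
    that is needed, [q] is the minimum over the point [a] of its first order Taylor
    polynomial at [a] plus [(kappa / eps) |x - a|^2].  As [y - eps * m] is positive for
    a constant [m] below the bottom, multiplying by it keeps minima, and the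
    large opening [kappa / eps] is multiplied by [O(eps)] and contributes only
    [O(kappa)] to the Hessian.  Where a paraboloid realizes the minimum at [x], its
    centre is [o(eps)]-close to [x], so it has the value and gradient of [q] there to the
    required accuracy ([taylor_contact], [profileP]).  The conditions on the top and
    bottom are then controlled by the [residual] ([conormal_estimate]).

    Suppose now that the subsolution property of the upper relaxed limit fails for a
    test function with a strict maximum at [x0].  Take [s] slightly larger than the
    balanced value, so that the conditions on the top and bottom are violated strictly;
    the equation and the lateral condition are violated near [x0] by continuity.  The
    minimum of smooth functions above touches solutions which nearly realize the relaxed
    limit at a point close to [x0], contradicting that they are subsolutions
    ([limit_strict]).  Supersolutions reduce to subsolutions, because [- u] solves a
    problem of the same kind ([neg], [solutionsN], [limit_operN]).

    It remains to see that the relaxed limits are finite, that is, that solutions exist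
    and are bounded uniformly for small [eps].  The same construction with [s] large and
    a large additive constant yields strict supersolutions ([upper_barrier_exists]); for
    the oblique condition it starts from a polynomial whose gradient is transversal to
    the lateral boundary ([transversal_function]).  They bound all subsolutions, since
    they are touched from above by smooth functions that violate the conditions.  Between such barriers Perron's method gives a solution
    ([perron]).  It needs that smooth strict subsolutions are viscosity subsolutions, also
    at the edges of the thin domain; there the conormals of the two faces are combined
    into one direction pointing outward ([thin_strict_sub_touched]). *)

(** * Scalar products and calculus of C^k functions *)

Section Dot.
Context {R : realType} {n : nat}.
Implicit Types u v w : 'rV[R]_n.

Lemma dotC u v : dot u v = dot v u.
Proof. by apply: eq_bigr => i _; rewrite mulrC. Qed.

Lemma dotDl u v w : dot (u + v) w = dot u w + dot v w.
Proof. by rewrite -big_split; apply: eq_bigr => i _; rewrite mxE mulrDl. Qed.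

Lemma dotZl a u v : dot (a *: u) v = a * dot u v.
Proof. by rewrite /dot big_distrr/=; apply: eq_bigr => i _; rewrite mxE mulrA. Qed.

Lemma dotNl u v : dot (- u) v = - dot u v.
Proof. by rewrite -scaleN1r dotZl mulN1r. Qed.

Lemma dotBl u v w : dot (u - v) w = dot u w - dot v w.
Proof. by rewrite dotDl dotNl. Qed.

Lemma dotDr u v w : dot w (u + v) = dot w u + dot w v.
Proof. by rewrite dotC dotDl !(dotC w). Qed.

Lemma dotZr a u v : dot v (a *: u) = a * dot v u.
Proof. by rewrite dotC dotZl dotC. Qed.

Lemma dotNr u v : dot v (- u) = - dot v u.
Proof. by rewrite dotC dotNl dotC. Qed.

Lemma dotBr u v w : dot w (u - v) = dot w u - dot w v.
Proof. by rewrite dotDr dotNr. Qed.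

Lemma dot0l u : dot 0 u = 0.
Proof. by rewrite -(scale0r u) dotZl mul0r. Qed.

Lemma dot0r u : dot u 0 = 0.
Proof. by rewrite dotC dot0l. Qed.

Definition dotE := (dotDl, dotDr, dotNl, dotNr, dotZl, dotZr, dot0l, dot0r).

Lemma dot_delta u i : dot (delta_mx 0 i) u = u 0 i.
Proof.
rewrite /dot (bigD1 i)//= mxE !eqxx mul1r big1 ?addr0// => j ji.
by rewrite mxE (negbTE ji) andbF mul0r.
Qed.

Lemma dot_mulmx u v : dot u v = (u *m v^T) 0 0.
Proof. by rewrite mxE; apply: eq_bigr => i _; rewrite mxE. Qed.

Lemma dot_mulmxl u v (A : 'M[R]_n) : dot (u *m A) v = dot u (v *m A^T).
Proof. by rewrite !dot_mulmx trmx_mul trmxK mulmxA. Qed.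

Lemma norm_entry m k (A : 'M[R]_(m, k)) i j : `|A i j| <= `|A|.
Proof.
rewrite [leRHS]/Num.Def.normr/= mx_normrE.
exact: (@le_bigmax _ _ _ 0 (fun ij : 'I_m * 'I_k => `|A ij.1 ij.2|) (i, j)).
Qed.

Lemma norm_coord u i : `|u 0 i| <= `|u|.
Proof. exact: norm_entry. Qed.

Lemma normm_le m (M : 'M[R]_(m, n)) (e : R) : 0 <= e ->
  (forall i j, `|M i j| <= e) -> `|M| <= e.
Proof.
move=> e0 Me; rewrite [leLHS]/Num.Def.normr/= mx_normrE.
by apply/bigmax_leP; split => // -[i j] _; exact: Me.
Qed.

Lemma norm_dot u v : `|dot u v| <= n%:R * `|u| * `|v|.
Proof.
rewrite (le_trans (ler_norm_sum _ _ _))//.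
rewrite (@le_trans _ _ (\sum_(i < n) `|u| * `|v|))//.
  by apply: ler_sum => i _; rewrite normrM ler_pM ?norm_coord.
by rewrite sumr_const card_ord -mulrA mulr_natl.
Qed.

Lemma dotvv_ge0 u : 0 <= dot u u.
Proof. by apply: sumr_ge0 => i _; rewrite -expr2 sqr_ge0. Qed.

Lemma sqr_norm_le u : `|u| ^+ 2 <= dot u u.
Proof.
suff : `|u| <= Num.sqrt (dot u u).
  by move=> h; rewrite -[leRHS]sqr_sqrtr ?dotvv_ge0// ler_sqr ?nnegrE ?sqrtr_ge0.
apply: normm_le; first exact: sqrtr_ge0.
move=> i j; rewrite ord1 -sqrtr_sqr ler_sqrt ?dotvv_ge0// /dot (bigD1 j)//= expr2.
by rewrite lerDl sumr_ge0// => k _; rewrite -expr2 sqr_ge0.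
Qed.

Lemma norm_enorm u : `|u| <= enorm u.
Proof.
rewrite -(@ler_pXn2r _ 2) ?nnegrE ?sqrtr_ge0//.
by rewrite sqr_sqrtr ?dotvv_ge0// sqr_norm_le.
Qed.

Lemma enorm_le u : enorm u <= n%:R * `|u|.
Proof.
rewrite -(@ler_pXn2r _ 2) ?nnegrE ?sqrtr_ge0 ?mulr_ge0//.
rewrite sqr_sqrtr ?dotvv_ge0// (le_trans (ler_norm _))// (le_trans (norm_dot _ _))//.
rewrite exprMn -mulrA -expr2 ler_wpM2r ?sqr_ge0//.
case: n => [|k]; first by rewrite expr0n.
by rewrite ler_eXnr// ler1n.
Qed.

End Dot.

Section DotCvg.
Context {R : realType} {n : nat}.

Lemma cvg_mx m k (T : Type) (F : set_system T) {FF : Filter F}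
    (M : T -> 'M[R]_(m, k)) (A : 'M[R]_(m, k)) :
  (forall i j, M x i j @[x --> F] --> A i j) -> M @ F --> A.
Proof.
move=> cM; apply/cvgrPdist_le => e e0.
have : \forall x \near F, forall i j, `|A i j - M x i j| <= e.
  apply: filter_forall => i; apply: filter_forall => j.
  by have /cvgrPdist_le /(_ e e0) := cM i j.
apply: filterS => x h; apply: normm_le; first exact: ltW.
by move=> i j; rewrite !mxE; exact: h.
Qed.

Lemma cvg_coord m k (T : Type) (F : set_system T) {FF : Filter F}
    (M : T -> 'M[R]_(m, k)) (A : 'M[R]_(m, k)) i j :
  M @ F --> A -> M x i j @[x --> F] --> A i j.
Proof.
move=> cM; have := @coord_continuous _ m k i j A.
by move=> /(@continuous_cvg _ _ _ F FF M _ A); apply.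
Qed.

Lemma cvg_dot (T : Type) (F : set_system T) {FF : Filter F}
    (f g : T -> 'rV[R]_n) (u v : 'rV[R]_n) :
  f @ F --> u -> g @ F --> v -> dot (f x) (g x) @[x --> F] --> dot u v.
Proof.
move=> fu gv; apply: cvg_big => [|i _]; first exact: add_continuous.
by apply: cvgM; exact: cvg_coord.
Qed.

Lemma cvg_dotl (T : Type) (F : set_system T) {FF : Filter F} (w : 'rV[R]_n)
    (f : T -> 'rV[R]_n) (u : 'rV[R]_n) :
  f @ F --> u -> dot w (f x) @[x --> F] --> dot w u.
Proof. by move=> fu; apply: (@cvg_dot _ _ _ (cst w)) => //; exact: cvg_cst. Qed.

Lemma cvg_dotr (T : Type) (F : set_system T) {FF : Filter F} (w : 'rV[R]_n)
    (f : T -> 'rV[R]_n) (u : 'rV[R]_n) :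
  f @ F --> u -> dot (f x) w @[x --> F] --> dot u w.
Proof. by move=> fu; apply: (@cvg_dot _ _ _ f (cst w)) => //; exact: cvg_cst. Qed.

Lemma cvg_mulmxl (T : Type) (F : set_system T) {FF : Filter F} (v : 'rV[R]_n)
    (M : T -> 'M[R]_n) (A : 'M[R]_n) :
  M @ F --> A -> v *m M x @[x --> F] --> v *m A.
Proof.
move=> cM; apply: cvg_mx => i j; rewrite mxE.
rewrite [X in X @ _](_ : _ = fun x => \sum_k v i k * M x k j); last first.
  by rewrite funeqE => x; rewrite mxE.
apply: cvg_big => [|k _]; first exact: add_continuous.
by apply: cvgMl_tmp; exact: cvg_coord.
Qed.

End DotCvg.

Section Calculus.
Context {R : realType}.

Definition continuous_linear (V W : normedModType R) (L : V -> W) : Prop :=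
  linear L /\ continuous L.

Lemma continuous_linear_diff (V W : normedModType R) (L : V -> W) x :
  continuous_linear L -> differentiable L x /\ 'd L x = L :> (V -> W).
Proof.
move=> [linL cL]; pose L' : {linear V -> W} :=
  HB.pack L (GRing.isLinear.Build _ _ _ _ _ linL).
have -> : L = L' by [].
by split; [exact: linear_differentiable|exact: diff_lin].
Qed.

Lemma derive_comp_linear (U V W : normedModType R) (L : U -> V) (f : V -> W) v x :
  continuous_linear L -> differentiable f (L x) ->
  'D_v (f \o L) x = 'D_(L v) f (L x).
Proof.
move=> linL df; have [dL dLE] := continuous_linear_diff x linL.
by rewrite !deriveE//; [rewrite diff_comp//= dLE|exact: differentiable_comp].
Qed.

Lemma derive_linear_comp (U V W : normedModType R) (L : V -> W) (f : U -> V) v x :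
  continuous_linear L -> differentiable f x ->
  'D_v (L \o f) x = L ('D_v f x).
Proof.
move=> linL df; have [dL dLE] := continuous_linear_diff (f x) linL.
by rewrite !deriveE//; [rewrite diff_comp//= dLE|exact: differentiable_comp].
Qed.

Lemma coord_linear m n i j :
  continuous_linear (fun M : 'M[R]_(m, n) => M i j).
Proof.
by split; [move=> a u v; rewrite !mxE|exact: coord_continuous].
Qed.

Lemma Ck_pred (V W : normedModType R) k (f : V -> W) : Ck k.+1 f -> Ck k f.
Proof.
elim: k f => [|k IH] f /= [df Df]; first by move=> x; exact: differentiable_continuous.
by split=> // v; apply: IH; exact: Df.
Qed.

Lemma Ck_continuous (V W : normedModType R) k (f : V -> W) : Ck k f -> continuous f.
Proof. by elim: k f => //= k IH f /Ck_pred /IH. Qed.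

Lemma Ck_cst (V W : normedModType R) k (a : W) : Ck k (cst a : V -> W).
Proof.
elim: k a => [|k IH] a /=; first by move=> x; exact: cvg_cst.
split=> // v.
by rewrite (_ : (fun x => _) = cst 0) ?funeqE// => x; rewrite derive_cst.
Qed.

Lemma CkD (V W : normedModType R) k (f g : V -> W) :
  Ck k f -> Ck k g -> Ck k (fun x => f x + g x).
Proof.
elim: k f g => [|k IH] f g /=; first by move=> cf cg x; apply: cvgD; [exact: cf|exact: cg].
move=> [df Df] [dg Dg]; split=> [x|v]; first exact: differentiableD.
rewrite (_ : (fun x => _) = (fun x => 'D_v f x + 'D_v g x)); first exact: IH.
by rewrite funeqE => x; rewrite deriveD//; exact: diff_derivable.
Qed.

Lemma CkM (V : normedModType R) k (f g : V -> R) :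
  Ck k f -> Ck k g -> Ck k (fun x => f x * g x).
Proof.
elim: k f g => [|k IH] f g; first by move=> cf cg x; apply: cvgM; [exact: cf|exact: cg].
move=> Cf Cg; have [df Df] := Cf; have [dg Dg] := Cg.
split=> [x|v]; first exact: differentiableM.
rewrite (_ : (fun x => _) = (fun x => f x * 'D_v g x + g x * 'D_v f x)).
  apply: CkD; apply: IH; [exact: Ck_pred|exact: Dg|exact: Ck_pred|exact: Df].
by rewrite funeqE => x; rewrite deriveM//; exact: diff_derivable.
Qed.

Lemma CkZ (V : normedModType R) k (f : V -> R) a :
  Ck k f -> Ck k (fun x => a * f x).
Proof. by move=> Cf; apply: CkM => //; exact: Ck_cst. Qed.

Lemma CkN (V : normedModType R) k (f : V -> R) :
  Ck k f -> Ck k (fun x => - f x).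
Proof.
move=> Cf; rewrite (_ : (fun x => _) = (fun x => -1 * f x)); first exact: CkZ.
by rewrite funeqE => x; rewrite mulN1r.
Qed.

Lemma Ck_sum (V : normedModType R) k (I : Type) (r : seq I) (f : I -> V -> R) :
  (forall i, Ck k (f i)) -> Ck k (fun x => \sum_(i <- r) f i x).
Proof.
move=> Cf; elim: r => [|i r IH].
  by rewrite (_ : (fun x => _) = cst 0) ?funeqE ?big_nil//; [exact: Ck_cst|move=> x; rewrite big_nil].
rewrite (_ : (fun x => _) = (fun x => f i x + \sum_(i <- r) f i x)); first exact: CkD.
by rewrite funeqE => x; rewrite big_cons.
Qed.

Lemma Ck_linear (V W : normedModType R) k (L : V -> W) :
  continuous_linear L -> Ck k L.
Proof.
move=> linL; case: k => [|k] /=; first by case: linL.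
split=> [x|v]; first by have [] := continuous_linear_diff x linL.
rewrite (_ : (fun x => _) = cst (L v)); first exact: Ck_cst.
rewrite funeqE => x; have [dL dLE] := continuous_linear_diff x linL.
by rewrite deriveE// dLE.
Qed.

Lemma Ck_comp_linear (U V W : normedModType R) k (L : U -> V) (f : V -> W) :
  continuous_linear L -> Ck k f -> Ck k (f \o L).
Proof.
move=> linL; elim: k f => [|k IH] f /=.
  by move=> cf x; apply: continuous_comp; [case: linL => _; exact|exact: cf].
move=> [df Df]; split=> [x|v].
  apply: differentiable_comp => //.
  by have [] := continuous_linear_diff x linL.
rewrite (_ : (fun x => _) = ('D_(L v) f) \o L); first exact: (IH _ (Df _)).
by rewrite funeqE => x; rewrite derive_comp_linear.
Qed.

Lemma Ck_linear_comp (U V W : normedModType R) k (L : V -> W) (f : U -> V) :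
  continuous_linear L -> Ck k f -> Ck k (L \o f).
Proof.
move=> linL; elim: k f => [|k IH] f /=.
  by move=> cf x; apply: continuous_comp; [exact: cf|case: linL => _; exact].
move=> [df Df]; split=> [x|v].
  apply: differentiable_comp => //.
  by have [] := continuous_linear_diff (f x) linL.
rewrite (_ : (fun x => _) = L \o ('D_v f)); first exact: (IH _ (Df _)).
by rewrite funeqE => x; rewrite derive_linear_comp.
Qed.

Lemma mean_value (V : normedModType R) (f : V -> R) (x v : V) :
  (forall y, differentiable f y) ->
  exists t : R, 0 < t < 1 /\ f (x + v) - f x = 'D_v f (x + t *: v).
Proof.
move=> df; pose g (t : R) := f (x + t *: v).
have dline (t0 : R) : is_diff t0 (fun t : R => x + t *: v) (fun t : R => t *: v).
  have := @is_diffD _ _ _ (cst x) (fun t : R => t *: v) 0 (fun t : R => t *: v) t0 (is_diff_cst _ _) (is_diff_scalel _ _).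
  by rewrite add0r.
have Dg (t : R) : is_derive t 1 g ('D_v f (x + t *: v)).
  have dg : differentiable g t.
    by apply: (@differentiable_comp _ _ _ _ (fun t : R => x + t *: v) f).
  apply: DeriveDef; first exact: diff_derivable.
  rewrite deriveE// (@diff_comp _ _ _ _ (fun t : R => x + t *: v) f)//=.
  by rewrite diff_val scale1r deriveE.
have cg : {within `[0, 1], continuous g}.
  apply: continuous_subspaceT => t.
  by apply: differentiable_continuous; apply/derivable1_diffP; have [] := Dg t.
have [t] := @MVT R g (fun s => 'D_v f (x + s *: v)) 0 1 ltr01 (fun t _ => Dg t) cg.
rewrite in_itv/= subr0 mulr1 => t01 E; exists t; split => //.
by rewrite -E /g scale0r scale1r addr0.
Qed.

End Calculus.

Section Gradient.
Context {R : realType} {n : nat}.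
Implicit Types (f g : 'rV[R]_n -> R) (x u v : 'rV[R]_n).

Lemma dot_linear u : continuous_linear (dot u : 'rV[R]_n -> R).
Proof.
split; first by move=> a v w; rewrite dotDr dotZr.
by move=> x; apply: (@cvg_dot _ _ _ (nbhs x) _ (cst u) id); [exact: cvg_cst|exact: cvg_id].
Qed.

Lemma derive_grad f x v : differentiable f x -> 'D_v f x = dot v (grad f x).
Proof.
move=> df; rewrite deriveE// [in LHS](row_sum_delta v) linear_sum/=.
by apply: eq_bigr => i _; rewrite linearZ/= mxE deriveE.
Qed.

Lemma grad_unique f x (p : 'rV[R]_n) :
  (forall v, 'D_v f x = dot v p) -> grad f x = p.
Proof. by move=> h; apply/rowP => i; rewrite mxE h dot_delta. Qed.

Lemma derive_hess f x u v : Ck 2 f ->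
  'D_u (fun z => 'D_v f z) x = dot (u *m hess f x) v.
Proof.
move=> [df Df].
have -> : (fun z => 'D_v f z) =
    (fun z => \sum_(j < n) v 0 j * 'D_(delta_mx 0 j) f z).
  rewrite funeqE => z; rewrite derive_grad//; apply: eq_bigr => j _.
  by rewrite mxE.
pose g (j : 'I_n) z := v 0 j * 'D_(delta_mx 0 j) f z.
have dg j z : differentiable (g j) z.
  by have [] : Ck 1 (g j) by apply: CkZ; exact: Df.
rewrite (_ : (fun z => _) = \sum_(j < n) g j); last by rewrite funeqE => z; rewrite fct_sumE.
rewrite derive_sum => [|j]; last exact: diff_derivable.
apply: eq_bigr => j _; rewrite /g.
have dDj z : differentiable ('D_(delta_mx 0 j) f) z by have [] := Df (delta_mx 0 j).
rewrite deriveMl; last exact: diff_derivable.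
rewrite mulrC; congr (_ * _); rewrite derive_grad// !mxE.
by apply: eq_bigr => i _; rewrite !mxE.
Qed.

Lemma hess_unique f x (X : 'M[R]_n) :
  (forall u v, 'D_u (fun z => 'D_v f z) x = dot (u *m X) v) -> hess f x = X.
Proof.
move=> h; apply/matrixP => i j; rewrite mxE h dotC dot_delta -rowE mxE.
by [].
Qed.

Lemma grad_continuous f : Ck 1 f -> continuous (grad f).
Proof.
move=> [_ Df] x; apply: (@cvg_mx _ _ _ _ (nbhs x)) => i j.
rewrite [X in X @ _](_ : _ = 'D_(delta_mx 0 j) f) ?mxE; first exact: Df.
by rewrite funeqE => y; rewrite mxE.
Qed.

Lemma hess_continuous f : Ck 2 f -> continuous (hess f).
Proof.
move=> [_ Df] x; apply: (@cvg_mx _ _ _ _ (nbhs x)) => i j.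
have [_ DDf] := Df (delta_mx 0 j).
rewrite [X in X @ _](_ : _ = 'D_(delta_mx 0 i) ('D_(delta_mx 0 j) f)) ?mxE.
  exact: DDf.
by rewrite funeqE => y; rewrite mxE.
Qed.

Lemma line_cvg x v : x + t *: v @[t --> (0 : R)] --> x.
Proof.
rewrite -[X in _ --> X]addr0; apply: cvgD; first exact: cvg_cst.
by rewrite -[X in _ --> X](scale0r v); apply: cvgZr_tmp; exact: cvg_id.
Qed.

Lemma line_near x v (P : set 'rV[R]_n) : (\forall y \near x, P y) ->
  \forall s \near 0^'+, forall t, 0 < t <= s -> P (x + t *: v).
Proof.
move=> /(line_cvg v) /nbhs_ballP[e /= e0 h].
near=> s => t /andP[t0 ts]; apply: h => /=.
by rewrite /ball/= sub0r normrN gtr0_norm// (le_lt_trans ts).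
Unshelve. all: by end_near. Qed.

Lemma derive_ge0_at f x v : Ck 1 f ->
  (\forall t \near 0^'+, f x <= f (x + t *: v)) -> 0 <= dot v (grad f x).
Proof.
move=> Cf fx; have [df Df] := Cf; rewrite leNgt; apply/negP => neg.
have /(line_near v) near_neg : \forall y \near x, dot v (grad f y) < 0.
  have : dot v (grad f y) @[y --> x] --> dot v (grad f x).
    have cg : grad f y @[y --> x] --> grad f x := @grad_continuous f Cf x.
    exact: (cvg_dotl cg).
  by move=> /cvgr_lt; exact.
near (0 : R)^'+ => s.
have s0 : 0 < s by [].
have := near fx s; have := near near_neg s.
have [t [/andP[t0 t1] E]] := mean_value x (s *: v) df.
move=> /(_ _) h /(_ _) fs.
have : f x <= f (x + s *: v) by apply: fs.
rewrite -subr_ge0 E derive_grad// dotZl pmulr_rge0// scalerA leNgt h//.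
by rewrite mulr_gt0//= ler_piMl// ltW.
Unshelve. all: by end_near. Qed.

Lemma derive_eq0_at_min f x : Ck 1 f -> (\forall y \near x, f x <= f y) ->
  grad f x = 0.
Proof.
move=> Cf fx; apply/rowP => i.
have ge0 v : 0 <= dot v (grad f x).
  apply: derive_ge0_at => //; have /(line_near v) h := fx.
  by near=> s; have := near h s; apply => //; rewrite lexx andbT.
apply/eqP; rewrite -dot_delta mxE eq_le ge0 andbT -oppr_ge0 -dotNl.
exact: ge0.
Unshelve. all: by end_near. Qed.

(** The mean value theorem, applied once to [f] and once to its derivative along
    [v], produces a strict decrease near [x] if the second derivative is negative. *)
Lemma hess_ge0_at_min f x v : Ck 2 f -> (\forall y \near x, f x <= f y) ->
  0 <= dot (v *m hess f x) v.
Proof.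
move=> Cf fx; have [df Df] := Cf; have C1f := Ck_pred Cf.
rewrite leNgt; apply/negP => neg.
have /(line_near v) near_neg : \forall y \near x, dot (v *m hess f y) v < 0.
  have : dot (v *m hess f y) v @[y --> x] --> dot (v *m hess f x) v.
    have ch : hess f y @[y --> x] --> hess f x := @hess_continuous f Cf x.
    exact: (cvg_dotr (cvg_mulmxl ch)).
  by move=> /cvgr_lt; exact.
have /(line_near v) near_min := fx.
near (0 : R)^'+ => s.
have s0 : 0 < s by [].
have h1 : forall t, 0 < t <= s -> dot (v *m hess f (x + t *: v)) v < 0 by near: s.
have h2 : forall t, 0 < t <= s -> f x <= f (x + t *: v) by near: s.
have [t [/andP[t0 t1] E]] := mean_value x (s *: v) df.
have [w wE] : exists w, w = t *: (s *: v) by exists (t *: (s *: v)).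
rewrite -wE in E; have [dDf _] := Df v.
have [r [/andP[r0 r1] E']] := mean_value x w dDf.
have D0 : 'D_v f x = 0.
  by apply: etrans (derive_grad _ (df _)) _; rewrite (derive_eq0_at_min C1f)// dot0r.
have Dv_neg : 'D_v f (x + w) < 0.
  have sub0 (a b : R) : b = 0 -> a - b = a by move=> ->; rewrite subr0.
  have -> := etrans (esym (sub0 _ _ D0)) (etrans E' (derive_hess _ _ _ Cf)).
  rewrite wE !scalerA -scalemxAl dotZl pmulr_rlt0; last by rewrite mulr_gt0.
  apply: h1; clear neg.
  have ts : t * s <= s by rewrite ler_piMl// ltW.
  have rts : r * (t * s) <= t * s by rewrite ler_piMl ?mulr_ge0// ltW.
  by rewrite !mulr_gt0//=; lra.
have := h2 s; rewrite s0 lexx => /(_ isT).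
rewrite -subr_ge0 E; apply/negP; rewrite -ltNge.
have -> : 'D_(s *: v) f (x + w) = s * 'D_v f (x + w).
  apply: etrans (derive_grad _ (df _)) _; rewrite dotZl; congr (_ * _).
  exact: esym (derive_grad _ (df _)).
by rewrite pmulr_rlt0.
Unshelve. all: by end_near. Qed.

Lemma derive_translate f x u v : 'D_u (fun y => f (y + v)) x = 'D_u f (x + v).
Proof.
rewrite /derive; set g1 := fun h : R => _; set g2 := fun h : R => _.
by suff -> : g1 = g2 by []; rewrite funeqE => h; rewrite /g1 /g2 /= addrA.
Qed.

Lemma second_difference f x u v (s : R) : Ck 2 f -> 0 < s ->
  exists a b, [/\ 0 < a < 1, 0 < b < 1 &
    f (x + s *: u + s *: v) - f (x + s *: u) - (f (x + s *: v) - f x) =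
    s ^+ 2 * dot (v *m hess f (x + (a * s) *: u + (b * s) *: v)) u].
Proof.
move=> Cf s0; have [df Df] := Cf.
pose g y := f (y + s *: v) - f y.
have dg y : differentiable g y.
  apply: differentiableB => //.
  by apply: (@differentiable_comp _ _ _ _ (fun y => y + s *: v)).
have [a [a01 E]] := mean_value x (s *: u) dg.
have [dDuf _] := Df (s *: u).
have [b [b01 E']] := mean_value (x + a *: (s *: u)) (s *: v) dDuf.
exists a, b; split => //.
rewrite (_ : f _ - _ - _ = g (x + s *: u) - g x); last by rewrite /g; ring.
rewrite E /g deriveB; [|apply: diff_derivable..] => //; last first.
  by apply: (@differentiable_comp _ _ _ _ (fun y => y + s *: v)).
rewrite derive_translate E' derive_hess// !scalerA -scalemxAl dotZl dotZr mulrA.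
by rewrite expr2.
Qed.

(** Both mixed derivatives are limits of the same second difference quotient. *)
Lemma hess_sym f x : Ck 2 f -> (hess f x)^T = hess f x.
Proof.
move=> Cf.
suff sym u v : dot (v *m hess f x) u = dot (u *m hess f x) v.
  apply/matrixP => i j; rewrite mxE.
  by have := sym (delta_mx 0 i) (delta_mx 0 j); rewrite !(dotC (_ *m _)) !dot_delta -!rowE !mxE.
apply/eqP; rewrite -subr_eq0 -normr_le0; apply/ler_addgt0Pr => e e0.
have cont w z : \forall y \near x, `|dot (w *m hess f x) z - dot (w *m hess f y) z| < e / 2.
  have : dot (w *m hess f y) z @[y --> x] --> dot (w *m hess f x) z.
    have ch : hess f y @[y --> x] --> hess f x := @hess_continuous f Cf x.
    exact: (cvg_dotr (cvg_mulmxl ch)).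
  by move=> /cvgrPdist_lt; apply; rewrite divr_gt0.
have /nbhs_ballP[d /= d0 near_d] : \forall y \near x,
    `|dot (u *m hess f x) v - dot (u *m hess f y) v| < e / 2 /\
    `|dot (v *m hess f x) u - dot (v *m hess f y) u| < e / 2.
  near=> y; split; near: y; exact: cont.
have [s sE] : exists s : R, s = d / (`|u| + `|v| + 1) by eexists.
have den0 : 0 < `|u| + `|v| + 1 by rewrite ltr_wpDl// addr_ge0.
have s0 : 0 < s by rewrite sE divr_gt0.
have close a b : 0 < a < 1 -> 0 < b < 1 -> ball x d (x + (a * s) *: u + (b * s) *: v).
  move=> /andP[a0 a1] /andP[b0 b1].
  rewrite -ball_normE/= -addrA opprD addrA subrr sub0r normrN.
  apply: le_lt_trans (ler_normD _ _) _; rewrite (normrZ (a * s)) (normrZ (b * s)) !normrM.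
  rewrite (gtr0_norm a0) (gtr0_norm b0) (gtr0_norm s0).
  have -> : d = s * `|u| + s * `|v| + s.
    by rewrite -!mulrDr -[X in _ + X]mulr1 -mulrDr sE divfK// gt_eqF.
  have au : a * s * `|u| <= s * `|u|.
    by rewrite -mulrA ler_piMl ?mulr_ge0// ltW.
  have bv : b * s * `|v| <= s * `|v|.
    by rewrite -mulrA ler_piMl ?mulr_ge0// ltW.
  by lra.
have [a [b [a01 b01 E]]] := second_difference x u v Cf s0.
have [a' [b' [a'01 b'01 E']]] := second_difference x v u Cf s0.
have := close _ _ a01 b01 => /near_d[_ h].
have := close _ _ b'01 a'01 => /near_d[h' _].
have EE : dot (v *m hess f (x + (a * s) *: u + (b * s) *: v)) u =
          dot (u *m hess f (x + (b' * s) *: u + (a' * s) *: v)) v.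
  have s2 : s ^+ 2 != 0 by rewrite expf_eq0/= gt_eqF.
  apply: (mulfI s2); rewrite -E addrAC [X in hess f X]addrAC -E'.
  by rewrite [x + s *: v + s *: u]addrAC; ring.
have key (A B C D : R) : `|A - B| < e / 2 -> `|D - C| < e / 2 -> B = C ->
    `|A - D| <= e.
  move=> AB DC BC; rewrite (_ : A - D = (A - B) - (D - C)); last by rewrite BC; ring.
  by rewrite (le_trans (ler_normB _ _))// [e]splitr lerD// ltW.
rewrite add0r; exact: (key _ _ _ _ h h' EE).
Unshelve. all: by end_near. Qed.
End Gradient.

(** * Quadratic functions, the product space and compactness *)

Section Quadratic.
Context {R : realType} {n : nat}.
Implicit Types (f g : 'rV[R]_n -> R) (x u v p : 'rV[R]_n).

Lemma derive_linear (V W : normedModType R) (L : V -> W) (x v : V) :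
  continuous_linear L -> 'D_v L x = L v.
Proof.
by move=> linL; have [dL dLE] := continuous_linear_diff x linL; rewrite deriveE// dLE.
Qed.

Definition quad (c : R) p (lam : R) x : R := c + dot p x + lam * dot x x.

Lemma quad_Ck k c p lam : Ck k (quad c p lam).
Proof.
apply: CkD.
  by apply: CkD; [exact: Ck_cst|exact: (Ck_linear _ (dot_linear p))].
apply: CkZ; rewrite /dot; apply: Ck_sum => i.
by apply: CkM; exact: (Ck_linear _ (coord_linear 0 i)).
Qed.

Lemma derive_dotxx x v : 'D_v (fun y : 'rV[R]_n => dot y y) x = 2 * dot v x.
Proof.
pose g (i : 'I_n) (y : 'rV[R]_n) : R := y 0 i * y 0 i.
have dc (i : 'I_n) : derivable (fun y : 'rV[R]_n => y 0 i) x v.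
  exact/diff_derivable/differentiable_coord.
rewrite (_ : (fun y => _) = \sum_(i < n) g i); last by rewrite funeqE => y; rewrite fct_sumE.
rewrite derive_sum => [|i]; last by apply: derivableM.
rewrite /dot big_distrr/=; apply: eq_bigr => i _; rewrite /g deriveM//.
rewrite (derive_linear _ _ (coord_linear 0 i)) /GRing.scale/=; ring.
Qed.

Lemma derive_quad c p lam x v :
  'D_v (quad c p lam) x = dot v (p + (2 * lam) *: x).
Proof.
have dq : differentiable (fun y : 'rV[R]_n => dot y y) x.
  have [d _] : Ck 1 (fun y : 'rV[R]_n => dot y y); last exact: d.
  rewrite /dot; apply: Ck_sum => i.
  by apply: CkM; exact: (Ck_linear _ (coord_linear 0 i)).
have dl : differentiable (dot p) x by have [] := continuous_linear_diff x (dot_linear p).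
rewrite /quad deriveD; [|apply: derivableD|apply: derivableM] => //;
  try exact: diff_derivable.
rewrite deriveD//; last exact: diff_derivable.
rewrite derive_cst add0r (derive_linear _ _ (dot_linear p)).
rewrite deriveMl; last exact: diff_derivable.
rewrite derive_dotxx dotDr dotZr (dotC v p); ring.
Qed.

Lemma grad_quad c p lam x : grad (quad c p lam) x = p + (2 * lam) *: x.
Proof. by apply: grad_unique => v; exact: derive_quad. Qed.

Lemma hess_quad c p lam x : hess (quad c p lam) x = (2 * lam)%:M.
Proof.
apply: hess_unique => u v.
rewrite (_ : (fun z => _) = quad (dot v p) ((2 * lam) *: v) 0).
  by rewrite derive_quad mulr0 scale0r addr0 mul_mx_scalar dotZl dotZr.
rewrite funeqE => z; rewrite derive_quad dotDr /quad mul0r addr0 dotZr dotZl//.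
Qed.

Lemma gradD f g x : differentiable f x -> differentiable g x ->
  grad (fun y => f y + g y) x = grad f x + grad g x.
Proof.
move=> df dg; apply: grad_unique => v.
by rewrite deriveD; [rewrite dotDr !derive_grad|exact: diff_derivable..].
Qed.

Lemma gradN f x : differentiable f x -> grad (fun y => - f y) x = - grad f x.
Proof.
move=> df; apply: grad_unique => v.
by rewrite deriveN; [rewrite dotNr derive_grad|exact: diff_derivable].
Qed.

Lemma hessD f g x : Ck 2 f -> Ck 2 g ->
  hess (fun y => f y + g y) x = hess f x + hess g x.
Proof.
move=> Cf Cg; have [df Df] := Cf; have [dg Dg] := Cg.
apply: hess_unique => u v.
rewrite (_ : (fun z => _) = (fun z => 'D_v f z + 'D_v g z)); last first.
  by rewrite funeqE => z; rewrite deriveD//; exact: diff_derivable.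
have [dDf _] := Df v; have [dDg _] := Dg v.
rewrite deriveD; [|exact: diff_derivable..].
by rewrite !derive_hess// mulmxDr dotDl.
Qed.

Lemma hessN f x : Ck 2 f -> hess (fun y => - f y) x = - hess f x.
Proof.
move=> Cf; have [df Df] := Cf.
apply: hess_unique => u v.
rewrite (_ : (fun z => _) = (fun z => - 'D_v f z)); last first.
  by rewrite funeqE => z; rewrite deriveN//; exact: diff_derivable.
have [dDf _] := Df v.
rewrite deriveN; [|exact: diff_derivable].
by rewrite !derive_hess// mulmxN dotNl.
Qed.

End Quadratic.

Section ProductSpace.
Context {R : realType} {N : nat}.
Implicit Types (x v : 'rV[R]_N) (y : R) (z w : 'rV[R]_(N + 1)).

Lemma xpart_pt x y : xpart (pt x y) = x.
Proof. exact: row_mxKl. Qed.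

Lemma ypart_pt x y : ypart (pt x y) = y.
Proof. by rewrite /ypart row_mxKr mxE eqxx mulr1n. Qed.

Lemma pt_part z : pt (xpart z) (ypart z) = z.
Proof.
by rewrite /pt [X in row_mx _ X](_ : _ = rsubmx z) ?hsubmxK// [rsubmx z]mx11_scalar.
Qed.

Lemma dot_row_mx (a c : 'rV[R]_N) (b d : 'rV[R]_1) :
  dot (row_mx a b) (row_mx c d) = dot a c + b 0 0 * d 0 0.
Proof.
rewrite /dot big_split_ord/= big_ord1; congr (_ + _).
  by apply: eq_bigr => i _; rewrite !row_mxEl.
by rewrite !row_mxEr.
Qed.

Lemma dot_pt x y v (s : R) : dot (pt x y) (pt v s) = dot x v + y * s.
Proof.
by rewrite /pt dot_row_mx !mxE !eqxx !mulr1n.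
Qed.

Lemma xpart_linear : continuous_linear (@xpart R N).
Proof.
split=> [a u v|z]; first by rewrite /xpart linearP.
by apply: differentiable_continuous; exact: differentiable_lsubmx.
Qed.

Lemma ypart_linear : continuous_linear (@ypart R N).
Proof.
split=> [a u v|z]; first by rewrite /ypart linearP !mxE.
by apply: (@continuous_comp _ _ _ rsubmx (fun M : 'rV[R]_1 => M 0 0));
  [exact/differentiable_continuous/differentiable_rsubmx|exact: coord_continuous].
Qed.

Lemma norm_xpart z : `|xpart z| <= `|z|.
Proof.
apply: normm_le => // i j; rewrite ord1 mxE; exact: norm_coord.
Qed.

Lemma norm_ypart z : `|ypart z| <= `|z|.
Proof. by rewrite /ypart mxE; exact: norm_coord. Qed.

Lemma norm_pt_le z e : `|xpart z| <= e -> `|ypart z| <= e -> `|z| <= e.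
Proof.
move=> xe ye; apply: normm_le; first exact: le_trans xe.
move=> i j; rewrite ord1 -[z]pt_part /pt mxE; case: splitP => k _.
  by rewrite (le_trans _ xe)//; exact: norm_coord.
by rewrite ord1 mxE eqxx mulr1n.
Qed.

Lemma cvg_pt (T : Type) (F : set_system T) {FF : Filter F}
    (f : T -> 'rV[R]_N) (g : T -> R) x y :
  f @ F --> x -> g @ F --> y -> pt (f t) (g t) @[t --> F] --> pt x y.
Proof.
move=> fx gy; apply: cvg_mx => i j; rewrite ord1.
rewrite [X in _ --> X]mxE; case: splitP => k jk; rewrite ?ord1.
  rewrite [X in X @ _](_ : _ = fun t => f t 0 k).
    exact: cvg_coord.
  by rewrite funeqE => t; rewrite (_ : j = lshift 1 k) ?row_mxEl//; exact: val_inj.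
rewrite mxE eqxx mulr1n [X in X @ _](_ : _ = g)//.
rewrite funeqE => t; rewrite (_ : j = rshift N k) ?row_mxEr ?mxE ?ord1 ?eqxx//.
by apply: val_inj; rewrite /= jk ord1.
Qed.

Lemma cvg_xpart (z : 'rV[R]_(N + 1)) : xpart w @[w --> z] --> xpart z.
Proof. by have [_] := xpart_linear; exact. Qed.

Lemma cvg_ypart (z : 'rV[R]_(N + 1)) : ypart w @[w --> z] --> ypart z.
Proof. by have [_] := ypart_linear; exact. Qed.

(** The form of all test functions on the thin domain: as [y] is small, [Q] carries
    the vertical derivative and [s] the second vertical derivative.  The constant
    [c] will make the factor of [Q] positive. *)
Definition lift_fun (psi Q : 'rV[R]_N -> R) (c s : R) z : R :=
  psi (xpart z) + (ypart z - c) * Q (xpart z) + s / 2 * ypart z ^+ 2.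

Variables (psi Q : 'rV[R]_N -> R) (c s : R).
Hypotheses (Cpsi : Ck 2 psi) (CQ : Ck 2 Q).

Lemma lift_fun_Ck : Ck 2 (lift_fun psi Q c s).
Proof.
have Cy := Ck_linear 2 ypart_linear.
apply: CkD; last by apply: CkZ; apply: CkM.
apply: CkD; first exact: (Ck_comp_linear xpart_linear Cpsi).
apply: CkM; last exact: (Ck_comp_linear xpart_linear CQ).
by apply: (CkD Cy); exact: Ck_cst.
Qed.

Lemma is_derive_ypart w z : is_derive z w (@ypart R N) (ypart w).
Proof.
have [d _] := continuous_linear_diff z ypart_linear.
by apply: DeriveDef; [exact: diff_derivable|exact: derive_linear ypart_linear].
Qed.

Lemma is_derive_xpart (f : 'rV[R]_N -> R) w z :
  (forall x, differentiable f x) ->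
  is_derive z w (f \o xpart) ('D_(xpart w) f (xpart z)).
Proof.
move=> df; have [dx _] := continuous_linear_diff z xpart_linear.
apply: DeriveDef; last exact: (derive_comp_linear w xpart_linear (df _)).
exact: diff_derivable (differentiable_comp dx (df _)).
Qed.

Lemma derive_lift z w : 'D_w (lift_fun psi Q c s) z =
  'D_(xpart w) psi (xpart z) + (ypart z - c) * 'D_(xpart w) Q (xpart z)
  + ypart w * Q (xpart z) + ypart w * s * ypart z.
Proof.
have [dpsi _] := Cpsi; have [dQ _] := CQ.
have H := is_deriveD (is_deriveD (is_derive_xpart w z dpsi)
  (is_deriveM (is_deriveB (is_derive_ypart w z) (is_derive_cst c z w))
    (is_derive_xpart w z dQ)))
  (is_deriveZ (s / 2) (is_deriveM (is_derive_ypart w z) (is_derive_ypart w z))).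
apply: etrans (@derive_val _ _ _ _ _ _ _ H) _.
rewrite /GRing.scale /= !fctE/=.
by field.
Qed.

Lemma grad_lift z : grad (lift_fun psi Q c s) z =
  pt (grad psi (xpart z) + (ypart z - c) *: grad Q (xpart z))
     (Q (xpart z) + s * ypart z).
Proof.
have [dpsi _] := Cpsi; have [dQ _] := CQ.
apply: grad_unique => w; rewrite -[w in RHS]pt_part dot_pt derive_lift.
by rewrite dotDr dotZr !derive_grad//; ring.
Qed.

Lemma hess_lift z : hess (lift_fun psi Q c s) z =
  block_mx (hess psi (xpart z) + (ypart z - c) *: hess Q (xpart z))
    (grad Q (xpart z))^T (grad Q (xpart z)) s%:M.
Proof.
have [dpsi Dpsi] := Cpsi; have [dQ DQ] := CQ.
apply: hess_unique => u w.
have [dDp _] := Dpsi (xpart w); have [dDQ _] := DQ (xpart w).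
have H := is_deriveD (is_deriveD (is_deriveD (is_derive_xpart u z dDp)
  (is_deriveM (is_deriveB (is_derive_ypart u z) (is_derive_cst c z u))
    (is_derive_xpart u z dDQ)))
  (is_deriveZ (ypart w) (is_derive_xpart u z dQ)))
  (is_deriveZ (ypart w * s) (is_derive_ypart u z)).
have -> : (fun z => 'D_w (lift_fun psi Q c s) z) =
  (fun z => ('D_(xpart w) psi \o xpart) z + (ypart z - c) * ('D_(xpart w) Q \o xpart) z
    + ypart w * (Q \o xpart) z + ypart w * s * ypart z).
  by apply/funext => y; exact: derive_lift.
apply: etrans (@derive_val _ _ _ _ _ _ _ H) _.
rewrite /GRing.scale /= !fctE/=.
rewrite (derive_hess _ _ _ Cpsi) (derive_hess _ _ _ CQ) (derive_grad _ (dQ _)).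
rewrite (derive_grad _ (dQ _)).
move: (hess psi _) (hess Q _) (grad Q _) => h k g {H}.
rewrite -[in RHS](pt_part u) -[in RHS](pt_part w) /pt mul_row_block dot_row_mx.
have -> : ((ypart w)%:M : 'rV[R]_1) 0 0 = ypart w by rewrite mxE eqxx mulr1n.
have -> : (xpart u *m g^T + (ypart u)%:M *m s%:M) 0 0 = dot (xpart u) g + ypart u * s.
  by rewrite mxE -dot_mulmx mul_scalar_mx !mxE eqxx mulr1n.
rewrite mul_scalar_mx mulmxDr -scalemxAr.
by rewrite !dotDl !dotZl (dotC g); ring.
Qed.

End ProductSpace.

Section UniformLimits.
Context {R : realType}.

Lemma compact_uniform (V : normedModType R) (A : set V) (P : V -> V -> Prop) :
  compact A ->
  (forall a, A a -> \forall x \near a & y \near a, A x -> P x y) ->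
  \forall d \near 0^'+, forall x y, A x -> `|y - x| < d -> P x y.
Proof.
move=> /compact_near_coveringP/near_covering_withinP cA hP.
suff : \forall d \near (0 : R)^'+, A `<=` (fun x => forall y, `|y - x| < d -> P x y).
  by apply: filterS => d h x y Ax; exact: h.
apply: (cA _ _ (fun (d : R) x => forall y, `|y - x| < d -> P x y)) => a Aa.
have [[U1 U2] /= [/nbhs_ballP[r1 /= r10 h1] /nbhs_ballP[r2 /= r20 h2]] hU] := hP a Aa.
pose r := Num.min r1 (r2 / 2).
have r0 : 0 < r by rewrite lt_min r10 divr_gt0.
exists (ball a r, [set d | d < r2 / 2]).
  split; first exact: nbhsx_ballx.
  by apply: nbhs_right_lt; rewrite divr_gt0.
move=> [x d] /= [xr dr] Ax y yx; apply: (hU (x, y)) => //; split => /=.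
  by apply: h1; apply: le_ball xr; rewrite ge_min lexx.
apply: h2; rewrite -ball_normE/= -(subrKA x) [r2]splitr.
rewrite (le_lt_trans (ler_normD _ _))// ltrD// 1?distrC ?(lt_trans yx)//.
by move: xr; rewrite -ball_normE/= => xr; rewrite distrC (lt_le_trans xr)// ge_min lexx orbT.
Unshelve. all: by end_near. Qed.

Lemma usc_max (T : topologicalType) (K : set T) (f : T -> R) :
  compact K -> K !=set0 ->
  (forall z e, K z -> 0 < e -> \forall z' \near z, K z' -> f z' < f z + e) ->
  exists2 z0, K z0 & forall z, K z -> f z <= f z0.
Proof.
move=> /compact_near_coveringP/near_covering_withinP cK [z1 Kz1] usc.
apply: contrapT => nomax.
have {}nomax z : K z -> exists2 z', K z' & f z < f z'.
  move=> Kz; apply: contrapT => h; apply: nomax; exists z => // z' Kz'.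
  by rewrite leNgt; apply/negP => lt; apply: h; exists z'.
pose F := filter_from K (fun z => [set z' | K z' /\ f z <= f z']).
have FF : Filter F.
  apply: filter_from_filter; first by exists z1.
  move=> a b Ka Kb; have [ab|ba] := leP (f a) (f b).
    by exists b => // z [Kz bz]; split; split => //; exact: le_trans bz.
  by exists a => // z [Kz az]; split; split => //; rewrite (le_trans (ltW ba)).
have [z Kz h] : \forall i \near F, K `<=` (fun x => f x < f i).
  apply: (cK _ _ (fun i x => f x < f i)) => x Kx.
  have [x' Kx' xx'] := nomax x Kx.
  exists ([set z | K z -> f z < f x'], [set z' | K z' /\ f x' <= f z']).
    split; last by exists x'.
    have := usc x (f x' - f x) Kx; rewrite subr_gt0 => /(_ xx').
    by apply: filterS => y /= h /h; rewrite addrC subrK.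
  by move=> [a b] /= [ha [Kb xb]] Ka; rewrite (lt_le_trans (ha Ka)).
by have := h z (conj Kz (lexx _)) z Kz; rewrite ltxx.
Qed.

End UniformLimits.

(** * Semicontinuous envelopes, barriers and suprema of subsolutions *)

Lemma near_ball (R : realType) (V : normedModType R) (z : V) (P : V -> Prop) :
  (\forall y \near z, P y) -> exists2 r : R, 0 < r & forall y, `|y - z| < r -> P y.
Proof.
move=> /nbhs_ballP[r /= r0 h]; exists r => // y yz; apply: h.
by rewrite -ball_normE/= distrC.
Qed.

Section Envelope.
Context {R : realType} {n : nat}.
Implicit Types (K : set 'rV[R]_n) (u f phi : 'rV[R]_n -> R) (z : 'rV[R]_n) (e : R).

Lemma bounded_onP K u :
  [bounded u z | z in K] <-> exists M : R, forall z, K z -> `|u z| <= M.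
Proof.
split=> [bu|[M h]].
  near +oo_R => M; exists M => z Kz.
  have : globally K [set x | `|u x| <= M] by near: M.
  exact.
by exists M; split; [exact: num_real|move=> M' /ltW MM' z Kz; exact: le_trans (h z Kz) MM'].
Unshelve. all: by end_near. Qed.

Lemma limf_esup_fin K u z : [bounded u z | z in K] -> K z ->
  limf_esup (fun z => (u z)%:E) (within K (nbhs z)) \is a fin_num.
Proof.
move=> /bounded_onP[M hM] Kz; rewrite fin_real//; apply/andP; split.
  rewrite (@lt_le_trans _ _ ((- M)%:E))%E ?ltNyr//.
  apply: le_ereal_inf_tmp => _ [V /= /nbhs_singleton/(_ Kz) Vz <-].
  apply: le_ereal_sup_tmp; exists (u z)%:E; first by exists z.
  by rewrite lee_fin; have := hM _ Kz; rewrite ler_norml => /andP[].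
rewrite (@le_lt_trans _ _ M%:E)%E ?ltry//.
apply: ge_ereal_inf; exists (ereal_sup ((fun z => (u z)%:E) @` K)).
  by exists K => //; exact: withinT.
apply: ge_ereal_sup => _ [y Ky <-]; rewrite lee_fin.
by have := hM _ Ky; rewrite ler_norml => /andP[].
Qed.

Lemma usc_env_near K u z e : [bounded u z | z in K] -> K z -> 0 < e ->
  \forall y \near z, K y -> u y < usc_env K u z + e.
Proof.
move=> bu Kz e0; have fin := limf_esup_fin bu Kz.
have [_ [V /= nV <-] lt] := lb_ereal_inf_adherent e0 fin.
have nV' : \forall y \near z, K y -> V y by [].
apply: filterS nV' => y h Ky; rewrite -lte_fin EFinD /usc_env fineK//.
apply: le_lt_trans lt; apply: le_ereal_sup_tmp; exists (u y)%:E => //.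
by exists y => //; exact: h.
Qed.

Lemma usc_env_approx K u z e (P : set 'rV[R]_n) :
  [bounded u z | z in K] -> K z -> 0 < e -> (\forall y \near z, P y) ->
  exists y, [/\ P y, K y & usc_env K u z - e < u y].
Proof.
move=> bu Kz e0 nP; have fin := limf_esup_fin bu Kz.
apply: contrapT => h.
have : (usc_env K u z <= usc_env K u z - e)%R.
  rewrite -lee_fin {1}/usc_env fineK//.
  apply: ge_ereal_inf; exists (ereal_sup ((fun z => (u z)%:E) @` (P `&` K))).
    by exists (P `&` K) => //=; apply: filterS nP => y Py Ky.
  apply: ge_ereal_sup => _ [y [Py Ky] <-]; rewrite lee_fin leNgt.
  by apply/negP => lt; apply: h; exists y.
by lra.
Qed.

Lemma usc_env_ge K u z : [bounded u z | z in K] -> K z -> u z <= usc_env K u z.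
Proof.
move=> bu Kz; apply/ler_addgt0Pr => e e0.
by have /nbhs_singleton/(_ Kz)/ltW := usc_env_near bu Kz e0.
Qed.

Lemma usc_env_le K u z (c : R) : [bounded u z | z in K] -> K z ->
  (\forall y \near z, K y -> u y <= c) -> usc_env K u z <= c.
Proof.
move=> bu Kz h; apply/ler_addgt0Pr => e e0.
have [y [Py Ky lt]] := usc_env_approx bu Kz e0 h.
by rewrite -lerBlDr (le_trans (ltW lt))// Py.
Qed.

Lemma usc_env_usc K u z e : [bounded u z | z in K] -> K z -> 0 < e ->
  \forall y \near z, K y -> usc_env K u y < usc_env K u z + e.
Proof.
move=> bu Kz e0; have e20 : 0 < e / 2 by rewrite divr_gt0.
have /nbhs_interior := usc_env_near bu Kz e20.
apply: filterS => y h Ky; rewrite (@le_lt_trans _ _ (usc_env K u z + e / 2))//.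
  by apply: usc_env_le => //; apply: filterS h => x hx Kx; rewrite ltW ?hx.
by rewrite ltrD2l gtr_pMr// invf_lt1// ltr1n.
Qed.

Lemma usc_env_mono K u v z : [bounded u z | z in K] -> [bounded v z | z in K] ->
  K z -> (forall y, K y -> u y <= v y) -> usc_env K u z <= usc_env K v z.
Proof.
move=> bu bv Kz uv; apply/ler_addgt0Pr => e e0; apply: usc_env_le => //.
apply: filterS (usc_env_near bv Kz e0) => y h Ky.
by rewrite (le_trans (uv _ Ky))// ltW ?h.
Qed.

Lemma within_near K f z e : {within K, continuous f} -> K z -> 0 < e ->
  \forall y \near z, K y -> `|f z - f y| < e.
Proof.
move=> /subspace_continuousP cf Kz e0.
by have /cvgrPdist_lt /(_ e e0) := cf z Kz.
Qed.

Lemma bounded_onN K u : [bounded u z | z in K] -> [bounded - u z | z in K].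
Proof.
by move=> /bounded_onP[M h]; apply/bounded_onP; exists M => z /h; rewrite normrN.
Qed.

Lemma lsc_envE K u z : lsc_env K u z = - usc_env K (fun z => - u z) z.
Proof. by rewrite /lsc_env /usc_env /limf_einf fineN. Qed.

Definition opp_cond (E : 'M[R]_n -> 'rV[R]_n -> R -> 'rV[R]_n -> Prop) X p r z :=
  E (- X) (- p) (- r) z.

Lemma visc_superN K E u :
  visc_super K E u <-> visc_sub K (opp_cond E) (fun z => - u z).
Proof.
have envE z : usc_env K (fun z => - u z) z = - lsc_env K u z by rewrite lsc_envE opprK.
split=> -[bu h].
  split=> [|phi z0 Cphi Kz0 mx]; first exact: bounded_onN.
  have CN := CkN Cphi.
  have := h (fun z => - phi z) z0 CN Kz0; rewrite hessN// gradN; last by have [] := Cphi.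
  rewrite /opp_cond envE !opprK; apply => z Kz.
  by have := mx z Kz; rewrite !envE; lra.
split=> [|phi z0 Cphi Kz0 mx].
  by have := bounded_onN bu; under [fun z => - - u z]eq_fun do rewrite opprK.
have CN := CkN Cphi.
have := h (fun z => - phi z) z0 CN Kz0; rewrite hessN// gradN; last by have [] := Cphi.
rewrite /opp_cond envE !opprK; apply => z Kz.
by have := mx z Kz; rewrite !envE; lra.
Qed.

End Envelope.

Section Perron.
Context {R : realType} {n : nat}.
Implicit Types (K : set 'rV[R]_n) (u v f phi : 'rV[R]_n -> R) (z : 'rV[R]_n) (e : R).
Implicit Types E : 'M[R]_n -> 'rV[R]_n -> R -> 'rV[R]_n -> Prop.

(** Failure of [E] is an open condition on the jet: the only regularity of the
    equation and of the boundary conditions that enters the general theory. *)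
Definition stable_failure K E : Prop :=
  forall X p (r : R) z, symmx X -> K z -> ~ E X p r z ->
  exists2 d : R, 0 < d & forall X' p' (r' : R) z', symmx X' -> K z' ->
    `|X' - X| < d -> `|p' - p| < d -> `|r' - r| < d -> `|z' - z| < d ->
    ~ E X' p' r' z'.

(** A strict supersolution in a sense that survives minima: at each point [f] is
    touched from above by a smooth function violating the subsolution condition,
    also for every larger value of the unknown.  Subsolutions are compared with it
    directly through the touching functions. *)
Definition upper_barrier K E f : Prop := {within K, continuous f} /\
  forall z0, K z0 -> exists w : 'rV[R]_n -> R, [/\ Ck 2 w, forall z, K z -> f z <= w z,
    w z0 = f z0 & forall r, f z0 <= r -> ~ E (hess w z0) (grad w z0) r z0].

(** Below the obstacle [g] nothing is required, so that a lower barrier, which need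
    not be a subsolution, belongs to the class over which Perron's supremum runs. *)
Definition sub_above K E g v : Prop := [bounded v z | z in K] /\
  forall phi z0, Ck 2 phi -> K z0 ->
    (forall z, K z -> usc_env K v z - phi z <= usc_env K v z0 - phi z0) ->
    g z0 < usc_env K v z0 ->
    E (hess phi z0) (grad phi z0) (usc_env K v z0) z0.

(** At a maximum point of the envelope of [v] minus [f] the function touching [f]
    also touches [v], so the maximum cannot be nonnegative. *)
Lemma sub_above_lt_barrier K E g f v : compact K -> upper_barrier K E f ->
  sub_above K E g v -> (forall z, K z -> g z < f z) ->
  forall z, K z -> usc_env K v z < f z.
Proof.
move=> cK [cf hf] [bv hv] gf z Kz.
have [z0 Kz0 mx] : exists2 z0, K z0 &
    forall z, K z -> usc_env K v z - f z <= usc_env K v z0 - f z0.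
  apply: usc_max => //; first by exists z.
  move=> y e Ky e0; have e20 : 0 < e / 2 by rewrite divr_gt0.
  have h1 := within_near cf Ky e20; have h2 := usc_env_usc bv Ky e20.
  apply: filterS2 h1 h2 => y' h1 h2 Ky'; have := h1 Ky'; have := h2 Ky'.
  by rewrite ltr_norml => ? /andP[? ?]; lra.
rewrite -subr_lt0 (le_lt_trans (mx z Kz))// subr_lt0 ltNge; apply/negP => fv.
have [w [Cw fw wf nE]] := hf z0 Kz0.
apply: (nE _ fv); apply: hv => //; last exact: lt_le_trans (gf _ Kz0) fv.
by move=> y Ky; rewrite wf (le_trans _ (mx y Ky))// lerB ?fw.
Qed.

Lemma lower_barrier_lt K E f u : compact K ->
  upper_barrier K (opp_cond E) (fun z => - f z) ->
  visc_super K E u -> forall z, K z -> f z < lsc_env K u z.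
Proof.
move=> cK bf /visc_superN[bu hu] z Kz; rewrite lsc_envE ltrNr.
apply: (sub_above_lt_barrier (g := fun z => - f z - 1) cK bf) => //.
  by split => // phi z0 Cphi Kz0 mx _; exact: hu.
by move=> y _; lra.
Qed.

Lemma visc_sub_lt_barrier K E f u : compact K -> upper_barrier K E f ->
  visc_sub K E u -> forall z, K z -> usc_env K u z < f z.
Proof.
move=> cK bf [bu hu] z Kz.
apply: (sub_above_lt_barrier (g := fun z => f z - 1) cK bf) => //.
  by split => // phi z0 Cphi Kz0 mx _; exact: hu.
by move=> y _; lra.
Qed.

Definition bowl z0 (sg k : R) z : R := sg * dot (z - z0) (z - z0) + k.

Lemma bowlE z0 sg k : bowl z0 sg k = quad (sg * dot z0 z0 + k) ((- 2 * sg) *: z0) sg.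
Proof.
rewrite funeqE => z; rewrite /bowl /quad !dotE (dotC z z0); ring.
Qed.

Lemma bowl_Ck m z0 sg k : Ck m (bowl z0 sg k).
Proof. by rewrite bowlE; exact: quad_Ck. Qed.

Lemma grad_bowl z0 sg k z : grad (bowl z0 sg k) z = (2 * sg) *: (z - z0).
Proof. by rewrite bowlE grad_quad mulNr scaleNr addrC scalerBr. Qed.

Lemma hess_bowl z0 sg k z : hess (bowl z0 sg k) z = (2 * sg)%:M.
Proof. by rewrite bowlE hess_quad. Qed.

Lemma bowl_at z0 sg k : bowl z0 sg k z0 = k.
Proof. by rewrite /bowl subrr dot0l mulr0 add0r. Qed.

Lemma norm_scalar_mx (a : R) : `|a%:M : 'M[R]_n| <= `|a|.
Proof.
by apply: normm_le => // i j; rewrite mxE; case: eqP => _; rewrite ?mulr1n ?mulr0n ?normr0.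
Qed.

(** A paraboloid flat enough makes an extremum strict without leaving the
    neighbourhood of the jet where a condition fails. *)
Lemma perturb_close phi z0 (d : R) : Ck 2 phi -> 0 < d ->
  exists eta r : R, [/\ 0 < eta, 0 < r, r <= d & forall sg k z, `|sg| <= eta ->
    `|z - z0| < r ->
    [/\ `|hess (fun z => phi z + bowl z0 sg k z) z - hess phi z0| < d,
        `|grad (fun z => phi z + bowl z0 sg k z) z - grad phi z0| < d &
        `|phi z - phi z0| < d / 4]].
Proof.
move=> Cphi d0; have d20 : 0 < d / 2 by rewrite divr_gt0.
have d40 : 0 < d / 4 by rewrite divr_gt0.
have [dphi _] := Cphi; have C1 := Ck_pred Cphi.
have h1 : \forall z \near z0, `|hess phi z0 - hess phi z| < d / 2.
  by have /cvgrPdist_lt := @hess_continuous _ _ _ Cphi z0; exact.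
have h2 : \forall z \near z0, `|grad phi z0 - grad phi z| < d / 2.
  by have /cvgrPdist_lt := @grad_continuous _ _ _ C1 z0; exact.
have h3 : \forall z \near z0, `|phi z0 - phi z| < d / 4.
  by have /cvgrPdist_lt := @Ck_continuous _ _ _ _ _ Cphi z0; exact.
have [r r0 h] := near_ball (filterI h1 (filterI h2 h3)).
exists (d / 8), (Num.min (Num.min r 1) d); split.
- by rewrite divr_gt0.
- by rewrite !lt_min r0 d0 ltr01.
- by rewrite ge_min lexx orbT.
move=> sg k z sgd; rewrite !lt_min => /andP[/andP[zr z1] zd].
have [h1z [h2z h3z]] : (`|hess phi z0 - hess phi z| < d / 2 /\
   `|grad phi z0 - grad phi z| < d / 2 /\ `|phi z0 - phi z| < d / 4).
  exact: h.
have split_lt (a b : R) : a < d / 2 -> b <= d / 2 -> a + b < d by lra.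
split; last by rewrite distrC.
- have -> : hess (fun z => phi z + bowl z0 sg k z) z - hess phi z0 =
      (hess phi z - hess phi z0) + (2 * sg)%:M.
    by rewrite (hessD z Cphi (bowl_Ck 2 z0 sg k)) hess_bowl addrAC.
  apply: le_lt_trans (ler_normD _ _) _; apply: split_lt; first by rewrite distrC.
  apply: le_trans (norm_scalar_mx _) _; rewrite normrM ger0_norm//; lra.
- have [dbowl _] := bowl_Ck 1 z0 sg k.
  have -> : grad (fun z => phi z + bowl z0 sg k z) z - grad phi z0 =
      (grad phi z - grad phi z0) + (2 * sg) *: (z - z0).
    by rewrite (gradD (dphi z) (dbowl z)) grad_bowl addrAC.
  apply: le_lt_trans (ler_normD _ _) _; apply: split_lt; first by rewrite distrC.
  rewrite normrZ normrM ger0_norm//.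
  have : `|sg| * `|z - z0| <= d / 8 * 1 by apply: ler_pM => //; exact: ltW.
  lra.
Qed.

Lemma bowl_lt z0 (eta r : R) z : 0 < eta -> 0 < r ->
  eta * dot (z - z0) (z - z0) < eta * r ^+ 2 -> `|z - z0| < r.
Proof.
move=> eta0 r0; rewrite ltr_pM2l// => h.
rewrite -ltr_sqr ?nnegrE// ?ltW//.
exact: le_lt_trans (sqr_norm_le (z - z0)) h.
Qed.

(** The touching function is made strict by a paraboloid, so that a member of the family
    close to the supremum is touched nearby with almost the same derivatives. *)
Lemma sub_above_sup K E g (S : set ('rV[R]_n -> R)) u : compact K ->
  stable_failure K E -> {within K, continuous g} ->
  (forall v, S v -> sub_above K E g v) -> [bounded u z | z in K] ->
  (forall v z, S v -> K z -> v z <= u z) ->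
  (forall z e, K z -> 0 < e -> exists2 v, S v & u z - e < v z) ->
  sub_above K E g u.
Proof.
move=> cK stab cg subS bu ubu supu; split=> // phi z0 Cphi Kz0 mx gap.
apply: contrapT => /(stab _ _ _ _ (hess_sym _ Cphi) Kz0)[d d0 nE].
have [eta [r [eta0 r0 rd close]]] := perturb_close z0 Cphi d0.
set U0 := usc_env K u z0 in mx gap nE.
pose phit z := phi z + bowl z0 eta 0 z.
have Cphit : Ck 2 phit by exact: (CkD Cphi (bowl_Ck _ _ _ _)).
have [gp gpE] : exists gp : R, gp = U0 - g z0 by eexists.
have gp0 : 0 < gp by rewrite gpE subr_gt0.
have [r' [r'0 r'r hr']] : exists r', [/\ 0 < r', r' <= r & forall z, K z ->
    `|z - z0| < r' -> g z < g z0 + gp / 4 /\ `|phi z - phi z0| < gp / 4].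
  have gp40 : 0 < gp / 4 by rewrite divr_gt0.
  have h3 : \forall z \near z0, `|phi z0 - phi z| < gp / 4.
    by have /cvgrPdist_lt := @Ck_continuous _ _ _ _ _ Cphi z0; exact.
  have [q q0 h] := near_ball (filterI (within_near cg Kz0 gp40) h3).
  exists (Num.min q r); split; rewrite ?lt_min ?q0// ?ge_min ?lexx ?orbT//.
  move=> z Kz; rewrite lt_min => /andP[zq _].
  have [/(_ Kz)] := h z zq.
  by rewrite ltr_norml [`|phi z - _|]distrC => /andP[? _] ?; split=> //; lra.
pose e := Num.min (Num.min (d / 16) (gp / 16)) (eta * r' ^+ 2 / 4).
have e0 : 0 < e by rewrite !lt_min !divr_gt0// mulr_gt0// exprn_gt0.
have [ed eg er] : [/\ e <= d / 16, e <= gp / 16 & e <= eta * r' ^+ 2 / 4].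
  by split; rewrite !ge_min lexx ?orbT.
have nphit : \forall y \near z0, phit y < phit z0 + e.
  have /cvgrPdist_lt /(_ e e0) := @Ck_continuous _ _ _ _ _ Cphit z0.
  by apply: filterS => y; rewrite ltr_norml => /andP[? ?]; lra.
have [ze [pe Kze ue]] := usc_env_approx bu Kz0 e0 nphit.
have [v Sv ve] := supu ze e Kze e0.
have [bv hv] := subS v Sv.
have [zb Kzb mxb] : exists2 zb, K zb &
    forall z, K z -> usc_env K v z - phit z <= usc_env K v zb - phit zb.
  apply: usc_max => //; first by exists z0.
  move=> y a Ky a0; have a20 : 0 < a / 2 by rewrite divr_gt0.
  have h1 : \forall y' \near y, `|phit y - phit y'| < a / 2.
    by have /cvgrPdist_lt := @Ck_continuous _ _ _ _ _ Cphit y; exact.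
  apply: filterS2 h1 (usc_env_usc bv Ky a20) => y' h1 h2 Ky'; have := h2 Ky'.
  by move: h1; rewrite ltr_norml => /andP[? ?] ?; lra.
have vu : usc_env K v zb <= usc_env K u zb.
  by apply: usc_env_mono => // y; exact: ubu.
have uphi := mx zb Kzb.
have vze := usc_env_ge bv Kze.
have mxze := mxb ze Kze.
have phit0 : phit z0 = phi z0 by rewrite /phit bowl_at addr0.
have phitE : phit zb = phi zb + eta * dot (zb - z0) (zb - z0) by rewrite /phit /bowl addr0.
have zbr' : `|zb - z0| < r'.
  apply: (bowl_lt eta0) => //.
  have : 0 < eta * r' ^+ 2 by rewrite mulr_gt0// exprn_gt0.
  rewrite -/U0 in ue; rewrite phit0 in pe; rewrite phitE in mxze.
  move: ue pe mxze ve vze vu uphi er; clear; lra.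
have bowl0 : 0 <= eta * dot (zb - z0) (zb - z0) by rewrite mulr_ge0 ?dotvv_ge0// ltW.
rewrite -/U0 in ue; rewrite phit0 in pe; rewrite phitE in mxze.
have F1 : U0 + (phi zb - phi z0) - 3 * e <= usc_env K v zb.
  move: ue pe mxze ve vze bowl0; clear; lra.
have vzb : usc_env K v zb <= U0 + (phi zb - phi z0).
  move: vu uphi; clear; lra.
have [gzb phib] := hr' zb Kzb zbr'.
have zbr : `|zb - z0| < r by exact: lt_le_trans r'r.
have etan : `|eta| <= eta by rewrite gtr0_norm.
have [hc gc pc] := close eta 0 zb etan zbr.
apply: (nE _ _ _ zb _ Kzb hc gc _ (lt_le_trans zbr rd)); first exact: hess_sym.
  2: apply: hv => //.
- move: F1 vzb ed pc d0; clear.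
  move: (usc_env K v zb) (phi zb) (phi z0) U0 e => a b c U e h1 h2 h3.
  rewrite !ltr_norml => /andP[h4 h5] h6; apply/andP; split; lra.
- move: F1 gzb eg phib gp0; rewrite gpE; clear.
  move: (usc_env K v zb) (phi zb) (phi z0) (g zb) (g z0) U0 e => a b c a' b' U e h1 h2 h3.
  rewrite !ltr_norml => /andP[h4 h5] h6; lra.
Qed.

End Perron.

(** * Perron's method *)

Section PerronMethod.
Context {R : realType} {n : nat}.
Implicit Types (K : set 'rV[R]_n) (u v f phi : 'rV[R]_n -> R) (z : 'rV[R]_n) (e : R).
Implicit Types E : 'M[R]_n -> 'rV[R]_n -> R -> 'rV[R]_n -> Prop.

(** At interior points this is ellipticity.  At boundary points touching only orders
    derivatives in inward directions, and it becomes a compatibility between the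
    conditions [Es], [Eb] and the shape of [K]. *)
Definition strict_sub_touched K Es Eb : Prop :=
  forall phi psi (r : R) z, Ck 2 phi -> Ck 2 psi -> K z ->
    ~ Eb (hess phi z) (grad phi z) r z ->
    (forall y, K y -> psi z - phi z <= psi y - phi y) ->
    Es (hess psi z) (grad psi z) r z.

Lemma usc_env_max K u phi z : [bounded u z | z in K] ->
  [bounded Num.max (u z) (phi z) | z in K] -> continuous phi -> K z ->
  usc_env K u z < usc_env K (fun z => Num.max (u z) (phi z)) z ->
  usc_env K (fun z => Num.max (u z) (phi z)) z = phi z.
Proof.
move=> bu bv cphi Kz; set v := fun z => _ => lt.
apply/eqP; rewrite eq_le; apply/andP; split; last first.
  by apply: le_trans (usc_env_ge bv Kz); rewrite /v le_max lexx orbT.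
rewrite leNgt; apply/negP => lt2.
pose c := Num.max (usc_env K u z) (phi z).
have cv : c < usc_env K v z by rewrite gt_max lt lt2.
pose e := (usc_env K v z - c) / 2.
have e0 : 0 < e by rewrite divr_gt0// subr_gt0.
suff : usc_env K v z <= c + e by move: e0; rewrite /e; lra.
apply: usc_env_le => //.
have h : \forall y \near z, `|phi z - phi y| < e.
  by have /cvgrPdist_lt := cphi z; exact.
apply: filterS2 h (usc_env_near bu Kz e0) => y h1 /[apply] h2.
have c1 : usc_env K u z <= c by rewrite le_max lexx.
have c2 : phi z <= c by rewrite le_max lexx orbT.
rewrite /v ge_max; apply/andP; split; first by move: h2 c1; clear; lra.
by move: h1; rewrite ltr_norml => /andP[h1 _]; move: h1 c2; clear; lra.
Qed.

(** The bump construction: were the lower envelope of the largest function [u]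
    of the class not a supersolution at [z0], the maximum of [u] and of a smooth
    strict subsolution slightly above [u] near [z0] would be in the class. *)
Lemma perron_super K Es Eb g u : compact K -> stable_failure K Eb ->
  strict_sub_touched K Es Eb -> sub_above K Es g u ->
  (forall z, K z -> g z <= u z) ->
  (forall v, sub_above K Es g v -> (forall z, K z -> g z <= v z) ->
    forall z, K z -> v z <= u z) ->
  visc_super K Eb u.
Proof.
move=> cK stab touch subu gu umax; have [bu hu] := subu.
have buN := bounded_onN bu.
split=> // phi z0 Cphi Kz0 mn; apply: contrapT.
move=> /(stab _ _ _ _ (hess_sym _ Cphi) Kz0)[d d0 nE].
have [eta [r [eta0 r0 rd close]]] := perturb_close z0 Cphi d0.
move: mn nE; set L0 := lsc_env K u z0 => mn nE.
have lsc_le z : K z -> lsc_env K u z <= u z.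
  by move=> Kz; rewrite lsc_envE lerNl; exact: (usc_env_ge buN).
have [c [c0 cr cd]] : exists c : R, [/\ 0 < c, c < eta * r ^+ 2 & c <= d / 4].
  exists (Num.min (eta * r ^+ 2 / 2) (d / 4)).
  have h : 0 < eta * r ^+ 2 by rewrite mulr_gt0// exprn_gt0.
  split; rewrite ?lt_min ?gt_min ?ge_min ?lexx ?orbT// ?divr_gt0//.
  by rewrite gtr_pMr// invf_lt1// ltr1n.
pose k := L0 - phi z0 + c.
pose phi' z := phi z + bowl z0 (- eta) k z.
have Cphi' : Ck 2 phi' by exact: (CkD Cphi (bowl_Ck _ _ _ _)).
have cphi' : continuous phi' := Ck_continuous Cphi'.
have phiE z : phi' z = phi z - eta * dot (z - z0) (z - z0) + (L0 - phi z0) + c.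
  by rewrite /phi' /bowl /k; ring.
have above z : K z -> phi' z <= u z + c - eta * dot (z - z0) (z - z0).
  move=> Kz; have := mn z Kz; have := lsc_le z Kz; rewrite phiE; clear; lra.
pose v z := Num.max (u z) (phi' z).
have uv z : u z <= v z by rewrite le_max lexx.
have pv z : phi' z <= v z by rewrite le_max lexx orbT.
have vuc z : K z -> v z <= u z + c.
  move=> Kz; have := above z Kz.
  have : 0 <= eta * dot (z - z0) (z - z0) by rewrite mulr_ge0 ?dotvv_ge0 ?ltW.
  by rewrite ge_max => h1 h2; apply/andP; split; move: h1 h2 c0; clear; lra.
have bv : [bounded v z | z in K].
  have /bounded_onP[M hM] := bu; apply/bounded_onP; exists (M + c) => z Kz.
  have := hM z Kz; have := uv z; have := vuc z Kz; move: c0; clear.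
  by rewrite !ler_norml => ? ? ? /andP[? ?]; apply/andP; split; lra.
have subv : sub_above K Es g v.
  split=> // psi zb Cpsi Kzb mx gap.
  have uvE : usc_env K u zb <= usc_env K v zb by apply: usc_env_mono => // y _.
  have [vu|uv'] := leP (usc_env K v zb) (usc_env K u zb).
    have E : usc_env K v zb = usc_env K u zb by apply/eqP; rewrite eq_le vu uvE.
    rewrite E; apply: hu => //; last by rewrite -E.
    move=> z Kz; rewrite -E; apply: le_trans (mx z Kz).
    by rewrite lerB//; apply: usc_env_mono => // y _.
  have vphi := usc_env_max bu bv cphi' Kzb uv'.
  have lt_up : u zb < phi' zb by rewrite -vphi (le_lt_trans (usc_env_ge bu Kzb)).
  have zr : `|zb - z0| < r.
    apply: (bowl_lt eta0) => //; have := above zb Kzb; move: lt_up cr; clear; lra.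
  have etan : `|- eta| <= eta by rewrite normrN gtr0_norm.
  have [hc gc pc] := close (- eta) k zb etan zr.
  rewrite vphi; apply: (touch phi') => //.
    apply: (nE (hess phi' zb) (grad phi' zb) (phi' zb) zb (hess_sym zb Cphi') Kzb
      hc gc _ (lt_le_trans zr rd)).
    have B0 : 0 <= eta * dot (zb - z0) (zb - z0) by rewrite mulr_ge0 ?dotvv_ge0 ?ltW.
    have := above zb Kzb; rewrite phiE; move: lt_up pc cd B0; rewrite phiE; clear.
    rewrite !ltr_norml => ? /andP[? ?] ? ? ?; apply/andP; split; lra.
  move=> y Ky; have := mx y Ky; rewrite vphi.
  have := le_trans (pv y) (usc_env_ge bv Ky); clear; lra.
have gv z : K z -> g z <= v z by move=> Kz; exact: le_trans (gu z Kz) (uv z).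
have vu := umax v subv gv.
have c20 : 0 < c / 2 by rewrite divr_gt0.
have h : \forall y \near z0, `|phi' z0 - phi' y| < c / 2.
  by have /cvgrPdist_lt := cphi' z0; exact.
have [y [hy Ky]] := usc_env_approx buN Kz0 c20 h.
have phi'0 : phi' z0 = L0 + c by rewrite phiE subrr dot0l mulr0 subr0; ring.
have uE : usc_env K (fun z => - u z) z0 = - L0 by rewrite /L0 lsc_envE opprK.
rewrite uE; have := le_trans (pv y) (vu y Ky); move: hy; rewrite phi'0.
by rewrite ltr_norml => /andP[_ h2]; move: h2; clear; lra.
Qed.

(** The supremum of the functions which lie above [fm] and are subsolutions where they
    exceed it.  It is a supersolution by the bump construction, so it stays strictly
    above [fm] by comparison with the lower barrier, and hence is a subsolution
    everywhere. *)
Theorem perron K Es Eb fm fp : compact K ->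
  stable_failure K Es -> stable_failure K Eb -> strict_sub_touched K Es Eb ->
  upper_barrier K Es fp -> upper_barrier K (opp_cond Eb) (fun z => - fm z) ->
  (forall z, K z -> fm z < fp z) ->
  exists u, visc_sub K Es u /\ visc_super K Eb u.
Proof.
move=> cK stabs stabb touch bp bm lt.
have cfm : {within K, continuous fm}.
  have [cN _] := bm; apply/subspace_continuousP => z Kz.
  apply/cvgrPdist_lt => e e0; apply: filterS (within_near cN Kz e0) => y h Ky.
  by have := h Ky; rewrite -opprD normrN.
have bounded_cont f : {within K, continuous f} -> [bounded f z | z in K].
  move=> cf; have [M [_ hM]] := compact_bounded (continuous_compact cf cK).
  apply/bounded_onP; exists (M + 1) => z Kz; apply: (hM (M + 1)); last by exists z.
  by rewrite ltrDl.
pose S := [set v | sub_above K Es fm v /\ forall z, K z -> fm z <= v z].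
have Slt v z : S v -> K z -> v z < fp z.
  move=> [sv _] Kz; have [bv _] := sv.
  by rewrite (le_lt_trans (usc_env_ge bv Kz))// (sub_above_lt_barrier cK bp sv).
have Sfm : S fm.
  split=> //; split; first exact: bounded_cont.
  move=> phi z0 _ Kz0 _; rewrite ltNge => /negP; case.
  apply/ler_addgt0Pr => e e0; apply: usc_env_le => //; first exact: bounded_cont.
  apply: filterS (within_near cfm Kz0 e0) => y /[apply].
  by rewrite ltr_norml => /andP[? ?]; lra.
pose u z := sup [set v z | v in S].
have hs z : K z -> has_sup [set v z | v in S].
  move=> Kz; split; first by exists (fm z), fm.
  by exists (fp z) => _ [v Sv <-]; exact/ltW/Slt.
have ubu v z : S v -> K z -> v z <= u z.
  move=> Sv Kz; apply: sup_upper_bound; first exact: hs.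
  by exists v.
have ufp z : K z -> u z <= fp z.
  move=> Kz; apply: ge_sup; first by exists (fm z), fm.
  by move=> _ [v Sv <-]; exact/ltW/Slt.
have bu : [bounded u z | z in K].
  have /bounded_onP[M1 h1] := bounded_cont _ cfm.
  have [cfp _] := bp; have /bounded_onP[M2 h2] := bounded_cont _ cfp.
  apply/bounded_onP; exists (M1 + M2) => z Kz.
  have := ufp z Kz; have := ubu fm z Sfm Kz; have := h1 z Kz; have := h2 z Kz.
  have : 0 <= `|fm z| by []; have : 0 <= `|fp z| by [].
  have := h1 z Kz; have := h2 z Kz; clear.
  rewrite !ler_norml => /andP[? ?] /andP[? ?] ? ? _ _ ? ?; apply/andP; split; lra.
have subu : sub_above K Es fm u.
  apply: (@sub_above_sup _ _ _ _ _ S) => //; first by move=> v [].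
  move=> z e Kz e0; have [_ [v Sv <-] h] := sup_adherent e0 (hs z Kz).
  by exists v.
have superu : visc_super K Eb u.
  apply: (perron_super cK stabb touch subu); first by move=> z; exact: ubu.
  by move=> v sv gv z; apply: ubu.
exists u; split=> //; have [_ hu] := subu; split=> // phi z0 Cphi Kz0 mx.
apply: hu => //; apply: lt_le_trans (usc_env_ge bu Kz0).
apply: lt_le_trans (lower_barrier_lt cK bm superu Kz0) _.
by rewrite lsc_envE lerNl; apply: (usc_env_ge (bounded_onN bu)).
Qed.

End PerronMethod.

(** * The unit normal of a C^1 domain *)

Lemma dist_via (R : realType) (V : normedModType R) (c a b : V) (d e : R) :
  `|c - a| <= d -> `|c - b| <= e -> `|a - b| <= d + e.
Proof.
move=> ca cb; have -> : a - b = (c - b) - (c - a) by rewrite opprB [RHS]addrC subrKA.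
by apply: le_trans (ler_normB _ _) _; rewrite addrC lerD.
Qed.

Section Directions.
Context {R : realType} {n : nat}.
Implicit Types (f rho : 'rV[R]_n -> R) (x v a b : 'rV[R]_n).

Lemma near0_right (P : R -> Prop) : (\forall t \near 0^'+, P t) ->
  exists2 d : R, 0 < d & forall t, 0 < t -> t < d -> P t.
Proof.
move=> /nbhs_ballP[d /= d0 h]; exists d => // t t0 td; apply: h => //.
by rewrite /ball/= sub0r normrN gtr0_norm.
Qed.

Lemma pos_along f x v : Ck 1 f ->
  0 < f x \/ 0 <= f x /\ 0 < dot v (grad f x) ->
  \forall t \near 0^'+, 0 < f (x + t *: v).
Proof.
move=> Cf [fx|[fx gx]].
  have h : \forall y \near x, 0 < f y.
    by have /cvgr_gt/(_ _ fx) := @Ck_continuous _ _ _ _ _ Cf x.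
  have := line_near v h; apply: filterS2 (nbhs_right_gt 0) => t t0 /(_ t).
  by apply; rewrite t0 lexx.
have h : \forall y \near x, 0 < dot v (grad f y).
  have cg : grad f y @[y --> x] --> grad f x := @grad_continuous _ _ f Cf x.
  have cd : dot v (grad f y) @[y --> x] --> dot v (grad f x).
    exact: (cvg_dotl cg).
  by move: cd => /cvgr_gt; exact.
have := line_near v h; apply: filterS2 (nbhs_right_gt 0) => t t0 ht.
have [df _] := Cf; have [s [/andP[s0 s1] E]] := mean_value x (t *: v) df.
rewrite -(subrK (f x) (f _)) E (derive_grad _ (df _)) dotZl ltr_pwDl//.
rewrite mulr_gt0// scalerA; apply: ht.
by rewrite mulr_gt0//= ler_piMl// ltW.
Qed.

Lemma enorm_gt0 a : a != 0 -> 0 < enorm a.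
Proof.
move=> a0; apply: lt_le_trans (norm_enorm a); by rewrite normr_gt0.
Qed.

Lemma enorm_sqr a : enorm a ^+ 2 = dot a a.
Proof. by rewrite sqr_sqrtr ?dotvv_ge0. Qed.

Lemma dot_eq0 a : dot a a <= 0 -> a = 0.
Proof.
move=> h; apply/eqP; rewrite -normr_eq0 -sqrf_eq0 eq_le sqr_ge0 andbT.
exact: le_trans (sqr_norm_le a) h.
Qed.

(** The unit normal does not depend on the defining function: the half spaces
    of inward directions are the same, so the gradients are positively parallel,
    by the equality case of the Cauchy-Schwarz inequality. *)
Lemma halfspace_parallel a b : a != 0 -> b != 0 ->
  (forall v, dot v a < 0 -> dot v b <= 0) ->
  (enorm a)^-1 *: a = (enorm b)^-1 *: b.
Proof.
move=> a0 b0 h.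
have A := enorm_gt0 a0; have B := enorm_gt0 b0.
have aa : 0 < dot a a by rewrite -enorm_sqr exprn_gt0.
have ab : 0 <= dot a b by have := h (- a); rewrite !dotNl oppr_lt0 oppr_le0; exact.
have key : dot a a * dot b b <= dot a b ^+ 2.
  suff : dot b b - dot a b ^+ 2 / dot a a <= 0.
    by rewrite subr_le0 ler_pdivlMr// mulrC.
  apply/ler_addgt0Pr => e e0.
  pose s := e / (dot a b + 1).
  have ab1 : 0 < dot a b + 1 by rewrite ltr_wpDl.
  have s0 : 0 < s by rewrite divr_gt0.
  have := h (b - (dot a b / dot a a + s) *: a).
  rewrite !dotE (dotC b a) mulrDl divfK ?gt_eqF//.
  have -> : dot a b - (dot a b + s * dot a a) < 0 by rewrite opprD addrA subrr sub0r oppr_lt0 mulr_gt0.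
  move=> /(_ isT) h1.
  have h2 : s * dot a b <= e.
    rewrite /s mulrAC ler_pdivrMr// ler_wpM2l ?lerDl// ltW//.
  by rewrite add0r; move: h1 h2; clear; rewrite mulrDl expr2 mulrAC; lra.
have AB : enorm a * enorm b <= dot a b.
  have AB0 : 0 <= enorm a * enorm b by rewrite mulr_ge0// ltW.
  by rewrite -ler_sqr ?nnegrE// exprMn !enorm_sqr.
have : enorm b *: a - enorm a *: b = 0.
  apply: dot_eq0; rewrite !dotE (dotC b a) -!enorm_sqr.
  have : enorm a * enorm b * (enorm a * enorm b) <= enorm a * enorm b * dot a b.
    by rewrite ler_wpM2l// mulr_ge0// ltW.
  clear; nra.
move/eqP; rewrite subr_eq0 => /eqP E.
apply: (scalerI (a := enorm a * enorm b)); first by rewrite mulf_neq0 ?gt_eqF.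
by rewrite !scalerA mulrAC mulfV ?gt_eqF// mul1r -mulrA mulfV ?gt_eqF// mulr1.
Qed.

Lemma defining_parallel f rho x : Ck 1 f -> Ck 1 rho -> f x = 0 -> rho x = 0 ->
  grad f x != 0 -> grad rho x != 0 ->
  (\forall y \near x, f y < 0 <-> rho y < 0) ->
  (enorm (grad f x))^-1 *: grad f x = (enorm (grad rho x))^-1 *: grad rho x.
Proof.
move=> Cf Crho fx rx f0 r0 h; apply: halfspace_parallel => // v va.
have [df _] := Cf; have [dr _] := Crho.
rewrite -oppr_ge0 -dotNr -gradN//; apply: derive_ge0_at; first exact: CkN.
have := pos_along (x := x) (v := v) (CkN Cf); rewrite gradN// dotNr fx oppr0 lexx oppr_gt0.
move=> /(_ (or_intror (conj isT va))); apply: filterS3 (line_near v h) (nbhs_right_gt 0).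
move=> t /(_ t) h' t0; rewrite rx oppr0 oppr_gt0 oppr_ge0 => h2; apply/ltW/h' => //.
by rewrite t0 lexx.
Qed.

End Directions.

Section Boundary.
Context {R : realType} {n : nat} (Om : set 'rV[R]_n) (nu : 'rV[R]_n -> 'rV[R]_n).
Hypotheses (Om_open : open Om) (Om_bounded : bounded_set Om)
  (nu_normal : outward_unit_normal Om nu).
Implicit Types (x b v : 'rV[R]_n).

Lemma bdryE : bdry Om = closure Om `\` Om.
Proof. by rewrite /bdry; move/interior_id: Om_open => ->. Qed.

Lemma closure_compact : compact (closure Om).
Proof.
apply: bounded_closed_compact; last exact: closed_closure.
have [M [Mr hM]] := Om_bounded; exists M; split=> // M' MM' x cx.
rewrite /= leNgt; apply/negP => gt.
have h : \forall y \near x, M' < `|y|.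
  by have /cvgr_gt := @norm_continuous _ _ x; exact.
have [y [Oy ly]] := cx _ h.
by have := hM M' MM' y Oy; rewrite /= leNgt ly.
Qed.

Lemma bdry_closed : closed (bdry Om).
Proof.
rewrite bdryE setDE; apply: closedI; first exact: closed_closure.
exact: open_closedC.
Qed.

Lemma bdry_compact : compact (bdry Om).
Proof.
by apply: subclosed_compact closure_compact _; [exact: bdry_closed|move=> x []].
Qed.

Lemma local_defining_bdry x rho : local_defining_function Om x rho -> bdry Om x ->
  rho x = 0.
Proof.
move=> [Crho g0 h]; rewrite bdryE => -[cx nx].
apply/eqP; rewrite eq_le; apply/andP; split.
  rewrite leNgt; apply/negP => r0.
  have h1 : \forall y \near x, 0 < rho y.
    by have /cvgr_gt/(_ _ r0) := @Ck_continuous _ _ _ _ _ Crho x.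
  have [y [Oy [[/(_ Oy) ry _] ry']]] := cx _ (filterI h h1).
  by have := lt_trans ry ry'; rewrite ltxx.
by rewrite leNgt; apply/negP => r0; apply: nx; apply/(nbhs_singleton h).
Qed.

Lemma inward_near x v : bdry Om x -> dot (nu x) v < 0 ->
  \forall t \near 0^'+, Om (x + t *: v).
Proof.
move=> bx nv; have [rho lrho nuE] := nu_normal bx.
have rx := local_defining_bdry lrho bx; have [Crho g0 h] := lrho.
have [dr _] := Crho.
have := pos_along (x := x) (v := v) (CkN Crho); rewrite gradN// dotNr rx oppr0 lexx oppr_gt0.
have g : dot v (grad rho x) < 0.
  move: nv; rewrite nuE dotZl pmulr_rlt0 ?invr_gt0 ?enorm_gt0//; by rewrite dotC.
move=> /(_ (or_intror (conj isT g))); apply: filterS3 (line_near v h) (nbhs_right_gt 0).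
move=> t /(_ t) h' t0; rewrite oppr_gt0 => h2; apply/h' => //.
by rewrite t0 lexx.
Qed.

(** Two boundary points near [a] are zeros of the same defining function, so by the
    mean value theorem the chord is orthogonal to its gradient at an intermediate
    point.  Compactness makes the estimate uniform. *)
Lemma normal_uniform (e : R) : 0 < e -> \forall d \near 0^'+, forall b x,
  bdry Om b -> `|x - b| < d -> bdry Om x ->
  `|dot (nu b) (x - b)| <= e * `|x - b| /\ `|nu x - nu b| <= e.
Proof.
move=> e0; apply: compact_uniform; first exact: bdry_compact.
move=> a ba; have [rho la _] := nu_normal ba; have [Crho g0 h] := la.
pose m y := (enorm (grad rho y))^-1 *: grad rho y.
have [dr _] := Crho.
have cg : grad rho y @[y --> a] --> grad rho a := @grad_continuous _ _ rho Crho a.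
have ce : enorm (grad rho y) @[y --> a] --> enorm (grad rho a).
  have cd : dot (grad rho y) (grad rho y) @[y --> a] --> dot (grad rho a) (grad rho a).
    exact: (cvg_dot cg cg).
  by apply: cvg_comp cd _; exact: sqrt_continuous.
have ea : 0 < enorm (grad rho a) := enorm_gt0 g0.
have cm : m y @[y --> a] --> m a.
  have e_ne0 : enorm (grad rho a) != 0 by rewrite gt_eqF.
  exact: (cvgZ (cvgV e_ne0 ce) cg).
have g_ne0 : \forall y \near a, enorm (grad rho a) / 2 < enorm (grad rho y).
  by have /cvgr_gt := ce; apply; rewrite gtr_pMr// invf_lt1// ltr1n.
(* the defining function at [a] also defines the domain at nearby boundary points *)
have bdry_nu : \forall y \near a, bdry Om y -> rho y = 0 /\ nu y = m y.
  have h' := nbhs_interior h.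
  apply: filterS2 h' g_ne0 => y hy gy by_.
  have gy0 : grad rho y != 0.
    apply: contraTneq gy => ->; rewrite /enorm dot0l sqrtr0 -leNgt.
    by rewrite divr_ge0// ltW.
  have ly : local_defining_function Om y rho by split.
  have ry := local_defining_bdry ly by_; split=> //.
  have [rho' ly' ->] := nu_normal by_; have [Crho' g0' h''] := ly'.
  apply: defining_parallel => //; first exact: local_defining_bdry ly' by_.
  apply: filterS2 hy h'' => w [h1 h2] [h3 h4].
  by split=> [/h4/h1|/h2/h3].
pose k : R := n%:R + 1.
have k0 : 0 < k by rewrite ltr_wpDl.
pose d := e * (enorm (grad rho a) / 2) / k / 2.
have d0 : 0 < d by rewrite !divr_gt0// mulr_gt0// divr_gt0.
have gd : \forall y \near a, `|grad rho a - grad rho y| < d by have /cvgrPdist_lt := cg; exact.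
have md : \forall y \near a, `|m a - m y| < e / 2.
  by have /cvgrPdist_lt := cm; apply; rewrite divr_gt0.
have [r r0 hr] := near_ball (filterI (filterI bdry_nu g_ne0) (filterI gd md)).
exists (ball a r, ball a r); first by split; exact: nbhsx_ballx.
move=> [b x] /= []; rewrite -!ball_normE/= ![`|a - _|]distrC => br xr bb bx.
have [[/(_ bb)[rb nb] gb] [gdb mdb]] := hr b br.
have [[/(_ bx)[rx nx] _] [_ mdx]] := hr x xr.
split; last first.
  by rewrite nx nb [e]splitr; exact: dist_via (ltW mdx) (ltW mdb).
have [t [/andP[t0 t1] E]] := mean_value b (x - b) dr.
have bxb : b + (x - b) = x by rewrite addrC subrK.
have := E; rewrite bxb rx rb subrr (derive_grad _ (dr _)) => E0.
have xi : `|b + t *: (x - b) - a| < r.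
  have -> : b + t *: (x - b) - a = (1 - t) *: (b - a) + t *: (x - a).
    by apply/rowP => i; rewrite !mxE; ring.
  apply: le_lt_trans (ler_normD _ _) _; rewrite (normrZ (1 - t)) (normrZ t).
  rewrite (gtr0_norm t0) (@gtr0_norm _ (1 - t)) ?subr_gt0//.
  have : (1 - t) * `|b - a| <= (1 - t) * r by apply: ler_wpM2l; [rewrite subr_ge0; exact: ltW|exact: ltW].
  have : t * `|x - a| < t * r by rewrite ltr_pM2l.
  clear; lra.
have [_ [gdx _]] := hr _ xi.
rewrite nb /m dotZl normrM gtr0_norm ?invr_gt0; last first.
  by apply: lt_trans gb; rewrite divr_gt0.
have -> : dot (grad rho b) (x - b) = dot (x - b) (grad rho b - grad rho (b + t *: (x - b))).
  by rewrite dotBr -E0 subr0 dotC.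
rewrite mulrC ler_pdivrMr; last by apply: lt_trans gb; rewrite divr_gt0.
have ggd : `|grad rho b - grad rho (b + t *: (x - b))| <= 2 * d.
  by rewrite mulr_natl mulr2n; exact: dist_via (ltW gdb) (ltW gdx).
apply: le_trans (norm_dot _ _) _.
have h1 : n%:R * `|x - b| * `|grad rho b - grad rho (b + t *: (x - b))| <=
   k * `|x - b| * (2 * d).
  by rewrite ler_pM ?mulr_ge0// ler_wpM2r// lerDl.
apply: le_trans h1 _.
have -> : k * `|x - b| * (2 * d) = e * `|x - b| * (enorm (grad rho a) / 2).
  by rewrite /d; field; rewrite gt_eqF.
by rewrite ler_wpM2l ?mulr_ge0// ?ltW.
Qed.

End Boundary.

(** * The data and the change of sign *)

Section Stability.
Context {R : realType}.

Lemma within_comp (T : Type) (X Y : topologicalType) (F : set_system T) {FF : Filter F}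
    (A : set X) (f : X -> Y) (h : T -> X) (a : X) :
  {within A, continuous f} -> A a -> h @ F --> a -> (\forall t \near F, A (h t)) ->
  f (h t) @[t --> F] --> f a.
Proof.
move=> /subspace_continuousP cf Aa ha hA V nV.
have /= h1 := ha _ (cf a Aa V nV).
by apply: filterS2 hA h1 => t At; exact.
Qed.

Lemma within_continuous_at (X Y : topologicalType) (A : set X) (f : X -> Y) (a : X) :
  continuous f -> f @ within A (nbhs a) --> f a.
Proof.
move=> cf; apply: cvg_trans (cf a); apply: cvg_app; exact: cvg_within.
Qed.

Lemma cont_fst (X Y Z : topologicalType) (f : X -> Y * Z) :
  continuous f -> continuous (fun x => (f x).1).
Proof. by move=> cf x; apply: cvg_comp (cf x) _; exact: cvg_fst. Qed.

Lemma cont_pair (X Y Z : topologicalType) (f : X -> Y) (g : X -> Z) :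
  continuous f -> continuous g -> continuous (fun x => (f x, g x)).
Proof. by move=> cf cg x; apply: cvg_pair; [exact: cf|exact: cg]. Qed.

Lemma cont_opp (X : topologicalType) (V : normedModType R) (f : X -> V) :
  continuous f -> continuous (fun x => - f x).
Proof. by move=> cf x; apply: cvgN; exact: cf. Qed.

Lemma cont_snd (X Y Z : topologicalType) (f : X -> Y * Z) :
  continuous f -> continuous (fun x => (f x).2).
Proof. by move=> cf x; apply: cvg_comp (cf x) _; exact: cvg_snd. Qed.

Context {n : nat}.
Implicit Types (K D : set 'rV[R]_n) (z : 'rV[R]_n).
Implicit Types E : 'M[R]_n -> 'rV[R]_n -> R -> 'rV[R]_n -> Prop.

Lemma stable_or K E1 E2 : stable_failure K E1 -> stable_failure K E2 ->
  stable_failure K (fun X p r z => E1 X p r z \/ E2 X p r z).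
Proof.
move=> s1 s2 X p r z sX Kz nE.
have [d1 d10 h1] := s1 X p r z sX Kz (fun h => nE (or_introl h)).
have [d2 d20 h2] := s2 X p r z sX Kz (fun h => nE (or_intror h)).
exists (Num.min d1 d2); first by rewrite lt_min d10.
move=> X' p' r' z' sX' Kz'; rewrite !lt_min.
move=> /andP[? ?] /andP[? ?] /andP[? ?] /andP[? ?] [].
  exact: h1.
exact: h2.
Qed.

Lemma stable_iff K E1 E2 :
  (forall X p r z, E1 X p r z <-> E2 X p r z) ->
  stable_failure K E1 -> stable_failure K E2.
Proof.
move=> E12 s1 X p r z sX Kz nE.
have [d d0 h] := s1 X p r z sX Kz (fun h => nE (iffLR (E12 _ _ _ _) h)).
exists d => // X' p' r' z' sX' Kz' hX hp hr hz /E12.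
exact: h.
Qed.

Definition jet : Type := ('M[R]_n * 'rV[R]_n * R * 'rV[R]_n)%type.

Lemma stable_le K D (c : 'M[R]_n -> 'rV[R]_n -> R -> 'rV[R]_n -> R) : closed D ->
  (forall X p r z, symmx X -> K z -> D z ->
    c w.1.1.1 w.1.1.2 w.1.2 w.2
      @[w --> within [set w | [/\ symmx w.1.1.1, K w.2 & D w.2]] (nbhs (X, p, r, z))]
      --> c X p r z) ->
  stable_failure K (fun X p r z => D z /\ c X p r z <= 0).
Proof.
move=> cD cc X p r z sX Kz nE.
have [Dz|nDz] := pselect (D z); last first.
  have [d d0 h] := near_ball (open_nbhs_nbhs (conj (closed_openC cD) nDz)).
  by exists d => // X' p' r' z' _ _ _ _ _ /h h' [].
have c0 : 0 < c X p r z by rewrite ltNge; apply/negP => c0; exact: nE.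
have := cc X p r z sX Kz Dz.
move=> /cvgr_gt/(_ 0 c0)/nbhs_ballP[d /= d0 h].
exists d => // X' p' r' z' sX' Kz' hX hp hr hz [Dz' c'].
have : 0 < c X' p' r' z'.
  apply: (h (X', p', r', z')) => //.
  by split; [split; [split|]|]; rewrite -ball_normE /ball_/= distrC.
by rewrite ltNge c'.
Qed.

Lemma stable_opp K E : stable_failure K (opp_cond E) -> stable_failure K E.
Proof.
move=> s X p r z sX Kz nE.
have sN Y : symmx Y -> symmx (- Y : 'M[R]_n) by rewrite /symmx => h; rewrite linearN/= h.
have := s (- X) (- p) (- r) z (sN _ sX) Kz; rewrite /opp_cond !opprK => /(_ nE)[d d0 h].
exists d => // X' p' r' z' sX' Kz' hX hp hr hz.
have nd (V : normedModType R) (a b : V) : `|- a + b| = `|a - b|.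
  by rewrite -normrN opprD opprK.
have := h (- X') (- p') (- r') z' (sN _ sX') Kz'; rewrite !opprK !nd.
exact.
Qed.

End Stability.

(** The data of the problem in one record, so that changing the sign of the
    unknown is an operation on problems. *)
Record problem (R : realType) (N : nat) := Problem {
  omega : set 'rV[R]_N;
  normal : 'rV[R]_N -> 'rV[R]_N;
  gtop : 'rV[R]_N -> R;
  gbot : 'rV[R]_N -> R;
  oper : 'M[R]_(N + 1) -> 'rV[R]_(N + 1) -> R -> 'rV[R]_N -> R -> R;
  rate : R;
  vtop : 'rV[R]_N -> R -> 'rV[R]_N;
  vbot : 'rV[R]_N -> R -> 'rV[R]_N;
  btop : 'rV[R]_N -> R -> R;
  bbot : 'rV[R]_N -> R -> R;
  gamma0 : 'rV[R]_N -> 'rV[R]_N;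
  beta0 : 'rV[R]_N -> R;
  ktop : 'rV[R]_N -> 'rV[R]_N;
  kbot : 'rV[R]_N -> 'rV[R]_N;
  ltop : 'rV[R]_N -> R;
  lbot : 'rV[R]_N -> R;
  lat : lateral_condition R N;
  blat : 'rV[R]_N -> R -> R }.

Definition cylinder {R : realType} {N : nat} (A : set 'rV[R]_N) : set ('rV[R]_N * R) :=
  A `*` `[-1, 1].

Record admissible (R : realType) (N : nat) (P : problem R N) : Prop := {
  omega_domain : bounded_domain (omega P);
  normal_ok : outward_unit_normal (omega P) (normal P);
  gtop_C1 : Ck 1 (gtop P);
  gbot_C1 : Ck 1 (gbot P);
  gbot_lt_gtop : forall x, closure (omega P) x -> gbot P x < gtop P x;
  oper_cont : {within [set w : 'M[R]_(N + 1) * 'rV[R]_(N + 1) * R * 'rV[R]_N * R |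
                 [/\ symmx w.1.1.1.1, closure (omega P) w.1.2 & -1 <= w.2 <= 1]],
        continuous (fun w : 'M[R]_(N + 1) * 'rV[R]_(N + 1) * R * 'rV[R]_N * R =>
          oper P w.1.1.1.1 w.1.1.1.2 w.1.1.2 w.1.2 w.2)};
  rate_gt0 : 0 < rate P;
  oper_mono : forall (p : 'rV[R]_(N + 1)) (x : 'rV[R]_N) (y : R),
        closure (omega P) x -> -1 <= y <= 1 ->
        forall (X Y : 'M[R]_(N + 1)) (r s : R),
          symmx X -> symmx Y -> psd_ge X Y -> r <= s ->
          oper P X p r x y - rate P * r <= oper P Y p s x y - rate P * s;
  vtop_cont : {within cylinder (closure (omega P)), continuous (fun w => vtop P w.1 w.2)};
  vbot_cont : {within cylinder (closure (omega P)), continuous (fun w => vbot P w.1 w.2)};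
  btop_cont : {within cylinder (closure (omega P)), continuous (fun w => btop P w.1 w.2)};
  bbot_cont : {within cylinder (closure (omega P)), continuous (fun w => bbot P w.1 w.2)};
  gamma0_C1 : Ck 1 (gamma0 P);
  beta0_C1 : Ck 1 (beta0 P);
  ktop_cont : {within closure (omega P), continuous (ktop P)};
  kbot_cont : {within closure (omega P), continuous (kbot P)};
  ltop_cont : {within closure (omega P), continuous (ltop P)};
  lbot_cont : {within closure (omega P), continuous (lbot P)};
  vtop_exp : forall e : R, 0 < e -> \forall y \near (0 : R),
        forall x, closure (omega P) x ->
        enorm (vtop P x y - (gamma0 P x + y *: ktop P x)) <= e * `|y|;
  vbot_exp : forall e : R, 0 < e -> \forall y \near (0 : R),
        forall x, closure (omega P) x ->
        enorm (vbot P x y - (- gamma0 P x + y *: kbot P x)) <= e * `|y|;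
  btop_exp : forall e : R, 0 < e -> \forall y \near (0 : R),
        forall x, closure (omega P) x ->
        `|btop P x y - (beta0 P x + ltop P x * y)| <= e * `|y|;
  bbot_exp : forall e : R, 0 < e -> \forall y \near (0 : R),
        forall x, closure (omega P) x ->
        `|bbot P x y - (- beta0 P x + lbot P x * y)| <= e * `|y|;
  blat_cont : {within cylinder (bdry (omega P)), continuous (fun w => blat P w.1 w.2)};
  lat_ok : match lat P with
    | Oblique g1 g2 =>
      [/\ {within cylinder (bdry (omega P)), continuous (fun w => pt (g1 w.1 w.2) (g2 w.1 w.2))},
          forall x y, bdry (omega P) x -> -1 <= y <= 1 -> 0 < dot (g1 x y) (normal P x) &
          forall x, bdry (omega P) x -> g2 x 0 = 0]
    | Dirichlet => True
    end }.

Section Negation.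
Context {R : realType} {N : nat}.
Implicit Type P : problem R N.

Definition thin P eps := thin_domain (omega P) (gtop P) (gbot P) eps.

Definition sub_cond P eps := thin_sub_cond (omega P) (gtop P) (gbot P) (oper P)
  (vtop P) (vbot P) (btop P) (bbot P) (lat P) (blat P) eps.

Definition super_cond P eps := thin_super_cond (omega P) (gtop P) (gbot P) (oper P)
  (vtop P) (vbot P) (btop P) (bbot P) (lat P) (blat P) eps.

Definition solutions P := thin_solutions (omega P) (gtop P) (gbot P) (oper P)
  (vtop P) (vbot P) (btop P) (bbot P) (lat P) (blat P).

Definition limit_oper P := limit_operator (gtop P) (gbot P) (oper P)
  (gamma0 P) (beta0 P) (ktop P) (kbot P) (ltop P) (lbot P).

(** The problem solved by [- u]. *)
Definition neg P : problem R N := {|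
  omega := omega P; normal := normal P; gtop := gtop P; gbot := gbot P;
  oper := fun X p r x y => - oper P (- X) (- p) (- r) x y;
  rate := rate P; vtop := vtop P; vbot := vbot P;
  btop := fun x y => - btop P x y; bbot := fun x y => - bbot P x y;
  gamma0 := gamma0 P; beta0 := fun x => - beta0 P x;
  ktop := ktop P; kbot := kbot P;
  ltop := fun x => - ltop P x; lbot := fun x => - lbot P x;
  lat := lat P; blat := fun x y => - blat P x y |}.

Lemma within_cvgP (T : topologicalType) (V : normedModType R) (A : set T) (f : T -> V) :
  {within A, continuous f} <-> forall x, A x -> f @ within A (nbhs x) --> f x.
Proof. exact: subspace_continuousP. Qed.

Lemma within_contN (T : topologicalType) (V : normedModType R) (A : set T) (f : T -> V) :
  {within A, continuous f} -> {within A, continuous (fun x => - f x)}.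
Proof.
move=> /within_cvgP cf; apply/within_cvgP => x Ax; exact: cvgN (cf x Ax).
Qed.

Lemma neg_admissible P : admissible P -> admissible (neg P).
Proof.
case=> H1 H2 H3 H4 H5 Fc r0 Fm H8 H9 H10 H11 H12 H13 H14 H15 H16 H17 H18 H19 H20 H21 H22 H23.
split; [exact: H1|exact: H2|exact: H3|exact: H4|exact: H5|idtac|exact: r0|idtac
  |exact: H8|exact: H9|exact: within_contN|exact: within_contN|exact: H12|idtac
  |exact: H14|exact: H15|exact: within_contN|exact: within_contN|exact: H18
  |exact: H19|idtac|idtac|exact: within_contN|exact: H23].
- apply: within_contN; apply/within_cvgP => -[[[[X p] r] x] y] /= hA.
  apply: (within_comp (h := fun w : 'M[R]_(N + 1) * 'rV[R]_(N + 1) * R * 'rV[R]_N * R =>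
     (- w.1.1.1.1, - w.1.1.1.2, - w.1.1.2, w.1.2, w.2))
     (a := (- X, - p, - r, x, y)) Fc).
  + by case: hA => sX ? ?; split=> //; rewrite /symmx linearN/= sX.
  + pose W := ('M[R]_(N + 1) * 'rV[R]_(N + 1) * R * 'rV[R]_N * R)%type.
    have c0 : continuous (fun w : W => w) by move=> w; exact: cvg_id.
    have c1 : continuous (fun w : W => w.1) := cont_fst c0.
    have c2 : continuous (fun w : W => w.1.1) := cont_fst c1.
    have c3 : continuous (fun w : W => w.1.1.1) := cont_fst c2.
    have cX : continuous (fun w : W => w.1.1.1.1) := cont_fst c3.
    have cp : continuous (fun w : W => w.1.1.1.2) := cont_snd c3.
    have cr : continuous (fun w : W => w.1.1.2) := cont_snd c2.
    have cx : continuous (fun w : W => w.1.2) := cont_snd c1.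
    have cy : continuous (fun w : W => w.2) := cont_snd c0.
    have hc := cont_pair (cont_pair (cont_pair (cont_pair (cont_opp cX) (cont_opp cp))
      (cont_opp cr)) cx) cy.
    set A := (X in within X _).
    have hW := @within_continuous_at _ _ A _ (X, p, r, x, y) hc.
    exact: hW.
  + apply: filterS (@withinT _ _ _ _) => -[[[[X' p'] r'] x'] y'] /= [sX ? ?].
    by split=> //; rewrite /symmx linearN/= sX.
- move=> p x y cx yI X Y r s sX sY XY rs.
  have := Fm (- p) x y cx yI (- Y) (- X) (- s) (- r).
  rewrite /symmx !linearN/= sX sY lerN2 => /(_ erefl erefl _ rs) h.
  suff : psd_ge (- Y) (- X) by move=> /h; lra.
  by move=> v; have := XY v; rewrite opprK addrC.
- exact: CkN.
- move=> e e0; apply: filterS (H20 e e0) => y h x cx; have := h x cx.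
  by rewrite -normrN /= mulNr; congr (`|_| <= _); ring.
- move=> e e0; apply: filterS (H21 e e0) => y h x cx; have := h x cx.
  by rewrite -normrN /= mulNr; congr (`|_| <= _); ring.
Qed.

Lemma super_condN P eps : opp_cond (super_cond P eps) = sub_cond (neg P) eps.
Proof.
rewrite funeqE => X; rewrite funeqE => p; rewrite funeqE => r; rewrite funeqE => z.
apply/propext; rewrite /opp_cond /super_cond /sub_cond /thin_super_cond /thin_sub_cond /=.
rewrite oppr_le0 !dotNr.
have lE : lateral_super (lat P) (blat P) (- p) (- r) (xpart z) (ypart z) <->
    lateral_sub (lat P) (fun x y => - blat P x y) p r (xpart z) (ypart z).
  case: (lat P) => [g1 g2|] /=; last by rewrite lerNr.
  by rewrite dotNr lerNr.
by split=> -[?|[? /lE ?]|[? ?]|[? ?]];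
  [apply: Or41|apply: Or42|apply: Or43; rewrite -lerNr|apply: Or44; rewrite -lerNr
  |apply: Or41|apply: Or42|apply: Or43; rewrite lerNr|apply: Or44; rewrite lerNr].
Qed.

Lemma negK P : neg (neg P) = P.
Proof.
case: P => om nu g1 g2 F al v1 v2 b1 b2 ga be k1 k2 l1 l2 L bl.
rewrite /neg /=; congr Problem.
- by do 5!rewrite funeqE => ?; rewrite !opprK.
- by do 2!rewrite funeqE => ?; rewrite !opprK.
- by do 2!rewrite funeqE => ?; rewrite !opprK.
- by rewrite funeqE => ?; rewrite !opprK.
- by rewrite funeqE => ?; rewrite !opprK.
- by rewrite funeqE => ?; rewrite !opprK.
- by do 2!rewrite funeqE => ?; rewrite !opprK.
Qed.

Lemma solutionsN P eps u : solutions P eps u -> solutions (neg P) eps (fun z => - u z).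
Proof.
move=> [subu superu]; split; first by have /visc_superN := superu; rewrite super_condN.
apply/visc_superN; rewrite -/(super_cond (neg P) eps) super_condN negK.
by under [fun z => - - u z]eq_fun do rewrite opprK.
Qed.

Lemma limit_operN P X p r x : Ck 1 (beta0 P) -> limit_oper (neg P) X p r x = - limit_oper P (- X) (- p) (- r) x.
Proof.
move=> [db _]; rewrite /limit_oper /limit_operator /=; congr (- oper P _ _ _ _ _).
- have tN (M : 'rV[R]_N) : (- M)^T = - M^T by rewrite linearN.
  have sN (a : R) : (- a)%:M = - a%:M :> 'M[R]_1 by rewrite raddfN.
  have cN : coef_c (gtop P) (gbot P) (gamma0 P) (fun x => - beta0 P x)
      (fun x => - ltop P x) (fun x => - lbot P x) x =
      - coef_c (gtop P) (gbot P) (gamma0 P) (beta0 P) (ltop P) (lbot P) x.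
    by rewrite /coef_c gradN// dotNr !mulrN -opprD mulNr -opprD.
  by rewrite !opprD !opp_block_mx gradN// oppr0 cN !mulNmx !mulmxN !mulNmx !tN
    !opprK dotNr !sN !opprK.
- rewrite /pt opp_row_mx; congr row_mx.
  by rewrite -raddfN /= dotNr; congr (_%:M); ring.
Qed.

End Negation.

(** * Geometry of the thin domain and stability of the conditions *)

Lemma compact_norm_bound (R : realType) (T : topologicalType) (V : normedModType R)
    (A : set T) (f : T -> V) : compact A -> {within A, continuous f} ->
  exists2 M : R, 0 < M & forall x, A x -> `|f x| <= M.
Proof.
move=> cA cf; have [M [_ hM]] := compact_bounded (continuous_compact cf cA).
exists (Num.max M 0 + 1); first by rewrite ltr_wpDl// le_max lexx orbT.
move=> x Ax; apply: (hM (Num.max M 0 + 1)); last by exists x.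
by rewrite ltr_pwDr// le_max lexx.
Qed.

Lemma cont_comp (X Y Z : topologicalType) (f : X -> Y) (g : Y -> Z) :
  continuous f -> continuous g -> continuous (fun x => g (f x)).
Proof. by move=> cf cg x; apply: continuous_comp; [exact: cf|exact: cg]. Qed.

Lemma cvg_pairT (T : Type) (F : set_system T) {FF : Filter F} (Y Z : topologicalType)
    (f : T -> Y) (g : T -> Z) (y : Y) (z : Z) :
  f @ F --> y -> g @ F --> z -> (f t, g t) @[t --> F] --> (y, z).
Proof. by move=> fy gz; exact: cvg_pair. Qed.

Section ThinGeometry.
Context {R : realType} {N : nat} (P : problem R N) (hP : admissible P).
Implicit Types (x : 'rV[R]_N) (y eps : R) (z : 'rV[R]_(N + 1)).

Let Om_open : open (omega P). Proof. by have [] := omega_domain hP. Qed.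
Let Om_bounded : bounded_set (omega P). Proof. by have [] := omega_domain hP. Qed.
Let Om_ne : omega P !=set0. Proof. by have [] := omega_domain hP. Qed.

Lemma omega_compact : compact (closure (omega P)).
Proof. exact: closure_compact. Qed.

Lemma omega_bdry_compact : compact (bdry (omega P)).
Proof. exact: bdry_compact. Qed.

Lemma within_C (V W : normedModType R) k (f : V -> W) (A : set V) :
  Ck k f -> {within A, continuous f}.
Proof. by move=> /Ck_continuous cf; apply: continuous_subspaceT. Qed.

Lemma edge_C1 (g : 'rV[R]_N -> R) eps : Ck 1 g ->
  Ck 1 (fun z : 'rV[R]_(N + 1) => eps * g (xpart z) - ypart z).
Proof.
move=> Cg; apply: CkD; last exact: (CkN (Ck_linear 1 ypart_linear)).
by apply: CkZ; exact: (Ck_comp_linear xpart_linear Cg).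
Qed.

Lemma grad_edge (g : 'rV[R]_N -> R) eps z : Ck 1 g ->
  grad (fun z : 'rV[R]_(N + 1) => eps * g (xpart z) - ypart z) z =
  pt (eps *: grad g (xpart z)) (- 1).
Proof.
move=> [dg _]; apply: grad_unique => v.
have H := is_deriveB (is_deriveZ eps (is_derive_xpart v z dg)) (is_derive_ypart v z).
apply: etrans (@derive_val _ _ _ _ _ _ _ H) _.
rewrite (derive_grad _ (dg _)) -[v in RHS]pt_part dot_pt dotZr mulrN1.
by [].
Qed.

Lemma thin_closureP eps z : closure (thin P eps) z ->
  closure (omega P) (xpart z) /\ eps * gbot P (xpart z) <= ypart z <= eps * gtop P (xpart z).
Proof.
move=> cz; split.
  move=> V /(cvg_xpart (z:=z)) nV.
  by have [z' [[Oz' _] Vz']] := cz _ nV; exists (xpart z').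
have C1 := Ck_continuous (edge_C1 eps (gtop_C1 hP)).
have C2 := Ck_continuous (edge_C1 eps (gbot_C1 hP)).
apply/andP; split; rewrite leNgt; apply/negP => lt.
  have h : \forall z' \near z, 0 < eps * gbot P (xpart z') - ypart z'.
    by have /cvgr_gt := C2 z; apply; rewrite subr_gt0.
  have [z' [[_ /andP[h1 _]] h2]] := cz _ h.
  by move: h1 h2; lra.
have h : \forall z' \near z, eps * gtop P (xpart z') - ypart z' < 0.
  by have /cvgr_lt := C1 z; apply; rewrite subr_lt0.
have [z' [[_ /andP[_ h1]] h2]] := cz _ h.
by move: h1 h2; lra.
Qed.

Definition height_bound (G : R) := 0 < G /\ forall x, closure (omega P) x ->
  [/\ `|gtop P x| <= G, `|gbot P x| <= G, `|grad (gtop P) x| <= G & `|grad (gbot P) x| <= G].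

Lemma height_boundP : exists G, height_bound G.
Proof.
have cO := omega_compact.
have [M1 M10 h1] := compact_norm_bound cO (within_C (A := closure (omega P)) (gtop_C1 hP)).
have [M2 M20 h2] := compact_norm_bound cO (within_C (A := closure (omega P)) (gbot_C1 hP)).
have [M3 M30 h3] := compact_norm_bound cO (continuous_subspaceT (grad_continuous (gtop_C1 hP))).
have [M4 M40 h4] := compact_norm_bound cO (continuous_subspaceT (grad_continuous (gbot_C1 hP))).
exists (M1 + M2 + M3 + M4); split; first by rewrite !addr_gt0.
move=> x cx; have := h1 x cx; have := h2 x cx; have := h3 x cx; have := h4 x cx.
by move=> ? ? ? ?; split; lra.
Qed.

Lemma thin_y_bound G eps z : height_bound G -> 0 <= eps -> closure (thin P eps) z ->
  `|ypart z| <= eps * G.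
Proof.
move=> [G0 hG] e0 /thin_closureP[cx /andP[y1 y2]].
have [gt gb _ _] := hG _ cx.
have : eps * gtop P (xpart z) <= eps * G by rewrite ler_wpM2l// (le_trans (ler_norm _)).
have : eps * (- G) <= eps * gbot P (xpart z).
  by rewrite ler_wpM2l//; move: gb; rewrite ler_norml => /andP[].
by rewrite ler_norml; move: y1 y2; move=> ? ? ? ?; apply/andP; split; lra.
Qed.

Lemma thin_compact eps : compact (closure (thin P eps)).
Proof.
apply: bounded_closed_compact; last exact: closed_closure.
have [G hG] := height_boundP; have [G0 hG'] := hG.
have [M M0 hM] : exists2 M : R, 0 < M & forall x, closure (omega P) x -> `|x| <= M.
  by apply: compact_norm_bound; [exact: omega_compact|apply: continuous_subspaceT => x; exact: cvg_id].
apply: (@filterS _ _ _ [set k | M + `|eps| * G <= k]); last first.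
  exact: (nbhs_pinfty_ge (num_real _)).
move=> k /= hk z cz; have [cx /andP[y1 y2]] := thin_closureP cz.
have [gt gb _ _] := hG' _ cx.
have e1 : `|eps * gtop P (xpart z)| <= `|eps| * G by rewrite normrM ler_wpM2l.
have e2 : `|eps * gbot P (xpart z)| <= `|eps| * G by rewrite normrM ler_wpM2l.
apply: norm_pt_le.
  by apply: le_trans (hM _ cx) _; apply: le_trans hk; rewrite lerDl mulr_ge0// ltW.
move: e1 e2 y1 y2 hk M0; rewrite !ler_norml => /andP[? ?] /andP[? ?] ? ? ? ?.
by apply/andP; split; lra.
Qed.

Definition in_slab eps : Prop :=
  0 < eps /\ forall z, closure (thin P eps) z -> -1 <= ypart z <= 1.

Lemma near_slab : \forall eps \near 0^'+, in_slab eps.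
Proof.
have [G hG] := height_boundP; have [G0 _] := hG.
have h : \forall eps \near (0 : R)^'+, eps < G^-1 by apply: nbhs_right_lt; rewrite invr_gt0.
apply: filterS2 h (nbhs_right_gt 0) => eps e1 e0; split=> // z cz.
rewrite -ler_norml (le_trans (thin_y_bound hG (ltW e0) cz))//.
by rewrite -ler_pdivlMr// mul1r ltW.
Qed.

Lemma thin_in_cylinder eps z : in_slab eps -> closure (thin P eps) z ->
  cylinder (closure (omega P)) (xpart z, ypart z).
Proof.
move=> [_ h] cz; split; first by have [] := thin_closureP cz.
by rewrite /= in_itv/= h.
Qed.

Lemma thin_near_base eps x r : 0 < eps -> 0 < r -> closure (omega P) x ->
  exists z, thin P eps z /\ `|xpart z - x| < r.
Proof.
move=> e0 r0 cx; have [x' [Ox' hx']] := cx _ (nbhsx_ballx x r r0).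
have lt := gbot_lt_gtop hP (@subset_closure _ (omega P) _ Ox').
exists (pt x' (eps * ((gtop P x' + gbot P x') / 2))).
rewrite /thin /thin_domain /= xpart_pt ypart_pt; split; last first.
  by move: hx'; rewrite -ball_normE /ball_/= distrC.
by split=> //; rewrite !ltr_pM2l//; move: lt => ?; apply/andP; split; lra.
Qed.

Lemma continuous_edge (g : 'rV[R]_N -> R) eps : Ck 1 g ->
  continuous (fun z : 'rV[R]_(N + 1) => eps * g (xpart z) - ypart z).
Proof. by move=> Cg; exact: Ck_continuous (edge_C1 eps Cg). Qed.

Lemma closed_over (A : set 'rV[R]_N) : closed A -> closed (fun z : 'rV[R]_(N + 1) => A (xpart z)).
Proof.
move=> cA; apply: (@closed_comp _ _ xpart) => // z _; exact: cvg_xpart.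
Qed.

Lemma closed_level (h : 'rV[R]_(N + 1) -> R) : continuous h -> closed [set z | 0 <= h z].
Proof. move=> ch; exact: (closed_comp (fun z _ => ch z) (@closed_ge R 0)). Qed.

Lemma graph_closed (g : 'rV[R]_N -> R) eps : Ck 1 g ->
  closed [set z : 'rV[R]_(N + 1) | closure (omega P) (xpart z) /\ ypart z = eps * g (xpart z)].
Proof.
move=> Cg; rewrite (_ : [set _ | _] = (fun z => closure (omega P) (xpart z)) `&`
    ([set z | 0 <= eps * g (xpart z) - ypart z] `&`
     [set z | 0 <= - (eps * g (xpart z) - ypart z)])); last first.
  apply/seteqP; split=> z /=.
    by move=> [cx ->]; split=> //; split=> /=; rewrite subrr ?oppr0.
  move=> [cx [/= h1 h2]]; split=> //; apply/eqP; rewrite eq_le.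
  by move: h1 h2 => ? ?; apply/andP; split; lra.
have ce : continuous (fun z : 'rV[R]_(N + 1) => eps * g (xpart z) - ypart z).
  exact: continuous_edge Cg.
apply: closedI; first by apply: closed_over; exact: closed_closure.
by apply: closedI; apply: closed_level => //; exact: cont_opp.
Qed.

Lemma lateral_closed eps : closed (lateral_bdry (omega P) (gtop P) (gbot P) eps).
Proof.
have -> : lateral_bdry (omega P) (gtop P) (gbot P) eps = (fun z => bdry (omega P) (xpart z)) `&`
    ([set z | 0 <= eps * gtop P (xpart z) - ypart z] `&`
     [set z | 0 <= - (eps * gbot P (xpart z) - ypart z)]).
  apply/seteqP; split=> z /=.
    by move=> [cx /andP[h1 h2]]; split=> //; split=> /=; move: h1 h2; lra.
  by move=> [cx [/= h1 h2]]; split=> //; move: h1 h2 => ? ?; apply/andP; split; lra.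
apply: closedI; first by apply: closed_over; exact: bdry_closed.
apply: closedI; apply: closed_level; first exact: continuous_edge (gtop_C1 hP).
by apply: cont_opp; exact: continuous_edge (gbot_C1 hP).
Qed.

Lemma jet_proj (A : set (@jet R (N + 1))) (w0 : @jet R (N + 1)) :
  [/\ w.1.1.1 @[w --> within A (nbhs w0)] --> w0.1.1.1,
      w.1.1.2 @[w --> within A (nbhs w0)] --> w0.1.1.2,
      w.1.2 @[w --> within A (nbhs w0)] --> w0.1.2,
      xpart w.2 @[w --> within A (nbhs w0)] --> xpart w0.2 &
      ypart w.2 @[w --> within A (nbhs w0)] --> ypart w0.2].
Proof.
have c0 : continuous (fun w : @jet R (N + 1) => w) by move=> w; exact: cvg_id.
have c1 : continuous (fun w : @jet R (N + 1) => w.1) := cont_fst c0.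
have c2 : continuous (fun w : @jet R (N + 1) => w.1.1) := cont_fst c1.
have cX : continuous (fun w : @jet R (N + 1) => w.1.1.1) := cont_fst c2.
have cp : continuous (fun w : @jet R (N + 1) => w.1.1.2) := cont_snd c2.
have cr : continuous (fun w : @jet R (N + 1) => w.1.2) := cont_snd c1.
have cz : continuous (fun w : @jet R (N + 1) => w.2) := cont_snd c0.
have [_ cx] := @xpart_linear R N; have [_ cy] := @ypart_linear R N.
split; apply: within_continuous_at => //.
  exact: (cont_comp cz cx).
exact: (cont_comp cz cy).
Qed.

Lemma stable_true (K : set 'rV[R]_(N + 1)) (c : 'M[R]_(N + 1) -> 'rV[R]_(N + 1) -> R -> 'rV[R]_(N + 1) -> R) :
  (forall X p r z, symmx X -> K z ->
    c w.1.1.1 w.1.1.2 w.1.2 w.2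
      @[w --> within [set w | [/\ symmx w.1.1.1, K w.2 & True]] (nbhs (X, p, r, z))]
      --> c X p r z) ->
  stable_failure K (fun X p r z => c X p r z <= 0).
Proof.
move=> h; apply: (@stable_iff _ _ _ (fun X p r z => setT z /\ c X p r z <= 0)).
  by move=> X p r z; split=> [[]|].
apply: stable_le; first exact: closedT.
by move=> X p r z sX Kz _; exact: h.
Qed.

Lemma stable_boundary (K D : set 'rV[R]_(N + 1)) (B : set 'rV[R]_N)
    (v : 'rV[R]_N -> R -> 'rV[R]_(N + 1)) (b : 'rV[R]_N -> R -> R) :
  closed D ->
  {within cylinder B, continuous (fun w => v w.1 w.2)} ->
  {within cylinder B, continuous (fun w => b w.1 w.2)} ->
  (forall z, K z -> D z -> cylinder B (xpart z, ypart z)) ->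
  stable_failure K (fun _ p _ z => D z /\
    dot (v (xpart z) (ypart z)) p <= b (xpart z) (ypart z)).
Proof.
move=> cD cv cb KD.
apply: (@stable_iff _ _ _ (fun X p r z => D z /\
    dot (v (xpart z) (ypart z)) p - b (xpart z) (ypart z) <= 0)).
  by move=> X p r z; rewrite subr_le0.
apply: (stable_le (c := fun X p r z => dot (v (xpart z) (ypart z)) p - b (xpart z) (ypart z))) => //.
move=> X p r z sX Kz Dz; set W := (X in within X _).
have [_ hp _ hx hy] := jet_proj W (X, p, r, z).
have inB : \forall w \near within W (nbhs (X, p, r, z)), cylinder B (xpart w.2, ypart w.2).
  by apply: filterS (@withinT _ _ _ _) => w [_ Kw Dw]; exact: KD.
pose proof (cvg_pairT hx hy) as hxy.
pose proof (within_comp cv (KD z Kz Dz) hxy inB) as hv.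
pose proof (within_comp cb (KD z Kz Dz) hxy inB) as hb.
exact: cvgB (cvg_dot hv hp) hb.
Qed.

Lemma pt_cont (B : set 'rV[R]_N) (v : 'rV[R]_N -> R -> 'rV[R]_N) (a : R) :
  {within cylinder B, continuous (fun w => v w.1 w.2)} ->
  {within cylinder B, continuous (fun w => pt (v w.1 w.2) a)}.
Proof.
move=> /within_cvgP cv; apply/within_cvgP => w Bw.
apply: cvg_pt; first exact: cv.
exact: cvg_cst.
Qed.

Lemma equation_stable (K : set 'rV[R]_(N + 1)) :
  (forall z, K z -> cylinder (closure (omega P)) (xpart z, ypart z)) ->
  stable_failure K (fun X p r z => oper P X p r (xpart z) (ypart z) <= 0).
Proof.
move=> hK; apply: (stable_true (c := fun X p r z => oper P X p r (xpart z) (ypart z))).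
move=> X p r z sX Kz; set W := (X in within X _).
have [hX hp hr hx hy] := jet_proj W (X, p, r, z).
pose proof (cvg_pairT (cvg_pairT (cvg_pairT (cvg_pairT hX hp) hr) hx) hy) as hw.
apply: (within_comp (oper_cont hP) _ hw); rewrite /=.
  by have [cx /=] := hK z Kz; rewrite in_itv/=; split.
apply: filterS (@withinT _ _ _ _) => w [sw Kw _] /=.
by have [cx /=] := hK _ Kw; rewrite in_itv/=; split.
Qed.

Lemma lateral_stable (K D : set 'rV[R]_(N + 1)) : closed D ->
  (forall z, K z -> D z -> cylinder (bdry (omega P)) (xpart z, ypart z)) ->
  stable_failure K (fun _ p r z => D z /\ lateral_sub (lat P) (blat P) p r (xpart z) (ypart z)).
Proof.
move=> cD lc; have := lat_ok hP; case: (lat P) => [g1 g2 [cg _ _]|_] /=.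
  apply: (stable_boundary (v := fun x y => pt (g1 x y) (g2 x y))) => //.
  exact: blat_cont.
apply: (@stable_iff _ _ _ (fun X p r z => D z /\ r - blat P (xpart z) (ypart z) <= 0)).
  by move=> X p r z; rewrite subr_le0.
apply: (stable_le (c := fun X p r z => r - blat P (xpart z) (ypart z))) => //.
move=> X p r z sX Kz Dz; set W := (X in within X _).
have [_ _ hr hx hy] := jet_proj W (X, p, r, z).
have inB : \forall w \near within W (nbhs (X, p, r, z)),
    cylinder (bdry (omega P)) (xpart w.2, ypart w.2).
  by apply: filterS (@withinT _ _ _ _) => w [_ Kw Dw]; exact: lc.
pose proof (within_comp (blat_cont hP) (lc z Kz Dz) (cvg_pairT hx hy) inB) as hb.
exact: cvgB hr hb.
Qed.

Lemma sub_cond_stable eps : in_slab eps ->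
  stable_failure (closure (thin P eps)) (sub_cond P eps).
Proof.
move=> he.
pose E1 (X : 'M[R]_(N + 1)) p r z := oper P X p r (xpart z) (ypart z) <= 0.
pose E2 (X : 'M[R]_(N + 1)) p r z := lateral_bdry (omega P) (gtop P) (gbot P) eps z /\
  lateral_sub (lat P) (blat P) p r (xpart z) (ypart z).
pose E3 (X : 'M[R]_(N + 1)) p (r : R) z := top_bdry (omega P) (gtop P) eps z /\
  dot (pt (vtop P (xpart z) (ypart z)) 1) p <= btop P (xpart z) (ypart z).
pose E4 (X : 'M[R]_(N + 1)) p (r : R) z := bottom_bdry (omega P) (gbot P) eps z /\
  dot (pt (vbot P (xpart z) (ypart z)) (- 1)) p <= bbot P (xpart z) (ypart z).
apply: (@stable_iff _ _ _ (fun X p r z => E1 X p r z \/ (E2 X p r z \/ (E3 X p r z \/ E4 X p r z)))).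
  move=> X p r z; split=> [[|[|[|]]] h|[] h]; [exact: Or41|exact: Or42|exact: Or43|exact: Or44|..].
  - by left.
  - by right; left.
  - by right; right; left.
  - by right; right; right.
apply: stable_or; last apply: stable_or; last apply: stable_or.
- by apply: equation_stable => z; exact: thin_in_cylinder.
- apply: lateral_stable; first exact: lateral_closed.
  by move=> z Kz [bz _]; have [_] := thin_in_cylinder he Kz; split.
- apply: (stable_boundary (v := fun x y => pt (vtop P x y) 1) (B := closure (omega P))) => //.
  + exact: graph_closed (gtop_C1 hP).
  + exact: pt_cont (vtop_cont hP).
  + exact: btop_cont.
  + by move=> z Kz _; exact: thin_in_cylinder he Kz.
- apply: (stable_boundary (v := fun x y => pt (vbot P x y) (- 1)) (B := closure (omega P))) => //.
  + exact: graph_closed (gbot_C1 hP).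
  + exact: pt_cont (vbot_cont hP).
  + exact: bbot_cont.
  + by move=> z Kz _; exact: thin_in_cylinder he Kz.
Qed.

End ThinGeometry.

Section SuperStable.
Context {R : realType} {N : nat} (P : problem R N) (hP : admissible P).

Lemma super_cond_stable (eps : R) : in_slab P eps ->
  stable_failure (closure (thin P eps)) (super_cond P eps).
Proof.
move=> he; apply: stable_opp; rewrite super_condN.
exact: (sub_cond_stable (neg_admissible hP)).
Qed.

End SuperStable.

(** * Smooth strict subsolutions on thin domains *)

Section Touching.
Context {R : realType} {N : nat}.
Implicit Types (P : problem R N) (x v : 'rV[R]_N) (y eps : R) (z : 'rV[R]_(N + 1)).

Lemma normal_near_continuous P : admissible P -> forall x, bdry (omega P) x ->
  forall e : R, 0 < e -> \forall x' \near x, bdry (omega P) x' -> `|normal P x - normal P x'| <= e.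
Proof.
move=> hP x bx e e0; have [_ Oo _ Ob] := omega_domain hP.
have [d d0 h] := near0_right (normal_uniform Oo Ob (normal_ok hP) e0).
have d20 : 0 < d / 2 by rewrite divr_gt0.
have d2d : d / 2 < d by rewrite gtr_pMr// invf_lt1// ltr1n.
apply: filterS (nbhsx_ballx x _ d20) => x'; rewrite -ball_normE/= => x'x bx'.
have x'x' : `|x' - x| < d / 2 by rewrite distrC.
by have [_] := h _ d20 d2d x x' bx x'x' bx'; rewrite distrC.
Qed.

Lemma normal_continuous P : admissible P -> {within bdry (omega P), continuous (normal P)}.
Proof.
move=> hP; apply/within_cvgP => x bx; apply/cvgrPdist_le => e e0.
exact: normal_near_continuous.
Qed.

Lemma transversal_bound P g1 g2 : admissible P -> lat P = Oblique g1 g2 ->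
  exists c0 M : R, [/\ 0 < c0, 0 < M &
    forall x y, bdry (omega P) x -> -1 <= y <= 1 ->
      [/\ c0 <= dot (g1 x y) (normal P x), `|g1 x y| <= M & `|g2 x y| <= M]].
Proof.
move=> hP latE; have := lat_ok hP; rewrite latE => -[cg pos _].
have cB : compact (cylinder (bdry (omega P))).
  by apply: compact_setX; [exact: omega_bdry_compact|exact: segment_compact].
have [M M0 hM] := compact_norm_bound cB cg.
have bd x y : bdry (omega P) x -> -1 <= y <= 1 -> `|g1 x y| <= M /\ `|g2 x y| <= M.
  move=> bx yI; have := hM (x, y); rewrite /= => h.
  have {}h : `|pt (g1 x y) (g2 x y)| <= M by apply: h; split=> //=; rewrite in_itv.
  split; apply: le_trans h.
    by rewrite -{1}(xpart_pt (g1 x y) (g2 x y)); exact: norm_xpart.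
  by rewrite -{1}(ypart_pt (g1 x y) (g2 x y)); exact: norm_ypart.
have [[x0 bx0]|nb] := pselect (bdry (omega P) !=set0); last first.
  by exists 1, M; split=> // x y bx; case: nb; exists x.
pose f (w : 'rV[R]_N * R) := dot (g1 w.1 w.2) (normal P w.1).
have cf : {within cylinder (bdry (omega P)), continuous f}.
  apply/within_cvgP => w Bw; have [bw wI] := Bw.
  have h1 : pt (g1 w'.1 w'.2) (g2 w'.1 w'.2) @[w' --> within (cylinder (bdry (omega P))) (nbhs w)]
      --> pt (g1 w.1 w.2) (g2 w.1 w.2).
    by have /within_cvgP := cg; exact.
  have [_ cx] := @xpart_linear R N.
  pose proof (cvg_comp _ _ h1 (cx _)) as h2.
  rewrite xpart_pt in h2.
  have h3 : normal P w'.1 @[w' --> within (cylinder (bdry (omega P))) (nbhs w)] --> normal P w.1.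
    apply: (within_comp (normal_continuous hP) bw).
      by apply: within_continuous_at; apply: cont_fst => w'; exact: cvg_id.
    by apply: filterS (@withinT _ _ _ _) => w' [].
  apply: cvg_dot h3.
  rewrite [X in X @ _](_ : _ = fun w' => xpart (pt (g1 w'.1 w'.2) (g2 w'.1 w'.2)))//.
  by rewrite funeqE => w'; rewrite xpart_pt.
have [w Bw mn] : exists2 w, w \in cylinder (bdry (omega P)) &
    forall t, t \in cylinder (bdry (omega P)) -> f w <= f t.
  apply: compact_EVT_min => //; exists (x0, 0); split=> //=.
  by rewrite in_itv/= lerN10 ler01.
rewrite inE in Bw; have [bw wI] := Bw.
exists (f w), M; split=> //.
  by apply: pos => //; move: wI; rewrite /= in_itv.
move=> x y bx yI; have [h1 h2] := bd x y bx yI; split=> //.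
by apply: (mn (x, y)); rewrite inE; split=> //=; rewrite in_itv.
Qed.

Definition edge_pos P eps z := eps * gtop P (xpart z) - ypart z.
Definition edge_neg P eps z := ypart z - eps * gbot P (xpart z).

(** At edges the inward directions of both faces have to be combined; the faces that
    do not pass through [z] impose nothing. *)
Lemma inward_direction P eps z (t : 'rV[R]_(N + 1)) : admissible P -> 0 < eps ->
  closure (thin P eps) z ->
  omega P (xpart z) \/ bdry (omega P) (xpart z) /\ dot (normal P (xpart z)) (xpart t) < 0 ->
  0 < edge_pos P eps z \/ ypart t < eps * dot (xpart t) (grad (gtop P) (xpart z)) ->
  0 < edge_neg P eps z \/ eps * dot (xpart t) (grad (gbot P) (xpart z)) < ypart t ->
  \forall s \near 0^'+, closure (thin P eps) (z + s *: t).
Proof.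
move=> hP e0 cz hx ht hb; have [_ Oo _ Ob] := omega_domain hP.
have [cx /andP[y1 y2]] := thin_closureP hP cz.
have nx : \forall s \near 0^'+, omega P (xpart z + s *: xpart t).
  case: hx => [Ox|[bx nt]]; last exact: (inward_near Oo (normal_ok hP) bx nt).
  have := line_near (xpart t) (open_nbhs_nbhs (conj Oo Ox)).
  by apply: filterS2 (nbhs_right_gt 0) => s s0; apply; rewrite s0 lexx.
have top : \forall s \near 0^'+, 0 < edge_pos P eps (z + s *: t).
  apply: pos_along; first exact: edge_C1 (gtop_C1 hP).
  case: ht => h; [by left|right; split; first by rewrite subr_ge0].
  rewrite grad_edge; last exact: gtop_C1.
  by rewrite -{1}[t]pt_part dot_pt dotZr mulrN1 subr_gt0.
have bot : \forall s \near 0^'+, 0 < edge_neg P eps (z + s *: t).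
  have C := edge_C1 eps (gbot_C1 hP); have [d _] := C.
  have h' : \forall s \near 0^'+, 0 < - (eps * gbot P (xpart (z + s *: t)) - ypart (z + s *: t)).
    apply: (pos_along (f := fun z => - (eps * gbot P (xpart z) - ypart z))); first exact: CkN.
    rewrite opprB; case: hb => h; [by left|right; split; first by rewrite subr_ge0].
    rewrite gradN// grad_edge; last exact: gbot_C1.
    by rewrite dotNr -{1}[t]pt_part dot_pt dotZr mulrN1 opprB subr_gt0.
  by apply: filterS h' => s; rewrite opprB.
apply: filterS3 nx top bot => s sx s1 s2; apply: subset_closure.
have [lx _] := @xpart_linear R N.
rewrite /thin /thin_domain /=.
split; first by rewrite addrC lx addrC.
by apply/andP; split; rewrite -subr_gt0.
Qed.

Lemma touch_direction P eps z (t : 'rV[R]_(N + 1)) (phi psi : 'rV[R]_(N + 1) -> R) : Ck 2 phi -> Ck 2 psi ->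
  (forall z', closure (thin P eps) z' -> psi z - phi z <= psi z' - phi z') ->
  (\forall s \near 0^'+, closure (thin P eps) (z + s *: t)) ->
  dot t (grad phi z) <= dot t (grad psi z).
Proof.
move=> Cphi Cpsi mn ht; have [dphi _] := Cphi; have [dpsi _] := Cpsi.
have C : Ck 2 (fun z' => psi z' - phi z') by exact: (CkD Cpsi (CkN Cphi)).
rewrite -subr_ge0 -dotBr.
have <- : grad (fun z' => psi z' - phi z') z = grad psi z - grad phi z.
  apply: etrans (gradD (dpsi z) _) _; last by rewrite gradN.
  exact: differentiableN.
by apply: derive_ge0_at; [exact: Ck_pred|apply: filterS ht => s /mn].
Qed.

Lemma ptD x x' y y' : pt x y + pt x' y' = pt (x + x') (y + y').
Proof. by rewrite /pt add_row_mx raddfD. Qed.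

Lemma ptZ (a : R) x y : a *: pt x y = pt (a *: x) (a * y).
Proof. by rewrite /pt scale_row_mx scale_scalar_mx. Qed.

Lemma ptN x y : - pt x y = pt (- x) (- y).
Proof. by rewrite /pt opp_row_mx raddfN. Qed.

Lemma thin_open_near P eps z : admissible P -> thin P eps z ->
  \forall z' \near z, closure (thin P eps) z'.
Proof.
move=> hP [Oz /andP[h1 h2]]; have [_ Oo _ _] := omega_domain hP.
have n1 : \forall z' \near z, omega P (xpart z').
  exact: (cvg_xpart (open_nbhs_nbhs (conj Oo Oz))).
have n2 : \forall z' \near z, 0 < eps * gtop P (xpart z') - ypart z'.
  have /cvgr_gt := continuous_edge (eps := eps) (gtop_C1 hP) (x := z).
  by apply; rewrite subr_gt0.
have n3 : \forall z' \near z, eps * gbot P (xpart z') - ypart z' < 0.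
  have /cvgr_lt := continuous_edge (eps := eps) (gbot_C1 hP) (x := z).
  by apply; rewrite subr_lt0.
apply: filterS3 n1 n2 n3 => z' o1 o2 o3; apply: subset_closure; split=> //.
by rewrite -subr_lt0 o3 -subr_gt0.
Qed.

Lemma touch_interior P eps z (phi psi : 'rV[R]_(N + 1) -> R) : admissible P -> in_slab P eps ->
  thin P eps z -> Ck 2 phi -> Ck 2 psi ->
  (forall z', closure (thin P eps) z' -> psi z - phi z <= psi z' - phi z') ->
  forall r, oper P (hess psi z) (grad psi z) r (xpart z) (ypart z) <=
            oper P (hess phi z) (grad phi z) r (xpart z) (ypart z).
Proof.
move=> hP he tz Cphi Cpsi mn r; have [dphi _] := Cphi; have [dpsi _] := Cpsi.
have CN := CkN Cphi.
have C : Ck 2 (fun z' => psi z' - phi z') by exact: (CkD Cpsi CN).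
have mn' : \forall z' \near z, psi z - phi z <= psi z' - phi z'.
  by apply: filterS (thin_open_near hP tz) => z' /mn.
have gE : grad (fun z' => psi z' - phi z') z = grad psi z - grad phi z.
  apply: etrans (gradD (dpsi z) _) _; last by rewrite gradN.
  exact: differentiableN.
have hE : hess (fun z' => psi z' - phi z') z = hess psi z - hess phi z.
  by apply: etrans (hessD z Cpsi CN) _; rewrite hessN.
have g0 := derive_eq0_at_min (Ck_pred C) mn'.
rewrite gE in g0; move/eqP: g0; rewrite subr_eq0 => /eqP ->.
have Kz := subset_closure tz.
have [cx yI] := thin_in_cylinder hP he Kz; rewrite /= in_itv/= in yI.
have := oper_mono hP (grad phi z) cx yI (hess_sym z Cpsi) (hess_sym z Cphi) _ (lexx r).
rewrite lerD2r; apply => v; rewrite -hE.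
exact: hess_ge0_at_min.
Qed.

Lemma cylinder_uniform (V : normedModType R) (B : set 'rV[R]_N) (f : 'rV[R]_N -> R -> V) (e : R) :
  compact B -> {within cylinder B, continuous (fun w => f w.1 w.2)} -> 0 < e ->
  \forall d \near 0^'+, forall x y, B x -> `|y| <= d -> `|f x y - f x 0| <= e.
Proof.
move=> /compact_near_coveringP/near_covering_withinP cB cf e0.
suff : \forall d \near (0 : R)^'+, B `<=` (fun x => forall y : R, `|y| <= d -> `|f x y - f x 0| <= e).
  by apply: filterS => d h x y bx; exact: h.
apply: (cB _ _ (fun d x => forall y : R, `|y| <= d -> `|f x y - f x 0| <= e)) => x bx.
have base x' : B x' -> cylinder B (x', 0 : R).
  by move=> bx'; split=> //=; rewrite in_itv/= lerN10 ler01.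
have e20 : 0 < e / 2 by rewrite divr_gt0.
have /within_cvgP/(_ _ (base x bx))/cvgrPdist_le/(_ _ e20)/nbhs_ballP[r /= r0 h] := cf.
have r10 : 0 < Num.min r 1 by rewrite lt_min r0 ltr01.
exists (ball x r, [set d | d < Num.min r 1]).
  by split; [exact: nbhsx_ballx|exact: nbhs_right_lt].
move=> [x' d] /= [xr]; rewrite lt_min => /andP[dr d1] bx' y yd.
have yr : `|y| < r by exact: le_lt_trans dr.
have y1 : `|y| <= 1 by exact: le_trans yd (ltW d1).
have k1 : `|f x 0 - f x' y| <= e / 2.
  apply: (h (x', y)); first by split=> //=; rewrite -ball_normE/= sub0r normrN.
  by split=> //=; rewrite in_itv/= -ler_norml.
have k2 : `|f x 0 - f x' 0| <= e / 2.
  by apply: (h (x', 0)); [split=> //=; exact: ballxx|exact: base].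
by rewrite [e]splitr; exact: dist_via k1 k2.
Qed.

Lemma oblique_vertical_small P g1 g2 (e : R) : admissible P -> lat P = Oblique g1 g2 ->
  0 < e -> \forall d \near 0^'+, forall x y, bdry (omega P) x -> `|y| <= d -> `|g2 x y| < e.
Proof.
move=> hP latE e0; have := lat_ok hP; rewrite latE => -[cg _ g20].
have e20 : 0 < e / 2 by rewrite divr_gt0.
have := cylinder_uniform (f := fun x y => pt (g1 x y) (g2 x y)) (omega_bdry_compact hP) cg e20.
apply: filterS => d h x y bx yd; have := h x y bx yd; rewrite ptN ptD g20// subr0 => h1.
have := le_trans (norm_ypart _) h1; rewrite ypart_pt => /le_lt_trans; apply.
by rewrite gtr_pMr// invf_lt1// ltr1n.
Qed.

Lemma conormal_bound P : admissible P -> exists M : R, 0 < M /\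
  forall x y, closure (omega P) x -> -1 <= y <= 1 -> `|vtop P x y| <= M /\ `|vbot P x y| <= M.
Proof.
move=> hP; have cB : compact (cylinder (closure (omega P))).
  by apply: compact_setX; [exact: omega_compact|exact: segment_compact].
have [M1 M10 h1] := compact_norm_bound cB (vtop_cont hP).
have [M2 M20 h2] := compact_norm_bound cB (vbot_cont hP).
exists (M1 + M2); split; first by rewrite addr_gt0.
move=> x y cx yI; have B : cylinder (closure (omega P)) (x, y) by split=> //=; rewrite in_itv.
have := h1 _ B; have := h2 _ B; move=> /= k2 k1; split.
  by rewrite (le_trans k1)// lerDl ltW.
by rewrite (le_trans k2)// lerDr ltW.
Qed.

Lemma normal_bound P : admissible P -> exists2 M : R, 0 < M &
  forall x, bdry (omega P) x -> `|normal P x| <= M.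
Proof.
by move=> hP; apply: compact_norm_bound; [exact: omega_bdry_compact|exact: normal_continuous].
Qed.

Lemma norm_dot_le n (u v : 'rV[R]_n) (a b : R) : `|u| <= a -> `|v| <= b ->
  `|dot u v| <= n%:R * a * b.
Proof.
move=> ua vb; apply: le_trans (norm_dot u v) _.
by rewrite ler_pM ?mulr_ge0// ler_wpM2l.
Qed.

(** At every boundary point a positive combination of the conormals of the faces through
    it points outward, also at the edges, where the lateral conormal is nearly
    horizontal.  Derivatives along it are ordered at a point of touching, so one of the
    strict inequalities in the combination carries over. *)
Lemma thin_strict_sub_touched P : admissible P -> \forall eps \near 0^'+,
  strict_sub_touched (closure (thin P eps)) (sub_cond P eps) (super_cond P eps).
Proof.
move=> hP; have [G hG] := height_boundP hP; have [G0 hG'] := hG.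
have [M1 [M10 hM1]] := conormal_bound hP.
have [Mn Mn0 hMn] := normal_bound hP.
have n0 : 0 <= N%:R :> R by [].
(* [mu] is small enough for the horizontal part of the combined conormal to be outward,
   and [eps] then so small that its vertical part outweighs the slope of the graph *)
have [mu [mu0 edge]] : exists mu : R, 0 < mu /\ \forall eps \near 0^'+,
    forall g1 g2, lat P = Oblique g1 g2 -> forall x y, bdry (omega P) x -> `|y| <= eps * G ->
      -1 <= y <= 1 -> forall v, `|v| <= M1 ->
      [/\ 0 < dot (g1 x y) (normal P x), 0 < dot (normal P x) (g1 x y + mu *: v) &
        forall q, `|q| <= G -> eps * `|dot (g1 x y + mu *: v) q| < mu - `|g2 x y|].
  case latE: (lat P) => [g1 g2|]; last by exists 1; split=> //; near=> eps.
  have [c0 [M [c00 M0 hM]]] := transversal_bound hP latE.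
  pose Gam := N%:R * Mn * M1 + 1.
  have Gam0 : 0 < Gam by rewrite ltr_wpDl// !mulr_ge0// ltW.
  pose mu := c0 / (2 * Gam).
  have mu0 : 0 < mu by rewrite divr_gt0// mulr_gt0.
  exists mu; split=> //.
  have mu20 : 0 < mu / 2 by rewrite divr_gt0.
  have [d d0 hd] := near0_right (oblique_vertical_small hP latE mu20).
  pose D := N%:R * (M + mu * M1) * G + 1.
  have MM : 0 <= M + mu * M1 by rewrite addr_ge0 ?(ltW M0)// mulr_ge0// ltW.
  have D0 : 0 < D by rewrite ltr_wpDl// !mulr_ge0// ltW.
  near=> eps => _ _ [<- <-] x y bx yG yI v vM.
  have e0 : 0 < eps by [].
  have eG : eps * G < d.
    by rewrite -ltr_pdivlMr//; near: eps; apply: nbhs_right_lt; rewrite divr_gt0.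
  have eD : eps * D < mu / 2.
    by rewrite -ltr_pdivlMr//; near: eps; apply: nbhs_right_lt; rewrite divr_gt0.
  have [h1 h2 h3] := hM x y bx yI.
  have eG0 : 0 < eps * G by rewrite mulr_gt0.
  have g2s := hd _ eG0 eG x y bx yG.
  have nv := norm_dot_le (hMn x bx) vM.
  have gv : `|g1 x y + mu *: v| <= M + mu * M1.
    apply: le_trans (ler_normD _ _) _; rewrite lerD// normrZ gtr0_norm//.
    by rewrite ler_wpM2l// ltW.
  have muG : mu * Gam = c0 / 2 by rewrite /mu; field; rewrite gt_eqF.
  split; first exact: lt_le_trans h1.
    rewrite dotDr dotZr dotC.
    have : mu * `|dot (normal P x) v| <= mu * Gam.
      by apply: ler_wpM2l; [exact: ltW|rewrite /Gam (le_trans nv)// lerDl].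
    rewrite muG => h4.
    have : - (mu * dot (normal P x) v) <= mu * `|dot (normal P x) v|.
      by rewrite -mulrN; apply: ler_wpM2l; [exact: ltW|rewrite -normrN ler_norm].
    by move: h1 h4 c00; clear; lra.
  move=> q qG; have := norm_dot_le gv qG; set B := `|dot _ q| => hB.
  have : eps * B <= eps * D.
    by apply: ler_wpM2l; [exact: ltW|rewrite /D (le_trans hB)// lerDl].
  by move: eD g2s; clear; lra.
have slab := near_slab hP.
have K0 : 0 < N%:R * M1 * G + 1 by rewrite ltr_wpDl// !mulr_ge0// ltW.
have small : \forall eps \near 0^'+, forall v q : 'rV[R]_N, `|v| <= M1 -> `|q| <= G ->
    eps * `|dot v q| < 1.
  near=> eps => v q vM qG; have := norm_dot_le vM qG => h.
  have e0 : 0 < eps by [].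
  apply: le_lt_trans (ler_wpM2l (ltW e0) h) _.
  apply: (@le_lt_trans _ _ (eps * (N%:R * M1 * G + 1))).
    by rewrite ler_pM2l// lerDl.
  rewrite -ltr_pdivlMr//; near: eps; apply: nbhs_right_lt; rewrite divr_gt0//.
have pos0 : \forall eps \near (0 : R)^'+, 0 < eps := nbhs_right_gt 0.
apply: filterS2 (filterI pos0 slab) (filterI edge small) => eps [e0 he] [edge_eps e1].
clear edge small slab pos0.
move=> phi psi r z Cphi Cpsi Kz nE mn.
have F1 : oper P (hess phi z) (grad phi z) r (xpart z) (ypart z) < 0.
  by rewrite ltNge; apply/negP => h; apply: nE; exact: Or41.
have FT : top_bdry (omega P) (gtop P) eps z ->
    dot (pt (vtop P (xpart z) (ypart z)) 1) (grad phi z) < btop P (xpart z) (ypart z).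
  by move=> tz; rewrite ltNge; apply/negP => h; apply: nE; exact: Or43.
have FB : bottom_bdry (omega P) (gbot P) eps z ->
    dot (pt (vbot P (xpart z) (ypart z)) (- 1)) (grad phi z) < bbot P (xpart z) (ypart z).
  by move=> tz; rewrite ltNge; apply/negP => h; apply: nE; exact: Or44.
have FL : lateral_bdry (omega P) (gtop P) (gbot P) eps z ->
    ~ lateral_super (lat P) (blat P) (grad phi z) r (xpart z) (ypart z).
  by move=> tz h; apply: nE; exact: Or42.
have [cx yb] := thin_closureP hP Kz; have [yb1 yb2] := andP yb.
have [gtG gbG dtG dbG] := hG' _ cx.
have yI : -1 <= ypart z <= 1 by have [_] := he; exact.
have yG := thin_y_bound hP hG (ltW e0) Kz.
have [vtM vbM] := hM1 _ _ cx yI.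
have inw := inward_direction hP e0 Kz.
have lt_edge : eps * gbot P (xpart z) < eps * gtop P (xpart z).
  by rewrite ltr_pM2l// (gbot_lt_gtop hP).
have [Oz|nOz] := pselect (omega P (xpart z)); last first.
  have bz : bdry (omega P) (xpart z).
    by have [_ Oo _ _] := omega_domain hP; rewrite bdryE.
  have Lz : lateral_bdry (omega P) (gtop P) (gbot P) eps z by [].
  move: (FL Lz) => {}FL; case latE: (lat P) FL => [g1 g2|] /= FL; last first.
    by apply: Or42; split=> //; rewrite latE /= leNgt; apply/negP => h; apply: FL; exact: ltW.
  have {}FL : dot (pt (g1 (xpart z) (ypart z)) (g2 (xpart z) (ypart z))) (grad phi z)
      < blat P (xpart z) (ypart z) by rewrite ltNge; apply/negP.
  set x := xpart z in bz FL cx *; set y := ypart z in FL yI yG *.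
  set q1 := pt (g1 x y) (g2 x y) in FL.
  have [pos _ _] := edge_eps g1 g2 latE x y bz yG yI (vtop P x y) vtM.
  suff [h|[[tz h]|[tz h]]] : dot q1 (grad psi z) <= blat P x y \/
      (top_bdry (omega P) (gtop P) eps z /\
        dot (pt (vtop P x y) 1) (grad psi z) <= dot (pt (vtop P x y) 1) (grad phi z) \/
       bottom_bdry (omega P) (gbot P) eps z /\
        dot (pt (vbot P x y) (- 1)) (grad psi z) <= dot (pt (vbot P x y) (- 1)) (grad phi z)).
  - by apply: Or42; split=> //; rewrite latE.
  - by apply: Or43; split=> //; apply: le_trans h (ltW (FT tz)).
  - by apply: Or44; split=> //; apply: le_trans h (ltW (FB tz)).
  have comb (v : 'rV[R]_N) (a : R) :
      (\forall s \near 0^'+, closure (thin P eps)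
        (z + s *: pt (- (g1 x y + mu *: v)) (- (g2 x y + mu * a)))) ->
      dot q1 (grad psi z) <= blat P x y \/
      dot (pt v a) (grad psi z) <= dot (pt v a) (grad phi z).
    rewrite -ptN -ptD -ptZ -/q1.
    move=> /(touch_direction Cphi Cpsi mn); rewrite !dotNl !dotDl !dotZl => h.
    have [h1|h1] := leP (dot q1 (grad psi z)) (blat P x y); [by left|right].
    rewrite -(ler_pM2l mu0); move: h h1 FL; clear; lra.
  have nrm (v : 'rV[R]_N) : 0 < dot (normal P x) v -> dot (normal P x) (- v) < 0.
    by rewrite dotNr oppr_lt0.
  have g2le : - `|g2 x y| <= g2 x y <= `|g2 x y| by rewrite -ler_norml.
  have absle (a : R) : - `|a| <= a <= `|a| by rewrite -ler_norml.
  have epsabs (a c : R) : eps * `|a| < c -> - c < eps * - a /\ eps * - a < c.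
    have := ler_wpM2l (ltW e0) (ler_norm a).
    have := ler_wpM2l (ltW e0) (ler_norm (- a)); rewrite normrN.
    rewrite !mulrN; clear; split; lra.
  have [yt|yt] := eqVneq y (eps * gtop P x).
    have [_ p2 p3] := edge_eps g1 g2 latE x y bz yG yI (vtop P x y) vtM.
    have [|h|h] := comb (vtop P x y) 1; [|by left|by right; left].
    apply: inw; rewrite ?xpart_pt ?ypart_pt.
    + by right; split=> //; exact: nrm.
    + right; rewrite dotNl; have [h1 h2] := epsabs _ _ (p3 _ dtG).
      by move: h1 g2le => h1 /andP[h3 h4]; move: h1 h3 h4; clear; lra.
    + by left; rewrite /edge_neg subr_gt0 -/y -/x yt.
  have [yB|yB] := eqVneq y (eps * gbot P x).
    have [_ p2 p3] := edge_eps g1 g2 latE x y bz yG yI (vbot P x y) vbM.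
    have [|h|h] := comb (vbot P x y) (- 1); [|by left|by right; right].
    apply: inw; rewrite ?xpart_pt ?ypart_pt.
    + by right; split=> //; exact: nrm.
    + by left; rewrite /edge_pos subr_gt0 -/y -/x yB.
    + right; rewrite dotNl; have [h1 h2] := epsabs _ _ (p3 _ dbG).
      by move: h2 g2le => h1' /andP[h3 h4]; move: h1' h3 h4; clear; lra.
  left; apply: le_trans (ltW FL).
  suff : dot (- q1) (grad phi z) <= dot (- q1) (grad psi z) by rewrite !dotNl lerN2.
  apply: (touch_direction Cphi Cpsi mn); apply: inw; rewrite /q1 ptN ?xpart_pt ?ypart_pt.
  + by right; split=> //; rewrite dotNr oppr_lt0 dotC.
  + by left; rewrite /edge_pos subr_gt0 -/y -/x lt_neqAle yt.
  + by left; rewrite /edge_neg subr_gt0 -/y -/x lt_neqAle eq_sym yB.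
have epsabs (a c : R) : eps * `|a| < c -> - c < eps * - a /\ eps * - a < c.
  have := ler_wpM2l (ltW e0) (ler_norm a).
  have := ler_wpM2l (ltW e0) (ler_norm (- a)); rewrite normrN.
  rewrite !mulrN; clear; split; lra.
have [yt|yt] := eqVneq (ypart z) (eps * gtop P (xpart z)).
  apply: Or43; split=> //; apply: le_trans (ltW (FT (conj cx yt))).
  rewrite -lerN2 -!dotNl; apply: (touch_direction Cphi Cpsi mn).
  apply: inw; rewrite ptN ?xpart_pt ?ypart_pt; first by left.
    by right; rewrite dotNl; have [h1 _] := epsabs _ _ (e1 _ _ vtM dtG).
  by left; rewrite /edge_neg subr_gt0 yt.
have [yB|yB] := eqVneq (ypart z) (eps * gbot P (xpart z)).
  apply: Or44; split=> //; apply: le_trans (ltW (FB (conj cx yB))).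
  rewrite -lerN2 -!dotNl; apply: (touch_direction Cphi Cpsi mn).
  apply: inw; rewrite ptN ?xpart_pt ?ypart_pt ?opprK; first by left.
    by left; rewrite /edge_pos subr_gt0 yB.
  by right; rewrite dotNl; have [_ h1] := epsabs _ _ (e1 _ _ vbM dbG).
apply: Or41; apply: le_trans (ltW F1); apply: (touch_interior hP he _ Cphi Cpsi mn).
by split=> //; rewrite !lt_neqAle yb1 yb2 yt eq_sym yB.
Unshelve. all: by end_near. Qed.

End Touching.

(** * Minima of paraboloids *)

Lemma min_family (R : realType) (U V : topologicalType) (I : set U) (w : U -> V -> R) :
  compact I -> I !=set0 -> continuous (fun p : U * V => w p.1 p.2) ->
  exists f : V -> R, continuous f /\
    forall z, (exists2 i, I i & w i z = f z) /\ forall i, I i -> f z <= w i z.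
Proof.
move=> cI I0 cw.
have wi i : continuous (w i).
  move=> z; have h : continuous (fun z : V => (i, z)).
    by move=> z'; apply: cvg_pair; [exact: cvg_cst|exact: cvg_id].
  exact: (cont_comp h cw).
have wz z : continuous (w^~ z).
  move=> i; have h : continuous (fun i : U => (i, z)).
    by move=> i'; apply: cvg_pair; [exact: cvg_id|exact: cvg_cst].
  exact: (cont_comp h cw).
have /choice[sel hsel] : forall z, exists i, I i /\ forall j, I j -> w i z <= w j z.
  move=> z; have [i Ii mx] : exists2 i, I i & forall j, I j -> - w j z <= - w i z.
    apply: usc_max => // i e Ii e0.
    have /cvgrPdist_lt/(_ e e0) := wz z i; apply: filterS => j.
    by rewrite ltr_norml => /andP[? ?] _; lra.
  by exists i; split=> // j Ij; rewrite -lerN2 mx.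
exists (fun z => w (sel z) z); split; last first.
  by move=> z; have [h1 h2] := hsel z; split=> //; exists (sel z).
move=> z; apply/cvgrPdist_le => e e0.
have e20 : 0 < e / 2 by rewrite divr_gt0.
have /compact_near_coveringP cov := cI.
have : \forall z' \near z, I `<=` (fun i => `|w i z' - w i z| < e).
  apply: (cov _ (nbhs z) (fun z' i => `|w i z' - w i z| < e)) => i Ii.
  have h1 : \forall i' \near i, `|w i z - w i' z| < e / 2.
    by have /cvgrPdist_lt/(_ _ e20) := wz z i.
  have h2 : \forall p \near (i, z), `|w i z - w p.1 p.2| < e / 2.
    by have /cvgrPdist_lt/(_ _ e20) := cw (i, z).
  have h1' : \forall p \near (i, z), `|w i z - w p.1 z| < e / 2.
    by exists ([set i' | `|w i z - w i' z| < e / 2], setT) => [|[a b] []//]; split=> //; exact: filterT.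
  apply: filterS2 h1' h2 => -[i' z'] /= k1 k2.
  have -> : w i' z' - w i' z = (w i z - w i' z) - (w i z - w i' z') by ring.
  by rewrite (le_lt_trans (ler_normB _ _))// [e]splitr ltrD.
apply: filterS => z' h; have [I1 m1] := hsel z; have [I2 m2] := hsel z'.
have := h _ I1; have := h _ I2; have := m1 _ I2; have := m2 _ I1.
rewrite !ltr_norml => ? ? /andP[? ?] /andP[? ?].
by rewrite ler_norml; apply/andP; split; lra.
Qed.

Section Taylor.
Context {R : realType} {N : nat}.
Implicit Types (f : 'rV[R]_N -> R) (a x : 'rV[R]_N) (lam om : R).

Definition paraboloid (c : R) (v : 'rV[R]_N) lam a x : R :=
  c + dot v (x - a) + lam * dot (x - a) (x - a).

Lemma paraboloidE c v lam a :
  paraboloid c v lam a = quad (c - dot v a + lam * dot a a) (v - (2 * lam) *: a) lam.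
Proof.
rewrite funeqE => x; rewrite /paraboloid /quad !dotE (dotC x a); ring.
Qed.

Lemma paraboloid_Ck k c v lam a : Ck k (paraboloid c v lam a).
Proof. by rewrite paraboloidE; exact: quad_Ck. Qed.

Lemma grad_paraboloid c v lam a x : grad (paraboloid c v lam a) x = v + (2 * lam) *: (x - a).
Proof. by rewrite paraboloidE grad_quad scalerBr -addrA [- _ + _]addrC. Qed.

Lemma hess_paraboloid c v lam a x : hess (paraboloid c v lam a) x = (2 * lam)%:M.
Proof. by rewrite paraboloidE hess_quad. Qed.

Definition taylor f lam a : 'rV[R]_N -> R := paraboloid (f a) (grad f a) lam a.

Lemma taylor_at f lam a : taylor f lam a a = f a.
Proof. by rewrite /taylor /paraboloid subrr !dot0r mulr0 !addr0. Qed.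

Lemma taylor_continuous f lam : Ck 1 f ->
  continuous (fun p : 'rV[R]_N * 'rV[R]_N => taylor f lam p.1 p.2).
Proof.
move=> Cf; have c0 : continuous (fun p : 'rV[R]_N * 'rV[R]_N => p) by move=> p; exact: cvg_id.
have c1 := cont_fst c0; have c2 := cont_snd c0.
have cf := cont_comp c1 (Ck_continuous Cf).
have cg := cont_comp c1 (grad_continuous Cf).
move=> p; have cd : p'.2 - p'.1 @[p' --> p] --> p.2 - p.1.
  by apply: cvgB; [exact: c2|exact: c1].
pose proof (cvg_dot (cg p) cd) as h1.
pose proof (cvg_dot cd cd) as h2.
apply: cvgD; first by apply: cvgD; [exact: cf|exact: h1].
by apply: cvgM; [exact: cvg_cst|exact: h2].
Qed.

(** The minimum over [a] of the paraboloids, with [lam] large, replaces a mollification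
    of [f], which is only C1.  The paraboloid centred at [x] has the value [f x] there,
    so the one which realizes the minimum at [x] lies below [f]; then its centre is near
    [x], since its quadratic term cannot exceed the first order Taylor remainder, and it
    agrees with [f] at [x] to first order. *)
Lemma taylor_contact f lam om a x : Ck 1 f -> 0 < lam -> 0 <= om ->
  (forall x', `|x' - a| <= `|x - a| -> `|grad f x' - grad f a| <= om) ->
  taylor f lam a x <= f x ->
  [/\ `|x - a| <= N%:R * om / lam,
      `|taylor f lam a x - f x| <= (N%:R * om) ^+ 2 / lam &
      `|grad (taylor f lam a) x - grad f x| <= (2 * N%:R + 1) * om].
Proof.
move=> Cf l0 om0 hom; have [df _] := Cf => tle.
have tle' := tle; rewrite /taylor /paraboloid in tle.
have [t [/andP[t0 t1] mv]] := mean_value a (x - a) df.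
rewrite subrKC derive_grad// in mv.
have ta : `|a + t *: (x - a) - a| <= `|x - a|.
  by rewrite addrC addKr normrZ gtr0_norm// ler_piMl// ltW.
have := norm_dot (x - a) (grad f (a + t *: (x - a)) - grad f a).
rewrite dotBr -mv (dotC (x - a) (grad f a)) => h1.
have {}h1 := le_trans h1 (ler_wpM2l (mulr_ge0 (ler0n _ _) (normr_ge0 (x - a))) (hom _ ta)).
have D0 : 0 <= `|x - a| := normr_ge0 _.
set D := `|x - a| in h1 hom ta D0 *.
have n0 : 0 <= N%:R :> R by [].
have sq : D ^+ 2 <= dot (x - a) (x - a) := sqr_norm_le _.
have lsq := ler_wpM2l (ltW l0) sq.
move: h1; rewrite ler_norml => /andP[h1 h2].
have key : lam * D ^+ 2 <= N%:R * D * om by move: h2 lsq tle; lra.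
have Dle : D <= N%:R * om / lam.
  rewrite ler_pdivlMr//; have [->|D1] := eqVneq D 0; first by rewrite mul0r mulr_ge0.
  have Dp : 0 < D by rewrite lt_neqAle eq_sym D1.
  rewrite -(ler_pM2l Dp); move: key; rewrite expr2; lra.
have ND : N%:R * D * om <= (N%:R * om) ^+ 2 / lam.
  have -> : (N%:R * om) ^+ 2 / lam = (N%:R * om) * (N%:R * om / lam) by ring.
  by rewrite mulrAC ler_wpM2l// mulr_ge0.
split=> //.
  rewrite ler_norml; apply/andP; split; last first.
    apply: le_trans (_ : 0 <= _); first by rewrite subr_le0.
    by rewrite divr_ge0 ?sqr_ge0// ltW.
  have l1 : 0 <= lam * dot (x - a) (x - a) by rewrite mulr_ge0 ?dotvv_ge0// ltW.
  by move: h2 ND l1; rewrite /taylor /paraboloid; lra.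
rewrite grad_paraboloid.
have -> : grad f a + (2 * lam) *: (x - a) - grad f x =
    (2 * lam) *: (x - a) - (grad f x - grad f a) by rewrite opprB [RHS]addrCA addrA.
apply: le_trans (ler_normB _ _) _.
have h3 := hom _ (lexx D) : `|grad f x - grad f a| <= om.
have h4 : `|(2 * lam) *: (x - a)| <= 2 * N%:R * om.
  rewrite normrZ gtr0_norm ?mulr_gt0// -/D -!mulrA ler_pM2l// mulrC -ler_pdivlMr//.
by move: h3 h4; lra.
Qed.

End Taylor.

(** * Profiles *)

Section Profile.
Context {R : realType} {N : nat} (P : problem R N) (hP : admissible P).
Implicit Types (psi t : 'rV[R]_N -> R) (x a : 'rV[R]_N) (y eps s m kap e : R)
  (z : 'rV[R]_(N + 1)).

Lemma normB_le (V : normedModType R) (u v : V) (a b : R) : `|u| <= a -> `|v| <= b ->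
  `|u - v| <= a + b.
Proof. by move=> ua vb; apply: le_trans (ler_normB _ _) _; exact: lerD. Qed.

Lemma normD_le (V : normedModType R) (u v : V) (a b : R) : `|u| <= a -> `|v| <= b ->
  `|u + v| <= a + b.
Proof. by move=> ua vb; apply: le_trans (ler_normD _ _) _; exact: lerD. Qed.

Lemma ball_compact n (r : R) : compact [set x : 'rV[R]_n | `|x| <= r].
Proof.
apply: bounded_closed_compact.
  by exists r; split; [exact: num_real|move=> M rM x /= xr; exact: le_trans xr (ltW rM)].
have h := @closed_comp _ _ (fun x : 'rV[R]_n => `|x|) _ _ (@closed_le R r); apply: h => x _.
exact: norm_continuous.
Qed.

Lemma small_mul (A B : R) : 0 < B -> \forall eps \near 0^'+, eps * A <= B.
Proof.
move=> B0; have A0 : 0 < `|A| + 1 by rewrite ltr_wpDl.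
near=> eps; have e0 : 0 < eps by [].
have : eps * A <= eps * (`|A| + 1).
  by rewrite ler_pM2l// (le_trans (ler_norm A))// lerDl.
move=> h; apply: le_trans h _; rewrite -ler_pdivlMr//.
by near: eps; apply: nbhs_right_le; rewrite divr_gt0.
Unshelve. all: by end_near. Qed.

(** The vertical derivative forced, to leading order, by the conditions on the top and
    on the bottom. *)
Definition slope psi x : R := beta0 P x - dot (gamma0 P x) (grad psi x).

Lemma slope_C1 psi : Ck 2 psi -> Ck 1 (slope psi).
Proof.
move=> [_ Dpsi]; apply: (CkD (beta0_C1 hP)).
apply: CkN; rewrite /dot; apply: Ck_sum => i; apply: CkM.
  exact: (Ck_linear_comp (coord_linear 0 i) (gamma0_C1 hP)).
by under eq_fun do rewrite mxE; exact: Dpsi.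
Qed.

(** What touching from above needs of a minimum [f] of smooth functions [w], when the
    formal expansion [psi + y * (slope psi + eps * t) + s / 2 * y ^ 2] is not smooth:
    at each point some [w] realizing the minimum has the derivatives of the expansion,
    with an error [e * eps] in the vertical one, [kap] and [e] in the others. *)
Definition profile psi t s m kap e eps (f : 'rV[R]_(N + 1) -> R) : Prop :=
  continuous f /\ forall z, closure (thin P eps) z ->
  `|f z - psi (xpart z)| <= e /\
  exists w Q dQ mu, [/\ Ck 2 w, forall z', f z' <= w z', w z = f z,
    grad w z = pt (grad psi (xpart z) + (ypart z - eps * m) *: dQ) (Q + s * ypart z) &
    hess w z = block_mx (hess psi (xpart z) + mu%:M) dQ^T dQ s%:M] /\
    [/\ `|mu| <= kap, `|Q - (slope psi (xpart z) + eps * t (xpart z))| <= e * eps &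
      `|dQ - grad (slope psi) (xpart z)| <= e].

(** The coefficient of [y] is taken from the paraboloids of [slope psi + eps * t] with
    opening of order [kap / eps]: on the thin domain they are multiplied by
    [y - eps * m], which is positive and of order [eps], so that the minimum over the
    centres does select the best paraboloid, and the opening contributes only [kap] to
    the Hessian. *)
Lemma profileP psi t s m kap e : Ck 2 psi -> Ck 1 t ->
  (forall x, closure (omega P) x -> m < gbot P x) -> 0 < kap -> 0 < e ->
  \forall eps \near 0^'+, exists f, profile psi t s m kap e eps f.
Proof.
move=> Cpsi Ct hm kap0 e0.
have Cq := slope_C1 Cpsi; have [dq _] := Cq; have [dt _] := Ct.
have cO := omega_compact hP.
have [G hG] := height_boundP hP; have [G0 _] := hG.
have Gm : 0 < G + `|m| by rewrite ltr_pwDl.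
have [kap1 [k10 k1E]] : exists k1 : R, 0 < k1 /\ 2 * k1 * (G + `|m|) = kap.
  exists (kap / (2 * (G + `|m|))); split; first by rewrite divr_gt0// mulr_gt0.
  by field; rewrite gt_eqF.
have n0 : 0 <= N%:R :> R by [].
(* the modulus of continuity of the gradients which makes both errors at most [e] *)
have [om [om0 om1 om2]] : exists om : R, [/\ 0 < om, (N%:R * om) ^+ 2 / kap1 <= e &
    (2 * N%:R + 1) * om <= e / 2].
  have N1 : 0 < 2 * N%:R + 1 :> R by rewrite ltr_wpDl// mulr_ge0.
  have N2 : 0 < N%:R ^+ 2 + 1 :> R by rewrite ltr_wpDl// sqr_ge0.
  have e20 : 0 < e / 2 by rewrite divr_gt0.
  have ke : 0 < e * kap1 by rewrite mulr_gt0.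
  have k1 := small_mul (2 * N%:R + 1) e20.
  have k2 := small_mul (N%:R ^+ 2) ke.
  near (0 : R)^'+ => om; exists om; have o0 : 0 < om by [].
  have o1 : om <= 1 by near: om; exact: nbhs_right_le.
  split=> //; last by rewrite mulrC; near: om.
  rewrite ler_pdivrMr//; apply: le_trans (_ : om * N%:R ^+ 2 <= _); last by near: om.
  by rewrite exprMn mulrC ler_wpM2r ?sqr_ge0// expr2 ler_piMl// ltW.
have cid : continuous (fun x : 'rV[R]_N => x) by move=> x; exact: cvg_id.
have [rho rho0 hrho] := compact_norm_bound cO (continuous_subspaceT cid).
have [L1 L10 hL1] := compact_norm_bound (@ball_compact N (3 * rho))
   (continuous_subspaceT (grad_continuous Cq)).
have [L2 L20 hL2] := compact_norm_bound (@ball_compact N (3 * rho))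
   (continuous_subspaceT (grad_continuous Ct)).
have [M1 M10 hM1] := compact_norm_bound cO (continuous_subspaceT (Ck_continuous Cq)).
have [M2 M20 hM2] := compact_norm_bound cO (continuous_subspaceT (Ck_continuous Ct)).
have unif f : Ck 1 f -> \forall d \near 0^'+, forall a x, closure (omega P) a ->
    `|x - a| < d -> `|grad f x - grad f a| <= om / 2.
  move=> Cf; apply: compact_uniform => // a ca.
  have o40 : 0 < om / 4 by rewrite divr_gt0.
  have /cvgrPdist_le/(_ _ o40) h := @grad_continuous _ _ _ Cf a.
  have h1 : \forall p \near (a, a), `|grad f a - grad f p.1| <= om / 4.
    by exists ([set x | `|grad f a - grad f x| <= om / 4], setT) => [|[? ?] []//]; split=> //; exact: filterT.
  have h2 : \forall p \near (a, a), `|grad f a - grad f p.2| <= om / 4.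
    by exists (setT, [set x | `|grad f a - grad f x| <= om / 4]) => [|[? ?] []//]; split=> //; exact: filterT.
  apply: filterS2 h1 h2 => -[b x] /= k1 k2 _.
  have := dist_via k2 k1; have -> : om / 4 + om / 4 = om / 2 by lra.
  by [].
have [d1 d10 hd1] := near0_right (unif _ Cq).
have [d2 d20 hd2] := near0_right (unif _ Ct).
have e20 : 0 < e / 2 by rewrite divr_gt0.
have [d [d0 dd1 dd2]] : exists d, [/\ 0 < d, d < d1 & d < d2].
  near (0 : R)^'+ => d; exists d; split=> //; near: d; exact: nbhs_right_lt.
have dd0 : 0 < d / 2 by rewrite divr_gt0.
pose Mf := (G + `|m|) * (M1 + M2 + e) + `|s| / 2 * G ^+ 2.
have k1 := small_mul (N%:R * (2 * (L1 + L2)) / kap1) dd0.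
have k2 := small_mul L2 e20.
have k3 := small_mul Mf e0.
near=> eps.
have eps0 : 0 < eps by [].
have eps1 : eps <= 1 by near: eps; exact: nbhs_right_le.
pose lam := kap1 / eps; have lam0 : 0 < lam by rewrite divr_gt0.
have [f fE] : exists f : 'rV[R]_N -> R, f = fun x => slope psi x + eps * t x by eexists.
have Cf : Ck 1 f by rewrite fE; exact: (CkD Cq (CkZ eps Ct)).
have gradfE x : grad f x = grad (slope psi) x + eps *: grad t x.
  rewrite fE; apply: grad_unique => v.
  have H := is_deriveD (DeriveDef (diff_derivable (v:=v) (dq x)) erefl)
     (is_deriveZ eps (DeriveDef (diff_derivable (v:=v) (dt x)) erefl)).
  rewrite (@derive_val _ _ _ _ _ _ _ H) !derive_grad//.
  by rewrite dotDr dotZr.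
pose w a z := lift_fun psi (taylor f lam a) (eps * m) s z.
have cw : continuous (fun p : 'rV[R]_N * 'rV[R]_(N + 1) => w p.1 p.2).
  have c0 : continuous (fun p : 'rV[R]_N * 'rV[R]_(N + 1) => p) by move=> p; exact: cvg_id.
  have c1 := cont_fst c0; have c2 := cont_snd c0.
  have cx : continuous (fun p : 'rV[R]_N * 'rV[R]_(N + 1) => xpart p.2).
    by apply: (cont_comp c2) => z; exact: cvg_xpart.
  have cy : continuous (fun p : 'rV[R]_N * 'rV[R]_(N + 1) => ypart p.2).
    by apply: (cont_comp c2) => z; exact: cvg_ypart.
  have cpsi := cont_comp cx (Ck_continuous Cpsi).
  have ct := cont_comp (cont_pair c1 cx) (@taylor_continuous R N f lam Cf).
  move=> p; apply: cvgD; last first.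
    by apply: cvgM; [exact: cvg_cst|exact: cvgM (cy p) (cy p)].
  apply: cvgD; first exact: cpsi.
  by apply: cvgM; [apply: cvgB; [exact: cy|exact: cvg_cst]|exact: ct].
have [x0 Ox0] : closure (omega P) !=set0.
  by have [[x0 ?] _ _ _] := omega_domain hP; exists x0; exact: subset_closure.
have [F [cF hF]] := min_family cO (ex_intro _ x0 Ox0) cw.
exists F; split=> // z Kz.
have [[a Oa waF] mn] := hF z.
have [cx /andP[yb yt]] := thin_closureP hP Kz.
set x := xpart z in cx yb yt *; set y := ypart z in yb yt *.
have ylt : 0 < y - eps * m.
  by rewrite subr_gt0 (lt_le_trans _ yb)// ltr_pM2l// hm.
have yG := thin_y_bound hP hG (ltW eps0) Kz; rewrite -/y in yG.
have yub : y - eps * m <= eps * (G + `|m|).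
  have := ler_norm y; have : eps * - m <= eps * `|m| by rewrite ler_pM2l// -normrN ler_norm.
  by move: yG; rewrite mulrDr mulrN; lra.
have tle : taylor f lam a x <= f x.
  have := mn x cx; rewrite -waF /w /lift_fun -/x -/y lerD2r lerD2l ler_pM2l//.
  by rewrite taylor_at.
have hgrad c d' x' : 0 <= c -> 0 <= d' -> `|grad (slope psi) x' - grad (slope psi) a| <= c ->
    `|grad t x' - grad t a| <= d' -> `|grad f x' - grad f a| <= c + d'.
  move=> c0 d'0 h1 h2; rewrite !gradfE opprD addrACA -scalerBr.
  apply: le_trans (ler_normD _ _) _; rewrite lerD// normrZ gtr0_norm//.
  by rewrite (le_trans _ h2)// ler_piMl.
have ar : `|a| <= 3 * rho by have := hrho a Oa; move: rho0; lra.
(* a crude bound on the distance of the centre, improved below by uniform continuity *)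
have L0 : 0 <= 2 * (L1 + L2) by rewrite mulr_ge0// addr_ge0// ltW.
have [|xa _ _] := taylor_contact Cf lam0 L0 _ tle.
  move=> x' x'a.
  have x'r : `|x'| <= 3 * rho.
    have h1 := ler_normB x a; have h2 := ler_normD (x' - a) a; rewrite subrK in h2.
    have := hrho a Oa; have := hrho x cx; move: h1 h2 x'a; clear; lra.
  have -> : 2 * (L1 + L2) = (L1 + L1) + (L2 + L2) by ring.
  have b1 := hL1 _ x'r; have b2 := hL1 _ ar; have b3 := hL2 _ x'r; have b4 := hL2 _ ar.
  apply: hgrad; [by rewrite addr_ge0// ltW|by rewrite addr_ge0// ltW|..].
    exact: normB_le b1 b2.
  exact: normB_le b3 b4.
have xad : `|x - a| < d.
  have : N%:R * (2 * (L1 + L2)) / lam <= d / 2.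
    have -> : N%:R * (2 * (L1 + L2)) / lam = eps * (N%:R * (2 * (L1 + L2)) / kap1).
      by rewrite /lam; field; rewrite !gt_eqF.
    by near: eps.
  by move: xa d0; lra.
have [|_ t2 t3] := taylor_contact Cf lam0 (ltW om0) _ tle.
  move=> x' x'a; have x'd := le_lt_trans x'a xad.
  have o20 : 0 <= om / 2 by rewrite divr_ge0// ltW.
  have -> : om = om / 2 + om / 2 by lra.
  by apply: hgrad => //; [exact: (hd1 d)|exact: (hd2 d)].
have Qe : `|taylor f lam a x - f x| <= e * eps.
  apply: le_trans t2 _; have -> : (N%:R * om) ^+ 2 / lam = (N%:R * om) ^+ 2 / kap1 * eps.
    by rewrite /lam; field; rewrite !gt_eqF.
  by rewrite ler_pM2r.
have CT : Ck 2 (taylor f lam a) := paraboloid_Ck 2 _ _ _ _.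
split.
  rewrite -waF /w /lift_fun -/x -/y.
  have -> : forall A B D : R, A + B + D - A = B + D by move=> *; ring.
  have fM : `|taylor f lam a x| <= M1 + M2 + e.
    have : `|f x| <= M1 + M2.
      rewrite fE; apply: normD_le; first exact: hM1.
      by rewrite normrM gtr0_norm// (le_trans _ (hM2 _ cx))// ler_piMl.
    have := ler_normD (taylor f lam a x - f x) (f x); rewrite subrK.
    have : e * eps <= e by rewrite ler_piMr// ltW.
    by move: Qe; lra.
  apply: (@le_trans _ _ (eps * Mf)); last by near: eps.
  have -> : eps * Mf = eps * (G + `|m|) * (M1 + M2 + e) + eps * (`|s| / 2 * G ^+ 2).
    by rewrite /Mf; ring.
  apply: normD_le.
    by rewrite normrM (gtr0_norm ylt); apply: ler_pM => //; exact: ltW.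
  have -> : `|s / 2 * y ^+ 2| = `|s| / 2 * `|y| ^+ 2.
    by rewrite normrM normrX normrM normfV (@ger0_norm _ 2).
  rewrite [leRHS]mulrCA.
  apply: ler_wpM2l; first by rewrite divr_ge0.
  apply: (@le_trans _ _ ((eps * G) ^+ 2)); first by rewrite lerXn2r// nnegrE// mulr_ge0// ltW.
  by rewrite exprMn ler_wpM2r ?sqr_ge0// expr2 ler_piMl// ltW.
exists (w a), (taylor f lam a x), (grad (taylor f lam a) x), ((y - eps * m) * (2 * lam)).
split.
  split=> //.
  - exact: lift_fun_Ck.
  - by move=> z'; have [_] := hF z'; exact.
  - by rewrite /w grad_lift.
  - by rewrite /w hess_lift// hess_paraboloid scale_scalar_mx.
split.
- have l2 : 0 < 2 * lam by rewrite mulr_gt0.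
  rewrite normrM (gtr0_norm ylt) (gtr0_norm l2).
  have -> : kap = (eps * (G + `|m|)) * (2 * lam).
    by rewrite -k1E /lam; field; rewrite gt_eqF.
  by apply: ler_wpM2r yub; exact: ltW.
- by have <- : f x = slope psi x + eps * t x by rewrite fE.
- have := dist_via (c := grad f x) (a := grad (taylor f lam a) x) (b := grad (slope psi) x)
    (d := e / 2) (e := e / 2).
  rewrite -splitr; apply; first by rewrite distrC (le_trans t3).
  rewrite gradfE addrAC subrr add0r normrZ gtr0_norm//.
  have xr : `|x| <= 3 * rho by have := hrho x cx; move: rho0; lra.
  apply: (@le_trans _ _ (eps * L2)); last by near: eps.
  by rewrite ler_pM2l// hL2.
Unshelve. all: by end_near. Qed.

End Profile.

(** * The residuals on the top and bottom *)

Section Conormal.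
Context {R : realType} {N : nat}.

Definition conormal_const (M : R) : R :=
  2 + N%:R * M + 2 * M * (N%:R * (M * M + M) * (2 * M)) + 2 * M * (N%:R * M).

Lemma conormal_const_gt0 (M : R) : 0 <= M -> 0 < conormal_const M.
Proof.
move=> M0; have n0 : 0 <= N%:R :> R by [].
have h1 : 0 <= N%:R * M by rewrite mulr_ge0.
have h2 : 0 <= 2 * M by rewrite mulr_ge0.
have h3 : 0 <= N%:R * (M * M + M) by rewrite mulr_ge0// addr_ge0// mulr_ge0.
have := mulr_ge0 h2 (mulr_ge0 h3 h2); have := mulr_ge0 h2 h1.
by rewrite /conormal_const; move: h1; lra.
Qed.

(** The terms of order one cancel by the choice of the slope; those of order [eps] are
    the residual; what is left involves an error [e] or a second factor [eps]. *)
Lemma conormal_expansion (v g0 k p dq dQ : 'rV[R]_N) (b b0 l Q q t s m g eps e M : R) :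
  0 < eps <= 1 -> 0 <= e <= 1 -> 1 <= M ->
  `|g0| <= M -> `|k| <= M -> `|p| <= M -> `|dq| <= M -> `|g| <= M -> `|m| <= M ->
  `|v - (g0 + (eps * g) *: k)| <= e * eps -> `|b - (b0 + l * (eps * g))| <= e * eps ->
  `|Q - (q + eps * t)| <= e * eps -> `|dQ - dq| <= e -> q = b0 - dot g0 p ->
  `|dot (pt v 1) (pt (p + (eps * g - eps * m) *: dQ) (Q + s * (eps * g))) - b -
    eps * (g * (dot k p - l + dot g0 dq + s) - m * dot g0 dq + t)| <=
  eps * (e + eps) * conormal_const M.
Proof.
move=> /andP[eps0 eps1] /andP[e0 e1] M1 hg0 hk hp hdq hg hm hv hb hQ hdQ qE.
have M0 : 0 <= M by lra.
have n0 : 0 <= N%:R :> R by [].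
have -> : dot (pt v 1) (pt (p + (eps * g - eps * m) *: dQ) (Q + s * (eps * g))) - b -
    eps * (g * (dot k p - l + dot g0 dq + s) - m * dot g0 dq + t) =
    dot (v - (g0 + (eps * g) *: k)) p + (Q - (q + eps * t)) - (b - (b0 + l * (eps * g))) +
    eps * ((g - m) * (dot (v - g0) dQ + dot g0 (dQ - dq))).
  by rewrite dot_pt qE !dotE; ring.
have hv0 : `|v - g0| <= eps * (M * M + M).
  have -> : v - g0 = (v - (g0 + (eps * g) *: k)) + (eps * g) *: k.
    by rewrite opprD addrA subrK.
  apply: (@le_trans _ _ (e * eps + eps * (M * M))).
    apply: normD_le hv _; rewrite normrZ normrM (gtr0_norm eps0) -mulrA ler_pM2l//.
    by apply: ler_pM.
  have : e * eps <= eps * M by rewrite mulrC ler_pM2l//; lra.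
  by rewrite mulrDr; lra.
have hdQ0 : `|dQ| <= 2 * M.
  have := ler_normD (dQ - dq) dq; rewrite subrK; move: hdQ hdq e1 M1; clear; lra.
have b1 := norm_dot_le hv hp.
have b2 := norm_dot_le hv0 hdQ0.
have b3 := norm_dot_le hg0 hdQ.
have b4 : `|g - m| <= M + M by exact: normB_le.
have b5 := normD_le b2 b3.
have b6 : `|(g - m) * (dot (v - g0) dQ + dot g0 (dQ - dq))| <=
    (M + M) * (N%:R * (eps * (M * M + M)) * (2 * M) + N%:R * M * e).
  by rewrite normrM; apply: ler_pM.
have b7 : `|eps * ((g - m) * (dot (v - g0) dQ + dot g0 (dQ - dq)))| <=
    eps * ((M + M) * (N%:R * (eps * (M * M + M)) * (2 * M) + N%:R * M * e)).
  by rewrite normrM (gtr0_norm eps0) ler_pM2l.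
apply: le_trans (normD_le (normB_le (normD_le b1 hQ) hb) b7) _.
rewrite /conormal_const.
pose A := N%:R * (M * M + M) * (2 * M).
have A0 : 0 <= A by rewrite !mulr_ge0// addr_ge0// mulr_ge0.
have NM : 0 <= N%:R * M by rewrite mulr_ge0.
have NMM : 0 <= 2 * M * (N%:R * M) by rewrite !mulr_ge0.
have MA : 0 <= 2 * M * A by rewrite mulr_ge0// mulr_ge0.
have -> : N%:R * (e * eps) * M + e * eps + e * eps +
    eps * ((M + M) * (N%:R * (eps * (M * M + M)) * (2 * M) + N%:R * M * e)) =
    eps * (e * (2 + N%:R * M + 2 * M * (N%:R * M)) + eps * (2 * M * A)).
  by rewrite /A; ring.
have -> : eps * (e + eps) * (2 + N%:R * M + 2 * M * (N%:R * (M * M + M) * (2 * M)) + 2 * M * (N%:R * M)) =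
    eps * ((e + eps) * (2 + N%:R * M + 2 * M * (N%:R * M) + 2 * M * A)) by rewrite /A; ring.
rewrite ler_pM2l//.
have B0 : 0 <= 2 + N%:R * M + 2 * M * (N%:R * M) by lra.
move: MA B0; set B := 2 + _ + _; set C := 2 * M * A => C0 B0.
have := mulr_ge0 e0 C0; have := mulr_ge0 (ltW eps0) B0.
by rewrite mulrDl !mulrDr; lra.
Qed.

Variables (P : problem R N) (hP : admissible P).
Implicit Types (psi t g l : 'rV[R]_N -> R) (k : 'rV[R]_N -> 'rV[R]_N).

(** The coefficient of [eps] in the defect of the boundary condition on the graph of
    [eps * g], for the test functions above.  The bottom condition, multiplied by
    [-1], has the form of the top one, so both are instances. *)
Definition residual psi t (s m : R) g k l x : R :=
  g x * (dot (k x) (grad psi x) - l x + dot (gamma0 P x) (grad (slope P psi) x) + s)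
  - m * dot (gamma0 P x) (grad (slope P psi) x) + t x.

Lemma expansion_small (V : normedModType R) (A : set 'rV[R]_N) (h : 'rV[R]_N -> R -> V) (G e : R) :
  0 < G -> 0 < e ->
  (forall e : R, 0 < e -> \forall y \near (0 : R), forall x, A x -> `|h x y| <= e * `|y|) ->
  \forall eps \near 0^'+, forall x y, A x -> `|y| <= eps * G -> `|h x y| <= e * eps.
Proof.
move=> G0 e0 hh; have eG : 0 < e / G by rewrite divr_gt0.
have [d d0 hd] := near_ball (hh _ eG).
near=> eps => x y Ax yG; have eps0 : 0 < eps by [].
have yd : `|y - 0| < d.
  rewrite subr0 (le_lt_trans yG)// -ltr_pdivlMr//; near: eps; apply: nbhs_right_lt.
  by rewrite divr_gt0.
apply: le_trans (hd y yd x Ax) _; rewrite -mulrA ler_pM2l// ler_pdivrMl//.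
by rewrite mulrC.
Unshelve. all: by end_near. Qed.

Definition conormal_close psi (m e K eps : R) : Prop :=
  forall (s : R) t z Q dQ, closure (thin P eps) z ->
  let x := xpart z in let y := ypart z in
  `|Q - (slope P psi x + eps * t x)| <= e * eps -> `|dQ - grad (slope P psi) x| <= e ->
  let p := pt (grad psi x + (y - eps * m) *: dQ) (Q + s * y) in
  (y = eps * gtop P x -> `|dot (pt (vtop P x y) 1) p - btop P x y -
     eps * residual psi t s m (gtop P) (ktop P) (ltop P) x| <= eps * e * K) /\
  (y = eps * gbot P x -> `|dot (pt (vbot P x y) (- 1)) p - bbot P x y +
     eps * residual psi t s m (gbot P) (fun x => - kbot P x) (fun x => - lbot P x) x|
     <= eps * e * K).

Lemma conormal_estimate psi (m : R) : Ck 2 psi -> exists2 K : R, 0 < K &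
  forall e : R, 0 < e -> e <= 1 -> \forall eps \near 0^'+, conormal_close psi m e K eps.
Proof.
move=> Cpsi; have cO := omega_compact hP.
have Cq := slope_C1 hP Cpsi.
have [G hG] := height_boundP hP; have [G0 hG'] := hG.
have [M1 M10 h1] := compact_norm_bound cO (continuous_subspaceT (Ck_continuous (gamma0_C1 hP))).
have [M2 M20 h2] := compact_norm_bound cO (ktop_cont hP).
have [M3 M30 h3] := compact_norm_bound cO (kbot_cont hP).
have [M4 M40 h4] := compact_norm_bound cO (continuous_subspaceT (grad_continuous (Ck_pred Cpsi))).
have [M5 M50 h5] := compact_norm_bound cO (continuous_subspaceT (grad_continuous Cq)).
have [M [[M_1 mM GM] [M1M M2M M3M] [M4M M5M]]] : exists M,
    [/\ [/\ 1 <= M, `|m| <= M & G <= M], [/\ M1 <= M, M2 <= M & M3 <= M] & M4 <= M /\ M5 <= M].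
  have m0 := normr_ge0 m; exists (1 + M1 + M2 + M3 + M4 + M5 + G + `|m|).
  by move: M10 M20 M30 M40 M50 G0 m0; clear => *; split; split; lra.
have K0 : 0 < conormal_const M by apply: conormal_const_gt0; lra.
exists (2 * conormal_const M); first by rewrite mulr_gt0.
move=> e e0 e1.
have exp1 : \forall eps \near (0 : R)^'+, forall x y, closure (omega P) x -> `|y| <= eps * G ->
    `|vtop P x y - (gamma0 P x + y *: ktop P x)| <= e * eps.
  apply: (expansion_small (h := fun x y => vtop P x y - (gamma0 P x + y *: ktop P x)) G0 e0) => e' e'0.
  apply: filterS (vtop_exp hP e'0) => y h x cx.
  by apply: le_trans (h x cx); exact: norm_enorm.
have exp2 : \forall eps \near (0 : R)^'+, forall x y, closure (omega P) x -> `|y| <= eps * G ->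
    `|vbot P x y - (- gamma0 P x + y *: kbot P x)| <= e * eps.
  apply: (expansion_small (h := fun x y => vbot P x y - (- gamma0 P x + y *: kbot P x)) G0 e0) => e' e'0.
  apply: filterS (vbot_exp hP e'0) => y h x cx.
  by apply: le_trans (h x cx); exact: norm_enorm.
have exp3 := expansion_small (A := closure (omega P)) (G := G)
  (h := fun x y => btop P x y - (beta0 P x + ltop P x * y)) G0 e0 (btop_exp hP).
have exp4 := expansion_small (A := closure (omega P)) (G := G)
  (h := fun x y => bbot P x y - (- beta0 P x + lbot P x * y)) G0 e0 (bbot_exp hP).
near=> eps.
have f1 : forall x y, closure (omega P) x -> `|y| <= eps * G ->
    `|vtop P x y - (gamma0 P x + y *: ktop P x)| <= e * eps by near: eps.
have f2 : forall x y, closure (omega P) x -> `|y| <= eps * G ->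
    `|vbot P x y - (- gamma0 P x + y *: kbot P x)| <= e * eps by near: eps.
have f3 : forall x y, closure (omega P) x -> `|y| <= eps * G ->
    `|btop P x y - (beta0 P x + ltop P x * y)| <= e * eps by near: eps.
have f4 : forall x y, closure (omega P) x -> `|y| <= eps * G ->
    `|bbot P x y - (- beta0 P x + lbot P x * y)| <= e * eps by near: eps.
have eps0 : 0 < eps by [].
have eps1 : eps <= 1 by near: eps; exact: nbhs_right_le.
have epse : eps <= e by near: eps; exact: nbhs_right_le.
move=> s t z Q dQ Kz /=; have [cx _] := thin_closureP hP Kz.
have yG := thin_y_bound hP hG (ltW eps0) Kz.
set x := xpart z in cx *; set y := ypart z in yG * => hQ hdQ.
have [gt gb _ _] := hG' x cx.
have fin : eps * (e + eps) * conormal_const M <= eps * e * (2 * conormal_const M).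
  rewrite -!mulrA ler_pM2l//.
  have -> : e * (2 * conormal_const M) = (e + e) * conormal_const M by ring.
  by apply: ler_wpM2r; [exact: ltW|rewrite lerD2l].
have epsI : 0 < eps <= 1 by rewrite eps0.
have eI : 0 <= e <= 1 by rewrite ltW.
have b1 := le_trans (h1 x cx) M1M.
have b4 := le_trans (h4 x cx) M4M.
have b5 := le_trans (h5 x cx) M5M.
split=> yE; apply: le_trans fin.
  have b2 := le_trans (h2 x cx) M2M.
  have b6 := le_trans gt GM.
  have f1' := f1 x y cx yG; have f3' := f3 x y cx yG.
  rewrite /residual yE; rewrite yE in f1' f3'.
  exact: (conormal_expansion (b0 := beta0 P x) s epsI eI M_1 b1 b2 b4 b5 b6 mM f1' f3' hQ hdQ erefl).
have b3 : `|- kbot P x| <= M by rewrite normrN; exact: le_trans (h3 x cx) M3M.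
have b6 := le_trans gb GM.
(* the bottom condition is read upwards, with the signs of [kbot] and [lbot] changed *)
have f2' : `|- vbot P x y - (gamma0 P x + y *: - kbot P x)| <= e * eps.
  by have := f2 x y cx yG; rewrite -normrN opprB addrC scalerN opprD opprK.
have f4' : `|- bbot P x y - (beta0 P x + - lbot P x * y)| <= e * eps.
  by have := f4 x y cx yG; rewrite -normrN; congr (`|_| <= _); ring.
rewrite /residual yE; rewrite yE in f2' f4'.
have := conormal_expansion (b0 := beta0 P x) s epsI eI M_1 b1 b3 b4 b5 b6 mM f2' f4' hQ hdQ erefl.
rewrite -normrN; congr (`|_| <= _).
by rewrite !dot_pt dotNl; ring.
Unshelve. all: by end_near. Qed.

End Conormal.

(** * A function with gradient transversal to the lateral boundary *)

Section Transversal.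
Context {R : realType} {N : nat}.

Lemma finite_net (A : set 'rV[R]_N) (d : R) : compact A -> 0 < d ->
  exists s : seq 'rV[R]_N, (forall b, b \in s -> A b) /\
    forall x, A x -> exists2 b, b \in s & `|x - b| < d.
Proof.
rewrite compact_cover => cA d0.
have [|x Ax|D DA AD] := cA _ A (fun b => ball b d).
- by move=> b _; exact: ball_open.
- by exists x => //; exact: ballxx.
exists (finmap.enum_fset D); split=> [b bD|x Ax]; first by have := DA b bD; rewrite inE.
have [b /= bD] := AD x Ax; rewrite -ball_normE/= distrC => xb; by exists b.
Qed.

Lemma Ck_exp (k p : nat) (f : 'rV[R]_N -> R) : Ck k f -> Ck k (fun x => f x ^+ p).
Proof.
move=> Cf; elim: p => [|p IH]; first exact: Ck_cst.
by under eq_fun do rewrite exprS; exact: CkM.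
Qed.

Lemma derive_exp (p : nat) (f : 'rV[R]_N -> R) x v : differentiable f x ->
  'D_v (fun x => f x ^+ p) x = p%:R * f x ^+ p.-1 * 'D_v f x.
Proof.
move=> df; have h := diff_derivable (v:=v) df.
have -> : (fun x => f x ^+ p) = f ^+ p by rewrite exprfctE.
by rewrite (deriveX _ h).
Qed.

Lemma derive_sum_seq (I : Type) (r : seq I) (f : I -> 'rV[R]_N -> R) x v :
  (forall i, differentiable (f i) x) ->
  'D_v (fun x => \sum_(i <- r) f i x) x = \sum_(i <- r) 'D_v (f i) x.
Proof.
move=> df; suff [] : is_derive x v (fun x => \sum_(i <- r) f i x) (\sum_(i <- r) 'D_v (f i) x) by [].
elim: r => [|i r IH].
  by under eq_fun do rewrite big_nil; rewrite big_nil; exact: is_derive_cst.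
under eq_fun do rewrite big_cons; rewrite big_cons; apply: is_deriveD.
by apply: DeriveDef => //; exact: diff_derivable.
Qed.

Lemma sum_dominant (I : eqType) (s : seq I) (T : I -> R) (e T0 : R) i0 :
  0 <= e -> (forall i, i \in s -> - e <= T i) -> i0 \in s -> T0 <= T i0 ->
  T0 - (size s)%:R * e <= \sum_(i <- s) T i.
Proof.
move=> e0; elim: s => [//|i s IH] lb; rewrite inE big_cons /= => /orP[/eqP <-|i0s] T00.
  have : - ((size s)%:R * e) <= \sum_(j <- s) T j.
    have {}lb j : j \in s -> - e <= T j by move=> js; apply: lb; rewrite inE js orbT.
    elim: s lb {IH} => [|j s IH] lb; first by rewrite big_nil mul0r oppr0.
    rewrite big_cons /=; have := lb j (mem_head _ _).
    have h : - ((size s)%:R * e) <= \sum_(j <- s) T j.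
      by apply: IH => k ks; apply: lb; rewrite inE ks orbT.
    by rewrite -addn1 natrD; move: h; lra.
  by move: T00; rewrite -addn1 natrD; move=> *; lra.
have := lb i (mem_head _ _).
have : T0 - (size s)%:R * e <= \sum_(j <- s) T j.
  by apply: IH => // j js; apply: lb; rewrite inE js orbT.
by rewrite -addn1 natrD; lra.
Qed.


Definition wall (nu : 'rV[R]_N -> 'rV[R]_N) (A : R) b : 'rV[R]_N -> R :=
  paraboloid 0 (nu b) A b.

Variables (P : problem R N) (hP : admissible P).

(** If the paraboloid is small at a boundary point, which is nearly in the tangent
    plane at [b], then the quadratic term forces the point to be so close to [b] that
    the normal part of the gradient dominates. *)
Lemma wall_transversal g1 g2 : lat P = Oblique g1 g2 ->
  exists c0 A r : R, [/\ 0 < c0, 0 < A, 0 < r & forall x b, bdry (omega P) x -> bdry (omega P) b ->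
    wall (normal P) A b x <= r -> c0 <= dot (g1 x 0) (grad (wall (normal P) A b) x)].
Proof.
move=> latE; have [c0 [M [c00 M0 hM]]] := transversal_bound hP latE.
have [Mn Mn0 hMn] := normal_bound hP.
have [_ Oo _ Ob] := omega_domain hP.
have n0 : 0 <= N%:R :> R by [].
have NM : 0 <= N%:R * M by rewrite mulr_ge0// ltW.
have NMn : 0 <= N%:R * Mn by rewrite mulr_ge0// ltW.
have [e1 [e10 e1E]] : exists e1, 0 < e1 /\ 3 * e1 * (N%:R * M) <= c0 / 2.
  have k0 : 0 < 6 * (N%:R * M + 1) by rewrite mulr_gt0// ltr_wpDl.
  exists (c0 / (6 * (N%:R * M + 1))); split; first by rewrite divr_gt0.
  rewrite mulrAC mulrA ler_pdivrMr//.
  by move: c00 NM => h1 h2; have := mulr_ge0 (ltW h1) h2; lra.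
have e120 : 0 < e1 / 2 by rewrite divr_gt0.
have [d' d'0 hd'] := near0_right (normal_uniform Oo Ob (normal_ok hP) e120).
have [d [d0 hd]] : exists d : R, 0 < d /\ forall b x, bdry (omega P) b -> `|x - b| < d ->
    bdry (omega P) x -> `|dot (normal P b) (x - b)| <= e1 / 2 * `|x - b| /\
      `|normal P x - normal P b| <= e1 / 2.
  exists (d' / 2); split; first by rewrite divr_gt0.
  by apply: hd'; [rewrite divr_gt0|rewrite gtr_pMr// invf_lt1// ltr1n].
have [A [A0 AE]] : exists A : R, 0 < A /\ A * d = N%:R * Mn + 1.
  exists ((N%:R * Mn + 1) / d); split; last by rewrite divfK// gt_eqF.
  by rewrite divr_gt0// ltr_wpDl.
have [r [r0 rd rA]] : exists r : R, [/\ 0 < r, r < d & A * r <= e1 ^+ 2 / 2].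
  have e20 : 0 < e1 ^+ 2 / 2 by rewrite divr_gt0// exprn_gt0.
  have h := small_mul A e20.
  near (0 : R)^'+ => r; exists r; split; first by [].
    by near: r; apply: nbhs_right_lt.
  by rewrite mulrC; near: r.
exists (c0 / 2), A, r; split=> //; first by rewrite divr_gt0.
move=> x b bx bb; rewrite /wall /paraboloid add0r grad_paraboloid => wr.
have sq := sqr_norm_le (x - b).
have t0 := normr_ge0 (x - b); set tau := `|x - b| in sq t0.
have Asq := ler_wpM2l (ltW A0) sq.
have td : tau < d.
  rewrite ltNge; apply/negP => dt.
  have := norm_dot (normal P b) (x - b); rewrite -/tau ler_norml => /andP[h1 _].
  have h2 : N%:R * `|normal P b| * tau <= N%:R * Mn * tau.
    by rewrite ler_wpM2r// ler_wpM2l// hMn.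
  have h3 : (N%:R * Mn + 1) * tau <= A * tau ^+ 2.
    by rewrite -AE expr2 mulrA ler_wpM2r// ler_pM2l.
  by move: wr rd h1 h2 h3 Asq dt; rewrite mulrDl mul1r; lra.
have [h1 h2] := hd b x bb td bx; rewrite -/tau in h1.
have At : A * tau <= e1.
  rewrite leNgt; apply/negP => gt.
  have B0 : 0 < A * tau by exact: lt_trans gt.
  have : (A * tau) ^+ 2 <= A * r + e1 / 2 * (A * tau).
    have -> : (A * tau) ^+ 2 = A * (A * tau ^+ 2) by ring.
    have -> : A * r + e1 / 2 * (A * tau) = A * (r + e1 / 2 * tau) by ring.
    by rewrite ler_pM2l//; move: h1; rewrite ler_norml => /andP[? ?]; lra.
  have : e1 * (A * tau) < (A * tau) ^+ 2 by rewrite expr2 ltr_pM2r.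
  have : e1 * e1 < e1 * (A * tau) by rewrite ltr_pM2l.
  by move: rA; rewrite (expr2 e1); move: (A * tau) => B; lra.
have yI : -1 <= (0 : R) <= 1 by rewrite lerN10 ler01.
have [k1 k2 _] := hM x 0 bx yI.
have -> : normal P b + (2 * A) *: (x - b) =
    normal P x - (normal P x - normal P b) + (2 * A) *: (x - b) by rewrite subKr.
rewrite dotDr dotBr dotZr.
have := norm_dot_le k2 h2; have := norm_dot_le k2 (lexx tau).
rewrite !ler_norml => /andP[h3 _] /andP[_ h4].
have h5 := ler_wpM2l (mulr_ge0 (@ler0n R 2) (ltW A0)) h3.
have h6 := ler_wpM2l NM At.
have h7 := mulr_ge0 NM (ltW e10).
by move: h4 h5 h6 h7 e1E k1; clear; lra.
Unshelve. all: by end_near. Qed.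

(** On a C1 domain the normal field is only continuous, but a smooth substitute for
    the distance to the boundary is still available: a sum of high powers of
    [S - wall] over a finite net of boundary points is a polynomial, its gradient at
    [x] is dominated by the points [b] of the net where [wall] is smallest, and those
    contributions are transversal by the preceding lemma. *)
Lemma transversal_function g1 g2 : lat P = Oblique g1 g2 ->
  exists psi, Ck 2 psi /\ forall x, bdry (omega P) x -> 1 <= dot (g1 x 0) (grad psi x).
Proof.
move=> latE; have [c0 [A [r [c00 A0 r0 good]]]] := wall_transversal latE.
have [c1 [M [_ M0 hM]]] := transversal_bound hP latE.
have [Mn Mn0 hMn] := normal_bound hP.
have n0 : 0 <= N%:R :> R by [].
have cB := omega_bdry_compact hP.
have cid : continuous (fun x : 'rV[R]_N => x) by move=> x; exact: cvg_id.
have [rho rho0 hrho] := compact_norm_bound cB (continuous_subspaceT cid).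
have wall_le x b (t : R) : bdry (omega P) b -> `|x - b| <= t ->
    `|wall (normal P) A b x| <= N%:R * Mn * t + A * (N%:R * t * t).
  move=> bb xbt; rewrite /wall /paraboloid add0r; apply: normD_le.
    exact: (norm_dot_le (hMn b bb) xbt).
  by rewrite normrM gtr0_norm// ler_pM2l//; exact: (norm_dot_le xbt xbt).
have r20 : 0 < r / 2 by rewrite divr_gt0.
have [d [d0 hd]] : exists d : R, 0 < d /\ N%:R * Mn * d + A * (N%:R * d * d) <= r / 2.
  have h := small_mul (N%:R * Mn + A * N%:R) r20.
  near (0 : R)^'+ => d; exists d; split=> //.
  have d1 : d <= 1 by near: d; exact: nbhs_right_le.
  have d0 : 0 < d by [].
  apply: le_trans (_ : d * (N%:R * Mn + A * N%:R) <= _); last by near: d.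
  have -> : N%:R * Mn * d + A * (N%:R * d * d) = d * (N%:R * Mn + A * N%:R * d) by ring.
  rewrite ler_pM2l// lerD2l; apply: ler_piMr => //.
  by apply: mulr_ge0 => //; exact: ltW.
have [s [sB net]] := finite_net cB d0.
pose S0 := N%:R * Mn * (2 * rho) + A * (N%:R * (2 * rho) * (2 * rho)).
have wS0 x b : bdry (omega P) x -> bdry (omega P) b -> `|wall (normal P) A b x| <= S0.
  move=> bx bb; apply: wall_le => //.
  by have := normB_le (hrho x bx) (hrho b bb); have -> : rho + rho = 2 * rho by ring.
have S00 : 0 <= S0.
  have rho20 : 0 <= 2 * rho by rewrite mulr_ge0// ltW.
  by rewrite addr_ge0// !mulr_ge0// ltW.
have [S SE] : exists S, S = S0 + 1 + r by eexists.
have [L LE] : exists L, L = N%:R * M * (Mn + 2 * A * (2 * rho)) by eexists.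
have L0 : 0 <= L.
  have rho20 : 0 <= 2 * A * (2 * rho) by rewrite !mulr_ge0// ltW.
  by rewrite LE !mulr_ge0// ?addr_ge0// ltW.
have yI : -1 <= (0 : R) <= 1 by rewrite lerN10 ler01.
have gL x b : bdry (omega P) x -> bdry (omega P) b ->
    `|dot (g1 x 0) (grad (wall (normal P) A b) x)| <= L.
  move=> bx bb; rewrite LE grad_paraboloid; have [_ k2 _] := hM x 0 bx yI.
  apply: norm_dot_le k2 _; apply: normD_le; first exact: hMn.
  rewrite normrZ gtr0_norm ?mulr_gt0// ler_pM2l ?mulr_gt0//.
  by have := normB_le (hrho x bx) (hrho b bb); have -> : rho + rho = 2 * rho by ring.
pose a := S - r; pose b' := S - r / 2.
have a0 : 0 < a by rewrite /a SE; lra.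
have ab : a < b' by rewrite /a /b'; lra.
have b'1 : 1 <= b' by rewrite /b' SE; lra.
have b'0 : 0 < b' by lra.
(* the exponent makes the points of the net where [wall] exceeds [r] negligible *)
have [p hp] : exists p : nat, (size s)%:R * (L * (a / b') ^+ p) <= c0 / 2.
  have q1 : `|a / b'| < 1 by rewrite gtr0_norm ?divr_gt0// ltr_pdivrMr// mul1r.
  have k0 : 0 < (size s)%:R * L + 1 by rewrite ltr_wpDl// mulr_ge0.
  have e0 : 0 < c0 / 2 / ((size s)%:R * L + 1) by rewrite !divr_gt0.
  have /cvgrPdist_le/(_ _ e0)[p _ h] := cvg_expr q1.
  have qp : 0 <= (a / b') ^+ p by rewrite exprn_ge0// ltW// divr_gt0.
  exists p; have := h p (leqnn p); rewrite /= sub0r normrN (ger0_norm qp).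
  rewrite ler_pdivlMr//; move: qp; move: (_ ^+ p) => z z0; lra.
pose W b x := S - wall (normal P) A b x.
have CW b : Ck 2 (W b).
  by apply: (CkD (Ck_cst _ _ S)); apply: CkN; exact: paraboloid_Ck.
pose Phi x := \sum_(b <- s) W b x ^+ p.+1.
have CPhi : Ck 2 Phi by apply: Ck_sum => b; exact: Ck_exp.
have DPhi x v : 'D_v Phi x =
    - (p.+1%:R * \sum_(b <- s) W b x ^+ p * dot v (grad (wall (normal P) A b) x)).
  rewrite derive_sum_seq => [|b]; last by have [h _] := Ck_exp p.+1 (CW b); exact: h.
  rewrite mulr_sumr -sumrN; apply: eq_bigr => b _.
  have [dW _] := CW b; rewrite derive_exp// /=.
  have [dw _] : Ck 1 (wall (normal P) A b) by exact: paraboloid_Ck.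
  have -> : 'D_v (W b) x = - 'D_v (wall (normal P) A b) x.
    rewrite deriveB; [|exact: derivable_cst|exact: diff_derivable].
    by rewrite derive_cst sub0r.
  by rewrite (derive_grad _ (dw x)); ring.
exists (fun x => - (2 / c0) * Phi x); split; first exact: CkZ.
have [dPhi _] := CPhi.
move=> x bx; rewrite -derive_grad; last by have [h _] := CkZ (- (2 / c0)) CPhi; exact: h.
have -> : 'D_(g1 x 0) (fun x => - (2 / c0) * Phi x) x = - (2 / c0) * 'D_(g1 x 0) Phi x.
  by apply: etrans (deriveZ _ _) _ => //; exact: diff_derivable.
rewrite DPhi mulrNN mulrCA.
have Wge1 b : bdry (omega P) b -> 1 <= W b x.
  move=> bb; have := wS0 x b bx bb; rewrite ler_norml => /andP[_ h].
  by rewrite /W SE; lra.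
have Wp0 b : bdry (omega P) b -> 0 <= W b x ^+ p.
  by move=> bb; rewrite exprn_ge0// (le_trans _ (Wge1 b bb)).
have [b0 b0s xb0] := net x bx.
have := @sum_dominant _ s (fun b => W b x ^+ p * dot (g1 x 0) (grad (wall (normal P) A b) x))
   (L * a ^+ p) (c0 * b' ^+ p) b0.
have ap0 : 0 <= a ^+ p by rewrite exprn_ge0// ltW.
move=> /(_ (mulr_ge0 L0 ap0)) sd.
have {}sd := sd _ b0s _.
have hsum : c0 * b' ^+ p - (size s)%:R * (L * a ^+ p) <=
    \sum_(b <- s) W b x ^+ p * dot (g1 x 0) (grad (wall (normal P) A b) x).
  apply: sd.
    move=> b bs; have bb := sB b bs.
    have [wr|wr] := leP (wall (normal P) A b x) r.
      have h := good x b bx bb wr.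
      apply: (@le_trans _ _ 0); first by rewrite oppr_le0 mulr_ge0.
      by rewrite mulr_ge0 ?Wp0// (le_trans _ h)// ltW.
    have h1 : W b x ^+ p <= a ^+ p.
      rewrite lerXn2r ?nnegrE ?ltW//; first by rewrite (lt_le_trans _ (Wge1 b bb)).
      by rewrite /W /a; lra.
    have := gL x b bx bb; rewrite ler_norml => /andP[h2 _].
    have h3 := ler_wpM2l (Wp0 b bb) h2; have h4 := ler_wpM2l L0 h1.
    by move: h3 h4; clear; lra.
  have bb0 := sB b0 b0s.
  have w0 : wall (normal P) A b0 x <= r / 2.
    by have := le_trans (wall_le x b0 d bb0 (ltW xb0)) hd; rewrite ler_norml => /andP[].
  have wr : wall (normal P) A b0 x <= r by move: w0 r0; clear; lra.
  have h := good x b0 bx bb0 wr.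
  rewrite mulrC; apply: ler_pM => //; [exact: exprn_ge0 (ltW b'0)|exact: ltW|].
  rewrite lerXn2r ?nnegrE//; [exact: ltW|exact: le_trans (Wge1 _ bb0)|].
  by rewrite /W /b'; lra.
have b'p : 1 <= b' ^+ p by rewrite exprn_ege1.
have e1 : (size s)%:R * (L * a ^+ p) = (size s)%:R * (L * (a / b') ^+ p) * b' ^+ p.
  have nz : b' ^+ p != 0 by rewrite expf_neq0// gt_eqF.
  by rewrite expr_div_n; field.
have h1 : (size s)%:R * (L * a ^+ p) <= c0 / 2 * b' ^+ p.
  by rewrite e1 ler_wpM2r// exprn_ge0// ltW.
have h2 : c0 / 2 * 1 <= c0 / 2 * b' ^+ p by rewrite ler_pM2l// divr_gt0.
have h3 : c0 / 2 <= \sum_(b <- s) W b x ^+ p * dot (g1 x 0) (grad (wall (normal P) A b) x).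
  by move: hsum h1 h2; clear; lra.
apply: (@le_trans _ _ (2 / c0 * (c0 / 2))); first by rewrite mulrA divfK ?gt_eqF// divff.
have c20 : 0 < 2 / c0 by rewrite divr_gt0.
have h4 : 2 / c0 * (c0 / 2) <= 2 / c0 * \sum_(b <- s) W b x ^+ p *
    dot (g1 x 0) (grad (wall (normal P) A b) x) by rewrite ler_pM2l.
apply: (le_trans h4); apply: ler_peMl; last by rewrite ler1n.
by apply: le_trans h4; rewrite mulr_ge0// ltW// divr_gt0.
Unshelve. all: by end_near. Qed.

End Transversal.

(** * Uniform barriers *)

Section Barrier.
Context {R : realType} {N : nat}.

Lemma norm_block_le (X : 'M[R]_N) (u v : 'rV[R]_N) (a e : R) :
  `|X| <= e -> `|u| <= e -> `|v| <= e -> `|a| <= e ->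
  `|block_mx X u^T v (a%:M : 'M[R]_1)| <= e.
Proof.
move=> hX hu hv ha; apply: normm_le; first exact: le_trans hX.
move=> i j; rewrite mxE; case: (splitP i) => i' _; rewrite mxE; case: (splitP j) => j' _.
- exact: le_trans (norm_entry _ _ _) hX.
- by rewrite mxE; exact: le_trans (norm_entry _ _ _) hu.
- exact: le_trans (norm_entry _ _ _) hv.
- by rewrite !ord1 mxE eqxx mulr1n.
Qed.

(** A ball of row vectors is compact; [vec_mx] followed by symmetrization maps it into
    the domain of the operator. *)
Lemma sym_ball_compact n (B : R) : exists2 A : set 'M[R]_n, compact A &
  (forall X, A X -> symmx X) /\ (forall X, symmx X -> `|X| <= B -> A X).
Proof.
pose h (v : 'rV[R]_(n * n)) : 'M[R]_n := 2^-1 *: (vec_mx v + (vec_mx v)^T).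
exists (h @` [set v | `|v| <= B]); last split.
- apply: continuous_compact; last exact: ball_compact.
  apply: continuous_subspaceT => v; apply: (@cvg_mx _ _ _ _ (nbhs v)) => i j.
  have hE w : h w i j = 2^-1 * (w 0 (mxvec_index i j) + w 0 (mxvec_index j i)) by rewrite !mxE.
  rewrite hE; under eq_fun do rewrite hE.
  by apply: cvgM; [exact: cvg_cst|apply: cvgD; exact: coord_continuous].
- by move=> _ [v _ <-]; rewrite /symmx /h linearZ/= linearD/= trmxK addrC.
- move=> X sX XB; exists (mxvec X) => /=.
    apply: normm_le; first exact: le_trans XB.
    move=> i j; rewrite ord1; case/mxvec_indexP: j => i' j'; rewrite mxvecE (le_trans _ XB)//.
    exact: norm_entry.
  by rewrite /h mxvecK sX; apply/matrixP => i j; rewrite !mxE; field.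
Qed.

Variables (P : problem R N) (hP : admissible P).
Implicit Types (psi t g l : 'rV[R]_N -> R) (k : 'rV[R]_N -> 'rV[R]_N).

(** Strict monotonicity in the unknown makes the operator positive at large values,
    uniformly for bounded derivatives. *)
Lemma oper_lower_bound (B : R) : exists2 M : R, 0 < M & forall X p x y r,
  symmx X -> `|X| <= B -> `|p| <= B -> closure (omega P) x -> -1 <= y <= 1 ->
  M < rate P * r -> 0 < oper P X p r x y.
Proof.
have [A cA [Asym AB]] := @sym_ball_compact (N + 1) B.
have c0 : compact [set (0 : R)] by exact: compact_set1.
have cD := compact_setX (compact_setX (compact_setX (compact_setX cA
  (@ball_compact R (N + 1) B)) c0) (omega_compact hP)) (@segment_compact R (- 1) 1).
have [|M M0 hM] := compact_norm_bound cD (f := fun w => oper P w.1.1.1.1 w.1.1.1.2 w.1.1.2 w.1.2 w.2).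
  apply: continuous_subspaceW (oper_cont hP) => -[[[[X p] r] x] y] /= [[[[AX _] _] cx] yI].
  by split=> //; exact: Asym.
exists M => // X p x y r sX XB pB cx yI Mr.
have r0 : 0 <= r.
  rewrite ltW// -(pmulr_rgt0 _ (rate_gt0 hP)); exact: lt_trans Mr.
have pXX : psd_ge X X by move=> v; rewrite subrr mulmx0 dot0l.
have := oper_mono hP p cx yI sX sX pXX r0; rewrite mulr0 subr0.
have := hM (X, p, 0, x, y); rewrite /= => h.
have {}h : `|oper P X p 0 x y| <= M.
  by apply: h; split; [split; [split; [split|]|]|]; rewrite //= ?in_itv//; exact: AB.
by move: h Mr; rewrite ler_norml => /andP[? ?]; lra.
Qed.

Lemma residual_cont psi t (s m : R) g k l : Ck 2 psi -> continuous t -> continuous g ->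
  {within closure (omega P), continuous k} -> {within closure (omega P), continuous l} ->
  {within closure (omega P), continuous (residual P psi t s m g k l)}.
Proof.
move=> Cpsi ct cg /within_cvgP ck /within_cvgP cl; apply/within_cvgP => x cx.
have C1 := slope_C1 hP Cpsi.
pose proof (@within_continuous_at _ _ (closure (omega P)) g x cg) as hg.
pose proof (@within_continuous_at _ _ (closure (omega P)) t x ct) as ht.
pose proof (@within_continuous_at _ _ (closure (omega P)) (grad (slope P psi)) x (grad_continuous C1)) as hq.
pose proof (@within_continuous_at _ _ (closure (omega P)) (grad psi) x (grad_continuous (Ck_pred Cpsi))) as hp.
pose proof (@within_continuous_at _ _ (closure (omega P)) (gamma0 P) x (Ck_continuous (gamma0_C1 hP))) as h0.
have h1 := cvg_dot (ck x cx) hp; have h2 := cvg_dot h0 hq.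
apply: cvgD; last exact: ht.
apply: cvgB; last by apply: cvgM; [exact: cvg_cst|exact: h2].
apply: cvgM; first exact: hg.
apply: cvgD; last exact: cvg_cst.
apply: cvgD; last exact: h2.
by apply: cvgB; [exact: h1|exact: (cl x cx)].
Qed.

Lemma residualD psi t (s m : R) g k l x :
  residual P psi t s m g k l x = residual P psi (cst 0) 0 m g k l x + g x * s + t x.
Proof. by rewrite /residual /=; ring. Qed.

Lemma lateral_function : exists psi, Ck 2 psi /\
  forall (g1 : 'rV[R]_N -> R -> 'rV[R]_N) (g2 : 'rV[R]_N -> R -> R), lat P = Oblique g1 g2 -> forall x, bdry (omega P) x ->
    blat P x 0 + 1 <= dot (g1 x 0) (grad psi x).
Proof.
case latE: (lat P) => [g1 g2|]; last by exists (cst 0); split=> //; exact: Ck_cst.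
have [psi [Cpsi hpsi]] := transversal_function hP latE.
have cB : compact (cylinder (bdry (omega P))).
  by apply: compact_setX; [exact: omega_bdry_compact|exact: segment_compact].
have [B B0 hB] := compact_norm_bound cB (blat_cont hP).
exists (fun x => (B + 1) * psi x); split; first exact: CkZ.
move=> _ _ [<- _] x bx; have [dpsi _] := Cpsi.
have -> : grad (fun x => (B + 1) * psi x) x = (B + 1) *: grad psi x.
  apply: grad_unique => v; rewrite dotZr -derive_grad//.
  by apply: etrans (deriveZ _ _) _ => //; exact: diff_derivable.
have := hB (x, 0); rewrite /= => h.
have {}h : `|blat P x 0| <= B by apply: h; split=> //=; rewrite in_itv/= lerN10 ler01.
rewrite dotZr; have := hpsi x bx; move: h; rewrite ler_norml => /andP[_ h] h1.
have B10 : 0 <= B + 1 by rewrite addr_ge0// ltW.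
by have := ler_wpM2l B10 h1; lra.
Qed.


(** At small height the conormal is close to its value at [y = 0], where its vertical
    part vanishes, so the inequality there, which has a margin, persists. *)
Lemma oblique_strict psi (g1 : 'rV[R]_N -> R -> 'rV[R]_N) (g2 : 'rV[R]_N -> R -> R) (B : R) :
  lat P = Oblique g1 g2 -> Ck 2 psi -> 0 < B ->
  (forall x, bdry (omega P) x -> blat P x 0 + 1 <= dot (g1 x 0) (grad psi x)) ->
  \forall eps \near 0^'+, forall z v q, closure (thin P eps) z -> bdry (omega P) (xpart z) ->
    `|v| <= eps * B -> `|q| <= B -> let x := xpart z in let y := ypart z in
    blat P x y < dot (pt (g1 x y) (g2 x y)) (pt (grad psi x + v) q).
Proof.
move=> latE Cpsi B0 hpsi; have := lat_ok hP; rewrite latE => -[cg _ g20].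
have cB := omega_bdry_compact hP.
have [G hG] := height_boundP hP; have [G0 _] := hG.
have [c0 [M [_ M0 hM]]] := transversal_bound hP latE.
have [M4 M40 h4] := compact_norm_bound cB (continuous_subspaceT (grad_continuous (Ck_pred Cpsi))).
have n0 : 0 <= N%:R :> R by [].
have half0 : 0 < 2^-1 :> R by rewrite invr_gt0.
have quart0 : 0 < 4^-1 :> R by rewrite invr_gt0.
have [e [e0 eE]] : exists e, 0 < e /\ e * (N%:R * M4 + B + 1) <= 2^-1.
  have h := small_mul (N%:R * M4 + B + 1) half0.
  by near (0 : R)^'+ => e; exists e; split; [|near: e].
have [d1 d10 hd1] := near0_right (cylinder_uniform (f := fun x y => pt (g1 x y) (g2 x y)) cB cg e0).
have [d2 d20 hd2] := near0_right (cylinder_uniform cB (blat_cont hP) e0).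
have slab := near_slab hP.
have k1 := small_mul (N%:R * M * B) quart0.
near=> eps.
have eps0 : 0 < eps by [].
have [_ yI'] : in_slab P eps by near: eps.
move=> z v q Kz bx vB qB.
have yG := thin_y_bound hP hG (ltW eps0) Kz; have yI := yI' z Kz.
set x := xpart z in bx *; set y := ypart z in yG yI *.
have eG0 : 0 < eps * G by rewrite mulr_gt0.
have eG1 : eps * G < d1.
  by rewrite -ltr_pdivlMr//; near: eps; apply: nbhs_right_lt; rewrite divr_gt0.
have eG2 : eps * G < d2.
  by rewrite -ltr_pdivlMr//; near: eps; apply: nbhs_right_lt; rewrite divr_gt0.
have := hd1 _ eG0 eG1 x y bx yG; rewrite ptN ptD g20// subr0 => hg.
have hg1 := le_trans (norm_xpart _) hg; rewrite xpart_pt in hg1.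
have hg2 := le_trans (norm_ypart _) hg; rewrite ypart_pt in hg2.
have hb := hd2 _ eG0 eG2 x y bx yG.
have [_ gM _] := hM x y bx yI.
have b1 := norm_dot_le hg1 (h4 x bx).
have b2 := norm_dot_le gM vB.
have b3 : `|g2 x y * q| <= e * B by rewrite normrM; exact: ler_pM.
have b4 : eps * (N%:R * M * B) <= 4^-1 by near: eps.
have := hpsi x bx.
rewrite dot_pt dotDr; rewrite dotBl in b1.
move: b1 b2 b3 b4 hb eE; rewrite !ler_norml.
move=> /andP[b1 _] /andP[b2 _] /andP[b3 _] b4 /andP[_ hb] eE.
by move: b1 b2 b3 b4 hb eE; clear; lra.
Unshelve. all: by end_near. Qed.

End Barrier.

(** The profile of a function [psi] transversal to the lateral boundary: a large second
    vertical derivative [2 * C], balanced by [t], makes both residuals strict with a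
    margin of [C] times the width, the lateral condition is strict by the choice of
    [psi], and a large additive constant makes the equation strict.  All of this is
    uniform in the thickness. *)
Lemma upper_barrier_exists (R : realType) (N : nat) (P : problem R N) : admissible P ->
  exists M : R, \forall eps \near 0^'+, exists f,
  upper_barrier (closure (thin P eps)) (sub_cond P eps) f /\
  forall z, closure (thin P eps) z -> 1 <= f z <= M.
Proof.
move=> hP; have cO := omega_compact hP.
have [G hG] := height_boundP hP; have [G0 hG'] := hG.
have [psi [Cpsi hpsi]] := lateral_function hP.
have C1psi := Ck_pred Cpsi; have Cq := slope_C1 hP Cpsi.
pose m := - G - 1.
have hm x : closure (omega P) x -> m < gbot P x.
  by move=> /hG'[_ + _ _]; rewrite ler_norml => /andP[h _]; rewrite /m; lra.
have [K K0 hK] := conormal_estimate hP m Cpsi.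
have c0 : continuous (cst 0 : 'rV[R]_N -> R) := @Ck_cst R _ _ 0 0.
have Cgt := Ck_continuous (gtop_C1 hP); have Cgb := Ck_continuous (gbot_C1 hP).
have [R1 R10 hR1] := compact_norm_bound cO
  (@residual_cont R N P hP psi (cst 0) 0 m _ _ _ Cpsi c0 Cgt (ktop_cont hP) (ltop_cont hP)).
have [R2 R20 hR2] := compact_norm_bound cO
  (@residual_cont R N P hP psi (cst 0) 0 m _ _ _ Cpsi c0 Cgb (within_contN (kbot_cont hP)) (within_contN (lbot_cont hP))).
have [M1 M10 h1] := compact_norm_bound cO (continuous_subspaceT (Ck_continuous Cpsi)).
have [M2 M20 h2] := compact_norm_bound cO (continuous_subspaceT (grad_continuous C1psi)).
have [M3 M30 h3] := compact_norm_bound cO (continuous_subspaceT (hess_continuous Cpsi)).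
have [M4 M40 h4] := compact_norm_bound cO (continuous_subspaceT (Ck_continuous Cq)).
have [M5 M50 h5] := compact_norm_bound cO (continuous_subspaceT (grad_continuous Cq)).
have cB : compact (cylinder (bdry (omega P))).
  by apply: compact_setX; [exact: omega_bdry_compact|exact: segment_compact].
have [B B0 hB] := compact_norm_bound cB (blat_cont hP).
have [dg dg0 hdg] : exists2 dg : R, 0 < dg & forall x, closure (omega P) x -> dg <= gtop P x - gbot P x.
  have [x0 Ox0] : closure (omega P) !=set0.
    by have [[x0 ?] _ _ _] := omega_domain hP; exists x0; exact: subset_closure.
  have [x cx mn] : exists2 x, closure (omega P) x & forall x', closure (omega P) x' ->
      gbot P x' - gtop P x' <= gbot P x - gtop P x.
    apply: usc_max => //; first by exists x0.
    move=> x e cx e0; have c : continuous (fun x => gbot P x - gtop P x).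
      by move=> x'; exact: (cvgB (Cgb x') (Cgt x')).
    have /cvgrPdist_lt/(_ e e0) := c x; apply: filterS => x'.
    by rewrite ltr_norml => /andP[? ?] _; lra.
  exists (gtop P x - gbot P x); first by rewrite subr_gt0 (gbot_lt_gtop hP).
  by move=> x' cx'; have := mn x' cx'; lra.
(* the margin [C * dg] absorbs the parts of the residuals without [s] and [t], and
   the error [K] of the profile *)
have [C [C0 CE]] : exists C : R, 0 < C /\ C * dg = R1 + R2 + K + 1.
  exists ((R1 + R2 + K + 1) / dg); split; last by rewrite divfK// gt_eqF.
  by rewrite divr_gt0// !addr_gt0.
have [t tE] : exists t : 'rV[R]_N -> R, t = fun x => - C * (gtop P x + gbot P x) by eexists.
have Ct : Ck 1 t by rewrite tE; apply: CkZ; exact: (CkD (gtop_C1 hP) (gbot_C1 hP)).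
have [Mt Mt0 ht] := compact_norm_bound cO (continuous_subspaceT (Ck_continuous Ct)).
have resT x : closure (omega P) x -> K < residual P psi t (2 * C) m (gtop P) (ktop P) (ltop P) x.
  move=> cx; rewrite residualD tE; have := hR1 x cx; have := ler_wpM2l (ltW C0) (hdg x cx).
  by rewrite ler_norml => ? /andP[? ?]; lra.
have resB x : closure (omega P) x ->
    residual P psi t (2 * C) m (gbot P) (fun x => - kbot P x) (fun x => - lbot P x) x < - K.
  move=> cx; rewrite residualD tE; have := hR2 x cx; have := ler_wpM2l (ltW C0) (hdg x cx).
  by rewrite ler_norml => ? /andP[? ?]; lra.
have CG : 0 < 2 * C * G by rewrite mulr_gt0// mulr_gt0.
have MG0 : 0 < (M5 + 1) * (2 * G + 1) by rewrite mulr_gt0// addr_gt0// mulr_gt0.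
(* a bound on the first and second derivatives of all touching functions *)
have [BJ [j1 j2 j3 j4 j5]] : exists BJ : R, [/\ M3 + 1 <= BJ, M5 + 1 <= BJ, 2 * C <= BJ,
    M2 + (M5 + 1) * (2 * G + 1) <= BJ & M4 + Mt + 1 + 2 * C * G <= BJ].
  exists ((M3 + 1) + (M5 + 1) + 2 * C + (M2 + (M5 + 1) * (2 * G + 1)) + (M4 + Mt + 1 + 2 * C * G)).
  move: M20 M30 M40 M50 C0 Mt0 CG MG0; clear.
  by move: ((M5 + 1) * _) (2 * C * G) => A1 A2 *; split; lra.
have [MF MF0 hMF] := oper_lower_bound hP BJ.
have [c1 c1E] : exists c1, c1 = MF / rate P + M1 + B + 3 by eexists.
have r0 := rate_gt0 hP.
have MFr : 0 < MF / rate P by rewrite divr_gt0.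
have BQ0 : 0 < M4 + Mt + 1 + 2 * C * G + (M5 + 1) * (2 * G + 1).
  by rewrite !addr_gt0// mulr_gt0// addr_gt0// mulr_gt0.
have lat_strict : \forall eps \near 0^'+, forall (g1 : 'rV[R]_N -> R -> 'rV[R]_N) (g2 : 'rV[R]_N -> R -> R),
    lat P = Oblique g1 g2 -> forall z v q, closure (thin P eps) z -> bdry (omega P) (xpart z) ->
    `|v| <= eps * (M4 + Mt + 1 + 2 * C * G + (M5 + 1) * (2 * G + 1)) ->
    `|q| <= M4 + Mt + 1 + 2 * C * G + (M5 + 1) * (2 * G + 1) ->
    let x := xpart z in let y := ypart z in
    blat P x y < dot (pt (g1 x y) (g2 x y)) (pt (grad psi x + v) q).
  case latE: (lat P) => [g1 g2|]; last by near=> eps.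
  have := oblique_strict hP latE Cpsi BQ0 (hpsi g1 g2 latE).
  by apply: filterS => eps h _ _ [<- <-].
exists (c1 + M1 + 1).
have prof := profileP hP (2 * C) Cpsi Ct hm ltr01 ltr01.
have con := hK 1 ltr01 (lexx 1).
have slab := near_slab hP.
near=> eps.
have eps0 : 0 < eps by [].
have eps1 : eps <= 1 by near: eps; exact: nbhs_right_le.
have he : in_slab P eps by near: eps.
have [f [cf hf]] : exists f, profile P psi t (2 * C) m 1 1 eps f by near: eps.
have con_eps : conormal_close P psi m 1 K eps by near: eps.
have lat_eps : forall (g1 : 'rV[R]_N -> R -> 'rV[R]_N) (g2 : 'rV[R]_N -> R -> R),
    lat P = Oblique g1 g2 -> forall z v q, closure (thin P eps) z -> bdry (omega P) (xpart z) ->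
    `|v| <= eps * (M4 + Mt + 1 + 2 * C * G + (M5 + 1) * (2 * G + 1)) ->
    `|q| <= M4 + Mt + 1 + 2 * C * G + (M5 + 1) * (2 * G + 1) ->
    let x := xpart z in let y := ypart z in
    blat P x y < dot (pt (g1 x y) (g2 x y)) (pt (grad psi x + v) q) by near: eps.
have fb z : closure (thin P eps) z -> c1 - M1 - 1 <= f z + c1 <= c1 + M1 + 1.
  move=> Kz; have [cx _] := thin_closureP hP Kz.
  have [+ _] := hf z Kz; have := h1 _ cx; rewrite !ler_norml => /andP[b1 b2] /andP[b3 b4].
  by apply/andP; move: b1 b2 b3 b4; clear; split; lra.
exists (fun z => f z + c1); split; last first.
  move=> z Kz; have /andP[h ->] := fb z Kz; rewrite andbT (le_trans _ h)// c1E.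
  by move: MFr B0; clear; lra.
split.
  by apply: continuous_subspaceT => z; exact: (cvgD (cf z) (cvg_cst c1)).
move=> z Kz; have [cx _] := thin_closureP hP Kz.
have [_ [w [Q [dQ [mu [[Cw wf wz gw hw] [hmu hQ hdQ]]]]]]] := hf z Kz.
have cE z' : quad c1 0 0 z' = c1 by rewrite /quad dot0l mul0r !addr0.
have Cc : Ck 2 (quad c1 0 0 : 'rV[R]_(N + 1) -> R) := quad_Ck 2 c1 0 0.
have [dw _] := Cw; have [dc _] := Cc.
exists (fun z => w z + quad c1 0 0 z).
split; [exact: (CkD Cw Cc)|by move=> z' _; rewrite cE lerD2r|by rewrite cE wz|].
move=> r fr; rewrite (hessD z Cw Cc) (gradD (dw z) (dc z)) hess_quad grad_quad.
rewrite mulr0 scale0r !addr0 (raddf0 (scalar_mx (n := N + 1))) addr0.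
rewrite gw hw.
have yG := thin_y_bound hP hG (ltW eps0) Kz.
have [_ /(_ z Kz) yI] := he.
have [conT conB] := con_eps (2 * C) t z Q dQ Kz hQ hdQ.
have dQM : `|dQ| <= M5 + 1.
  have := ler_normD (dQ - grad (slope P psi) (xpart z)) (grad (slope P psi) (xpart z)); rewrite subrK.
  by have := h5 _ cx; move: hdQ; clear; lra.
set x := xpart z in cx yG yI gw hw hQ hdQ conT conB *; set y := ypart z in yG yI gw hw hQ hdQ conT conB *.
have ym : `|y - eps * m| <= eps * (2 * G + 1).
  have mE : `|eps * m| <= eps * (G + 1).
    by rewrite normrM gtr0_norm// ler_pM2l// /m -opprD normrN ger0_norm// addr_ge0// ltW.
  by apply: le_trans (normB_le yG mE) _; rewrite -mulrDr ler_pM2l//; clear; lra.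
have vM : `|(y - eps * m) *: dQ| <= eps * ((M5 + 1) * (2 * G + 1)).
  by rewrite normrZ mulrCA mulrC; apply: ler_pM.
have yG1 : `|y| <= G by apply: le_trans yG _; rewrite ler_piMl// ltW.
have QM : `|Q + 2 * C * y| <= M4 + Mt + 1 + 2 * C * G.
  have q1 : `|eps * t x| <= Mt.
    by rewrite normrM gtr0_norm// (le_trans _ (ht x cx))// ler_piMl.
  have q2 := normD_le (h4 x cx) q1.
  have q3 : `|Q| <= M4 + Mt + 1.
    have := ler_normD (Q - (slope P psi x + eps * t x)) (slope P psi x + eps * t x); rewrite subrK.
    by move: hQ q2 eps1; clear; lra.
  have q4 : `|2 * C * y| <= 2 * C * G by rewrite normrM gtr0_norm ?mulr_gt0// ler_pM2l// mulr_gt0.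
  exact: normD_le q3 q4.
have rbig : MF / rate P + B + 1 < r.
  by have /andP[h _] := fb z Kz; move: h fr; rewrite c1E; clear; lra.
case=> [h|[[bx _] h]|[[_ yE] h]|[[_ yE] h]].
- have : 0 < oper P (block_mx (hess psi x + mu%:M) dQ^T dQ (2 * C)%:M)
      (pt (grad psi x + (y - eps * m) *: dQ) (Q + 2 * C * y)) r x y.
    apply: hMF => //.
    + by rewrite -hw; exact: hess_sym.
    + apply: norm_block_le.
      * exact: le_trans (normD_le (h3 x cx) (le_trans (norm_scalar_mx _) hmu)) j1.
      * exact: le_trans dQM j2.
      * exact: le_trans dQM j2.
      * by rewrite gtr0_norm ?mulr_gt0.
    + apply: norm_pt_le; rewrite ?xpart_pt ?ypart_pt.
      * have h2' : `|(y - eps * m) *: dQ| <= (M5 + 1) * (2 * G + 1).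
          by apply: le_trans vM _; rewrite ler_piMl// ltW.
        exact: le_trans (normD_le (h2 x cx) h2') j4.
      * exact: le_trans QM j5.
    + have : MF / rate P < r by move: rbig B0; clear; lra.
      by rewrite ltr_pdivrMr// [_ * rate P]mulrC.
  by rewrite ltNge h.
- move: h; case latE: (lat P) => [g1 g2|] /= h.
    have b1 : `|(y - eps * m) *: dQ| <=
        eps * (M4 + Mt + 1 + 2 * C * G + (M5 + 1) * (2 * G + 1)).
      apply: le_trans vM _; rewrite ler_pM2l//.
      by move: M40 Mt0 CG; clear; lra.
    have b2 : `|Q + 2 * C * y| <= M4 + Mt + 1 + 2 * C * G + (M5 + 1) * (2 * G + 1).
      by move: QM MG0; clear; lra.
    by have := lat_eps g1 g2 latE z _ _ Kz bx b1 b2; rewrite /= ltNge h.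
  have := hB (x, y); rewrite /= => hb.
  have {}hb : `|blat P x y| <= B by apply: hb; split=> //=; rewrite in_itv.
  by move: hb h rbig MFr; rewrite ler_norml => /andP[_]; clear; lra.
- have := conT yE; rewrite mulr1 ler_norml => /andP[k1 _].
  have := resT x cx; rewrite -(ltr_pM2l eps0).
  by move: k1 h; clear; lra.
- have := conB yE; rewrite mulr1 ler_norml => /andP[k1 _].
  have := resB x cx; rewrite -(ltr_pM2l eps0) mulrN.
  by move: k1 h; clear; lra.
Unshelve. all: by end_near. Qed.

(** * Bounds on solutions and relaxed limits *)

Section Relaxed.
Context {R : realType} {N : nat}.
Implicit Types (P : problem R N) (x : 'rV[R]_N) (eps r e : R) (u : 'rV[R]_(N + 1) -> R)
  (z : 'rV[R]_(N + 1)).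

(** Upper and lower barriers bound every solution, and Perron's method between them
    produces one. *)
Lemma solutions_bounded P : admissible P -> exists M : R, \forall eps \near 0^'+,
  solutions P eps !=set0 /\
  forall u z, solutions P eps u -> closure (thin P eps) z -> `|u z| <= M.
Proof.
move=> hP; have hN := neg_admissible hP.
have [M1 near1] := upper_barrier_exists hP.
have [M2 near2] := upper_barrier_exists hN.
exists (Num.max M1 M2).
have touch := thin_strict_sub_touched hP; have slab := near_slab hP.
near=> eps.
have [f1 [bar1 hf1]] : exists f, upper_barrier (closure (thin P eps)) (sub_cond P eps) f /\
  forall z, closure (thin P eps) z -> 1 <= f z <= M1 by near: eps.
have [f2 [bar2 hf2]] : exists f, upper_barrier (closure (thin P eps)) (sub_cond (neg P) eps) f /\
  forall z, closure (thin P eps) z -> 1 <= f z <= M2 by near: eps.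
have he : in_slab P eps by near: eps.
have st : strict_sub_touched (closure (thin P eps)) (sub_cond P eps) (super_cond P eps).
  by near: eps.
have cK := thin_compact hP (eps := eps).
split.
  rewrite -super_condN in bar2.
  have [||u [subu superu]] := perron (fm := fun z => - f2 z) cK (sub_cond_stable hP he)
      (super_cond_stable hP he) st bar1.
  - by under eq_fun do rewrite opprK.
  - by move=> z Kz; have /andP[h1 _] := hf1 z Kz; have /andP[h2 _] := hf2 z Kz; lra.
  - by exists u.
move=> u z Su Kz.
have le_bar (Q : problem R N) f v : upper_barrier (closure (thin P eps)) (sub_cond Q eps) f ->
    visc_sub (closure (thin P eps)) (sub_cond Q eps) v -> v z <= f z.
  move=> bf sv; have [bv _] := sv.
  apply: le_trans (usc_env_ge bv Kz) _; apply: ltW.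
  exact: (visc_sub_lt_barrier cK bf sv Kz).
have [subu _] := Su; have [subNu _] := solutionsN Su.
have h1 := le_bar P f1 u bar1 subu.
have h2 := le_bar (neg P) f2 _ bar2 subNu.
have /andP[_ k1] := hf1 z Kz; have /andP[_ k2] := hf2 z Kz.
rewrite ler_norml lerNl !le_max (le_trans h2 k2) (le_trans h1 k1) orbT//.
Unshelve. all: by end_near. Qed.

Definition relaxed_sup P x r : \bar R :=
  ereal_sup (relaxed_values (omega P) (gtop P) (gbot P) (solutions P) x r).

Definition upper P x : \bar R := upper_relaxed (omega P) (gtop P) (gbot P) (solutions P) x.

Definition lower P x : \bar R := lower_relaxed (omega P) (gtop P) (gbot P) (solutions P) x.

Lemma upper_cvg P x : relaxed_sup P x r @[r --> 0^'+] --> upper P x /\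
  upper P x = ereal_inf (relaxed_sup P x @` [set r : R | 0 < r]).
Proof.
have mono : {in Interval (BRight (0 : R)) +oo%O &, nondecreasing_fun (relaxed_sup P x)}.
  move=> r r' _ _ rr'; apply: le_ereal_sup => t [eps [u [xi [eta [/andP[e0 er] Su K d tE]]]]].
  exists eps, u, xi, eta; split=> //; first by rewrite e0 (lt_le_trans er).
  exact: lt_le_trans rr'.
have h := @nondecreasing_at_right_cvge R (relaxed_sup P x) 0 +oo%O isT mono.
have sE : [set` Interval (BRight (0 : R)) +oo%O] = [set r : R | 0 < r].
  by apply/seteqP; split=> r; rewrite /= in_itv/= andbT.
rewrite sE in h; have limE : upper P x = ereal_inf (relaxed_sup P x @` [set r : R | 0 < r]).
  exact: (cvg_lim _ h).
by split=> //; rewrite limE.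
Qed.

(** The characterization of the value of the upper relaxed limit by which the proof of
    convergence proceeds. *)
Definition is_upper_limit P x (a : R) : Prop :=
  (forall e, 0 < e -> exists2 r, 0 < r & forall eps u z, 0 < eps < r -> solutions P eps u ->
     closure (thin P eps) z -> `|xpart z - x| < r -> u z < a + e) /\
  (forall e r, 0 < e -> 0 < r -> exists eps u z, [/\ 0 < eps < r, solutions P eps u,
     closure (thin P eps) z, `|xpart z - x| < r & a - e < u z]).

Lemma upperP P x : admissible P -> closure (omega P) x ->
  upper P x \is a fin_num /\ is_upper_limit P x (fine (upper P x)).
Proof.
move=> hP cx; have [_ UE] := upper_cvg P x.
have [M nearM] := solutions_bounded hP; have [d d0 hd] := near0_right nearM.
have n0 : 0 < N%:R + 1 :> R by rewrite ltr_wpDl.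
have en (v : 'rV[R]_N) r : 0 < r -> `|v| < r / (N%:R + 1) -> enorm v < r.
  move=> r0; rewrite ltr_pdivlMr// => h; apply: le_lt_trans (enorm_le v) _.
  by apply: le_lt_trans h; rewrite mulrC ler_wpM2l// lerDl.
have geM r : 0 < r -> ((- M)%:E <= relaxed_sup P x r)%E.
  move=> r0; pose eps := Num.min (d / 2) (r / 2).
  have d20 : 0 < d / 2 by rewrite divr_gt0.
  have r20 : 0 < r / 2 by rewrite divr_gt0.
  have eps0 : 0 < eps by rewrite /eps lt_min d20.
  have epsd : eps < d by rewrite /eps gt_min; apply/orP; left; rewrite gtr_pMr// invf_lt1// ltr1n.
  have epsr : eps < r by rewrite /eps gt_min; apply/orP; right; rewrite gtr_pMr// invf_lt1// ltr1n.
  have [[u Su] bnd] := hd eps eps0 epsd.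
  have rn0 : 0 < r / (N%:R + 1) by rewrite divr_gt0.
  have [z [tz zx]] := thin_near_base hP eps0 rn0 cx.
  have Kz : closure (thin P eps) z := subset_closure tz.
  apply: le_trans (_ : (u z)%:E <= _)%E.
    by rewrite lee_fin; have := bnd u z Su Kz; rewrite ler_norml => /andP[].
  apply: ereal_sup_ubound; exists eps, u, (xpart z), (ypart z).
  by split; rewrite ?pt_part ?eps0//; exact: en.
have leM : (relaxed_sup P x d <= M%:E)%E.
  apply: ge_ereal_sup => _ [eps [u [xi [eta [/andP[e0 ed] Su K _ ->]]]]].
  have [_ bnd] := hd eps e0 ed; rewrite lee_fin.
  by have := bnd u _ Su K; rewrite ler_norml => /andP[].
have fin : upper P x \is a fin_num.
  rewrite fin_real//; apply/andP; split.
    rewrite (@lt_le_trans _ _ ((- M)%:E))%E ?ltNyr// UE.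
    by apply: le_ereal_inf_tmp => _ [r r0 <-]; exact: geM.
  rewrite (@le_lt_trans _ _ M%:E)%E ?ltry// UE.
  by apply: ge_ereal_inf; exists (relaxed_sup P x d) => //; exists d.
split=> //; split=> [e e0|e r e0 r0].
  have fin' : ereal_inf (relaxed_sup P x @` [set r : R | 0 < r]) \is a fin_num by rewrite -UE.
  have [_ [r r0 <-] lt] := lb_ereal_inf_adherent e0 fin'.
  exists (r / (N%:R + 1)); first by rewrite divr_gt0.
  move=> eps u z /andP[eps0 epsr] Su Kz zx; rewrite -lte_fin EFinD fineK//.
  rewrite UE; apply: le_lt_trans lt; apply: ereal_sup_ubound.
  exists eps, u, (xpart z), (ypart z); split; rewrite ?pt_part ?eps0//; last exact: en.
  apply: lt_le_trans epsr _; rewrite ler_pdivrMr// ler_peMr// ?lerDr//; exact: ltW.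
have ler : (upper P x <= relaxed_sup P x r)%E by rewrite UE; apply: ereal_inf_lbound; exists r.
have lt : ((fine (upper P x) - e)%:E < relaxed_sup P x r)%E.
  apply: lt_le_trans ler; rewrite -[ltRHS]fineK// lte_fin.
  by rewrite gtrBl.
have [_ [eps [u [xi [eta [epsI Su K dx ->]]]]] lt'] := ereal_sup_gt lt.
exists eps, u, (pt xi eta); split=> //.
by rewrite xpart_pt (le_lt_trans (norm_enorm _)).
Qed.

Lemma lowerN P x : lower P x = (- upper (neg P) x)%E.
Proof.
have [cv _] := upper_cvg (neg P) x.
have E r : ereal_inf (relaxed_values (omega P) (gtop P) (gbot P) (solutions P) x r) =
    (- relaxed_sup (neg P) x r)%E.
  rewrite ereal_infEN; congr (- ereal_sup _)%E; apply/seteqP; split.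
    move=> _ [t [eps [u [xi [eta [epsI Su K dx ->]]]]] <-].
    by exists eps, (fun z => - u z), xi, eta; split=> //; exact: solutionsN.
  move=> _ [eps [u [xi [eta [epsI Su K dx ->]]]]].
  exists (- (u (pt xi eta))%:E)%E; last by rewrite oppeK.
  exists eps, (fun z => - u z), xi, eta; split=> //.
  by have := solutionsN Su; rewrite negK.
rewrite /lower /lower_relaxed; under eq_fun do rewrite E.
by apply: cvg_lim => //; exact: cvgeN.
Qed.

End Relaxed.

(** * The limit jet *)

Section LimitJet.
Context {R : realType} {N : nat}.
Implicit Types (P : problem R N) (x p : 'rV[R]_N) (X : 'M[R]_N) (psi : 'rV[R]_N -> R).

Definition limit_entry P X p x : R :=
  dot (gamma0 P x *m X) (gamma0 P x) +
  dot (coef_b (gtop P) (gbot P) (gamma0 P) (ktop P) (kbot P) x) p +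
  coef_c (gtop P) (gbot P) (gamma0 P) (beta0 P) (ltop P) (lbot P) x.

Definition limit_cross P X p x : 'rV[R]_N :=
  grad (beta0 P) x - p *m Dmx (gamma0 P) x - gamma0 P x *m X.

Definition limit_hess P X p x : 'M[R]_(N + 1) :=
  block_mx X (limit_cross P X p x)^T (limit_cross P X p x) (limit_entry P X p x)%:M.

(** In the limit operator, [A + B + C] has the gradient of [slope psi] off the diagonal:
    it is the Hessian of [psi x + y * slope psi x + s / 2 * y ^ 2] at [y = 0]. *)
Lemma limit_operE P X p r x : symmx X -> limit_oper P X p r x =
  oper P (limit_hess P X p x) (pt p (beta0 P x - dot (gamma0 P x) p)) r x 0.
Proof.
move=> sX; rewrite /limit_oper /limit_operator; congr (oper P _ _ _ _ _).
have rot (V : zmodType) (a b c : V) : - a - b + c = c - b - a.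
  by rewrite addrC addrA addrAC.
rewrite !add_block_mx !addr0 /limit_hess.
have -> : - (X *m (gamma0 P x)^T) - (p *m Dmx (gamma0 P) x)^T + (grad (beta0 P) x)^T =
    (limit_cross P X p x)^T by rewrite rot /limit_cross !linearB/= [(gamma0 P x *m X)^T]trmx_mul sX.
have -> : - (gamma0 P x *m X) - p *m Dmx (gamma0 P) x + grad (beta0 P) x = limit_cross P X p x.
  exact: rot.
congr (block_mx _ _ _ _); rewrite /limit_entry !raddfD/=; congr (_ + _ + _).
by rewrite [LHS]mx11_scalar -dot_mulmx.
Qed.

Lemma limit_hess_sym P X p x : symmx X -> symmx (limit_hess P X p x).
Proof.
by move=> sX; rewrite /symmx /limit_hess tr_block_mx trmxK sX tr_scalar_mx.
Qed.

Lemma limit_hess_scalar P X p x (a : R) : limit_hess P (X + a%:M) p x =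
  limit_hess P X p x + a *: block_mx 1%:M (- (gamma0 P x)^T) (- gamma0 P x)
    (dot (gamma0 P x) (gamma0 P x))%:M.
Proof.
have cE : limit_cross P (X + a%:M) p x = limit_cross P X p x - a *: gamma0 P x.
  by rewrite /limit_cross mulmxDr mul_mx_scalar opprD addrA.
have eE : limit_entry P (X + a%:M) p x =
    limit_entry P X p x + a * dot (gamma0 P x) (gamma0 P x).
  by rewrite /limit_entry mulmxDr dotDl mul_mx_scalar dotZl; ring.
rewrite /limit_hess cE eE scale_block_mx add_block_mx scale_scalar_mx mulr1.
congr block_mx.
- by rewrite linearB/= linearZ/= scalerN.
- by rewrite scalerN.
- by rewrite scale_scalar_mx raddfD.
Qed.

Lemma mul_jacobian (f : 'rV[R]_N -> 'rV[R]_N) x (v : 'rV[R]_N) :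
  differentiable f x -> v *m jacobian f x = 'D_v f x.
Proof. by move=> df; rewrite /jacobian mul_rV_lin1 deriveE. Qed.

Lemma grad_slope P psi x : admissible P -> Ck 2 psi ->
  grad (slope P psi) x = limit_cross P (hess psi x) (grad psi x) x.
Proof.
move=> hP Cpsi; have [dpsi Dpsi] := Cpsi; have [dg _] := gamma0_C1 hP.
have [db _] := beta0_C1 hP.
apply: grad_unique => v.
pose T (i : 'I_N) y := gamma0 P y 0 i * 'D_(delta_mx 0 i) psi y.
have CT i : Ck 1 (T i).
  by apply: CkM; [exact: (Ck_linear_comp (coord_linear 0 i) (gamma0_C1 hP))|exact: Dpsi].
have -> : slope P psi = (fun y => beta0 P y - \sum_i T i y).
  by rewrite funeqE => y; congr (_ - _); apply: eq_bigr => i _; rewrite mxE.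
have dT i : differentiable (T i) x by have [h _] := CT i.
have dS : differentiable (fun y => \sum_i T i y) x.
  by have [h _] := Ck_sum (index_enum 'I_N) CT; exact: h.
rewrite deriveB; [|exact: diff_derivable|exact: diff_derivable].
rewrite (derive_sum_seq _ _ dT) (derive_grad _ (db x)) /limit_cross !dotBr -addrA -opprD.
congr (_ - _).
have -> : dot v (grad psi x *m Dmx (gamma0 P) x) = dot ('D_v (gamma0 P) x) (grad psi x).
  by rewrite /Dmx -dot_mulmxl mul_jacobian.
have -> : dot v (gamma0 P x *m hess psi x) = dot (gamma0 P x) (v *m hess psi x).
  by rewrite -{1}(hess_sym x Cpsi) -dot_mulmxl dotC.
rewrite -big_split; apply: eq_bigr => i _ /=.
have dgi : differentiable (fun y => gamma0 P y 0 i) x.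
  by have [h _] := Ck_linear_comp (coord_linear 0 i) (gamma0_C1 hP); exact: h.
have dpi : differentiable (fun y => 'D_(delta_mx 0 i) psi y) x by have [h _] := Dpsi (delta_mx 0 i).
rewrite deriveM; [|exact: diff_derivable|exact: diff_derivable].
have -> : 'D_v (fun y => gamma0 P y 0 i) x = ('D_v (gamma0 P) x) 0 i.
  exact: (derive_linear_comp v (coord_linear 0 i) (dg x)).
have -> : 'D_v ('D_(delta_mx 0 i) psi) x = (v *m hess psi x) 0 i.
  by rewrite (derive_hess x v (delta_mx 0 i) Cpsi) dotC dot_delta.
by rewrite addrC !mxE; congr (_ + _); rewrite mulrC.
Qed.

(** The residuals on the top and bottom differ by a multiple of the unknown second
    vertical derivative, and this is the equation that determines it: here the
    coefficients [coef_b] and [coef_c] of the limit operator come from. *)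
Lemma limit_balance P psi x (m : R) : admissible P -> Ck 2 psi -> closure (omega P) x ->
  residual P psi (cst 0) (limit_entry P (hess psi x) (grad psi x) x) m (gtop P) (ktop P) (ltop P) x =
  residual P psi (cst 0) (limit_entry P (hess psi x) (grad psi x) x) m (gbot P)
    (fun x => - kbot P x) (fun x => - lbot P x) x.
Proof.
move=> hP Cpsi cx; have := gbot_lt_gtop hP cx; rewrite -subr_gt0 => w0.
have w1 : gtop P x - gbot P x != 0 by rewrite gt_eqF.
rewrite /residual grad_slope// /limit_cross /limit_entry /coef_b /coef_c /=.
have dg : dot (gamma0 P x) (grad psi x *m Dmx (gamma0 P) x) =
    dot (gamma0 P x *m (Dmx (gamma0 P) x)^T) (grad psi x) by rewrite dot_mulmxl trmxK.
rewrite !dotE dg [dot (gamma0 P x) (gamma0 P x *m _)]dotC.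
by field.
Qed.

End LimitJet.

(** * Passage to the limit *)

Section Limit.
Context {R : realType} {N : nat}.
Implicit Types (P : problem R N) (x p : 'rV[R]_N) (X : 'M[R]_N) (psi phi : 'rV[R]_N -> R)
  (e r eps : R) (u : 'rV[R]_(N + 1) -> R) (z : 'rV[R]_(N + 1)).

(** The alternatives to exclude once the test functions have been made strict on the
    top and bottom. *)
Definition side_cond P (X : 'M[R]_(N + 1)) (p : 'rV[R]_(N + 1)) (r : R) z : Prop :=
  oper P X p r (xpart z) (ypart z) <= 0 \/
  (bdry (omega P) (xpart z) /\ lateral_sub (lat P) (blat P) p r (xpart z) (ypart z)).

Definition slab_points P : set 'rV[R]_(N + 1) :=
  [set z | cylinder (closure (omega P)) (xpart z, ypart z)].

Lemma side_cond_stable P : admissible P -> stable_failure (slab_points P) (side_cond P).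
Proof.
move=> hP; apply: stable_or; first by apply: (equation_stable hP) => z.
apply: (lateral_stable hP (D := fun z => bdry (omega P) (xpart z))).
  by have [_ Oo _ _] := omega_domain hP; apply: closed_over; exact: bdry_closed.
by move=> z [_ yI] bz; split.
Qed.

Lemma slab_base P x : closure (omega P) x -> slab_points P (pt x 0).
Proof.
by move=> cx; rewrite /slab_points /= xpart_pt ypart_pt; split=> //=; rewrite in_itv/= lerN10 ler01.
Qed.

Lemma limit_fails_side P X p r x : admissible P -> symmx X -> closure (omega P) x ->
  ~ limit_sub_cond (omega P) (limit_oper P) (lat P) (blat P) X p r x ->
  ~ side_cond P (limit_hess P X p x) (pt p (beta0 P x - dot (gamma0 P x) p)) r (pt x 0).
Proof.
move=> hP sX cx nE; rewrite /side_cond xpart_pt ypart_pt -limit_operE//.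
move=> [h|[bx h]]; apply: nE; first by left.
right; split=> //; have := lat_ok hP; move: h; case: (lat P) => //= g1 g2 h [_ _ g20].
by move: h; rewrite g20// dot_pt mul0r addr0.
Qed.

(** By compactness of the closed base: every point has a neighbourhood and a thickness
    below which this holds. *)
Lemma upper_majorant P (U h : 'rV[R]_N -> R) e : admissible P -> continuous h -> 0 < e ->
  (forall x, closure (omega P) x -> is_upper_limit P x (U x)) ->
  (forall x, closure (omega P) x -> U x <= h x) ->
  \forall d \near 0^'+, forall eps u z, 0 < eps < d -> solutions P eps u ->
    closure (thin P eps) z -> usc_env (closure (thin P eps)) u z <= h (xpart z) + e.
Proof.
move=> hP ch e0 hU Uh; have e20 : 0 < e / 2 by rewrite divr_gt0.
have /compact_near_coveringP/near_covering_withinP cO := omega_compact hP.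
pose good d x := forall eps u z, 0 < eps < d -> solutions P eps u ->
    closure (thin P eps) z -> xpart z = x -> usc_env (closure (thin P eps)) u z <= h x + e.
suff : \forall d \near (0 : R)^'+, closure (omega P) `<=` good d.
  apply: filterS => d hd eps u z epsd Su Kz.
  by have [cx _] := thin_closureP hP Kz; exact: (hd _ cx eps u z epsd Su Kz).
apply: (cO _ _ good) => x cx; have [U1 _] := hU x cx.
have [r r0 hr] := U1 _ e20.
have /cvgrPdist_lt/(_ _ e20)/near_ball[r' r'0 hr'] := ch x.
have r20 : 0 < Num.min r r' / 2 by rewrite divr_gt0// lt_min r0.
have rr : Num.min r r' / 2 < Num.min r r' by rewrite gtr_pMr ?invf_lt1 ?ltr1n// lt_min r0.
exists (ball x (Num.min r r' / 2), [set d | d < r]).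
  by split; [exact: nbhsx_ballx|exact: nbhs_right_lt].
move=> [x' d] /= [xx' dr] _ eps u z /andP[eps0 epsd] Su Kz zx'.
have {}xx' : `|x' - x| < Num.min r r' / 2 by move: xx'; rewrite -ball_normE/= distrC.
have [[bu _] _] := Su.
have [rle r'le] : Num.min r r' <= r /\ Num.min r r' <= r' by rewrite !ge_min !lexx orbT.
have h1 : usc_env (closure (thin P eps)) u z <= U x + e / 2.
  apply: usc_env_le => //.
  have near_z : \forall z' \near z, `|xpart z' - xpart z| < Num.min r r' / 2.
    have /cvgrPdist_lt/(_ _ r20) := cvg_xpart (z := z).
    by apply: filterS => z'; rewrite distrC.
  apply: filterS near_z => z' d1 Kz'; apply: ltW.
  apply: (hr eps u z') => //; first by rewrite eps0 (lt_trans epsd).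
  rewrite -(subrK (xpart z) (xpart z')) -addrA zx' (le_lt_trans (ler_normD _ _))//.
  by rewrite zx' in d1; move: d1 xx' rle r0; clear; move: (Num.min r r') => m; lra.
have h2 := Uh x cx.
have := hr' x' (lt_le_trans (lt_trans xx' rr) r'le).
by rewrite ltr_norml => /andP[h3 h4]; move: h1 h2 h3 h4; clear; lra.
Qed.


(** If the limit condition fails, it fails for all nearby jets.  The profile of [psi],
    with a second vertical derivative slightly above the balanced one and with [t]
    splitting the resulting excess between top and bottom, is then a strict
    supersolution near [x0].  Since the maximum is strict, solutions on thin domains
    that nearly realize the relaxed limit at [x0] are touched by it from above at a
    point near [x0] with nearly the same value, a contradiction. *)
Lemma limit_strict P U psi x0 (eta : R) : admissible P ->
  (forall x, closure (omega P) x -> is_upper_limit P x (U x)) -> closure (omega P) x0 -> Ck 2 psi ->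
  0 < eta ->
  (forall x, closure (omega P) x -> U x - psi x + eta * dot (x - x0) (x - x0) <=
    U x0 - psi x0) ->
  limit_sub_cond (omega P) (limit_oper P) (lat P) (blat P) (hess psi x0) (grad psi x0)
    (U x0) x0.
Proof.
move=> hP hU cx0 Cpsi eta0 strict; apply: contrapT => nE.
have sX : symmx (hess psi x0) := hess_sym x0 Cpsi.
have := limit_fails_side hP sX cx0 nE; rewrite -/(slope P psi x0).
move=> /(side_cond_stable hP (limit_hess_sym _ _ _ sX) (slab_base cx0))[d d0 nside].
have cO := omega_compact hP; have Cq := slope_C1 hP Cpsi; have C1psi := Ck_pred Cpsi.
have [G hG] := height_boundP hP; have [G0 hG'] := hG.
have [M5 M50 h5] := compact_norm_bound cO (continuous_subspaceT (grad_continuous Cq)).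
have [m mE] : exists m, m = - G - 1 by eexists.
have hm x : closure (omega P) x -> m < gbot P x.
  by move=> /hG'[_ + _ _]; rewrite ler_norml => /andP[h _]; rewrite mE; lra.
have [K K0 hK] := conormal_estimate hP m Cpsi.
have d40 : 0 < d / 4 by rewrite divr_gt0.
(* an excess [d / 4] over the balanced value makes the residuals [w] and [- w] *)
have [s0 s0E] : exists s0, s0 = limit_entry P (hess psi x0) (grad psi x0) x0 by eexists.
have [s sE] : exists s, s = s0 + d / 4 by eexists.
have [w [w0 wE]] : exists w, 0 < w /\ w = (gtop P x0 - gbot P x0) * (d / 4) / 2.
  eexists; split; last reflexivity.
  by rewrite divr_gt0// mulr_gt0// subr_gt0; exact: (gbot_lt_gtop hP).
have [t0 t0E] : exists t0, t0 = - residual P psi (cst 0) s m (gtop P) (ktop P) (ltop P) x0 + w.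
  by eexists.
have shift g k l x s1 (c : R) : residual P psi (cst c) s1 m g k l x =
    residual P psi (cst 0) s1 m g k l x + c by rewrite /residual /=; ring.
have shifts g k l x (s1 c : R) : residual P psi (cst 0) (s1 + c) m g k l x =
    residual P psi (cst 0) s1 m g k l x + g x * c by rewrite /residual /=; ring.
pose T := residual P psi (cst t0) s m (gtop P) (ktop P) (ltop P).
pose B := residual P psi (cst t0) s m (gbot P) (fun x => - kbot P x) (fun x => - lbot P x).
have T0 : T x0 = w by rewrite /T shift t0E; ring.
have B0 : B x0 = - w.
  have bal := limit_balance m hP Cpsi cx0; rewrite -s0E in bal.
  by rewrite /B shift t0E sE !shifts bal wE; field.
have ct : continuous (cst t0 : 'rV[R]_N -> R) := @Ck_cst R _ _ 0 t0.
have cT : {within closure (omega P), continuous T}.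
  exact: (@residual_cont R N P hP psi (cst t0) s m (gtop P) (ktop P) (ltop P) Cpsi ct
    (Ck_continuous (gtop_C1 hP)) (ktop_cont hP) (ltop_cont hP)).
have cB : {within closure (omega P), continuous B}.
  exact: (@residual_cont R N P hP psi (cst t0) s m (gbot P) (fun x => - kbot P x)
    (fun x => - lbot P x) Cpsi ct (Ck_continuous (gbot_C1 hP))
    (within_contN (kbot_cont hP)) (within_contN (lbot_cont hP))).
have w20 : 0 < w / 2 by rewrite divr_gt0.
have near_le (V : normedModType R) (f : 'rV[R]_N -> V) : continuous f ->
    \forall x \near x0, `|f x - f x0| <= d / 4.
  move=> cf; have /cvgrPdist_le/(_ _ d40) := cf x0.
  by apply: filterS => x; rewrite distrC.
have n1 := near_le _ _ (Ck_continuous Cpsi).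
have n2 := near_le _ _ (grad_continuous C1psi).
have n3 := near_le _ _ (hess_continuous Cpsi).
have n4 := near_le _ _ (Ck_continuous Cq).
have n5 := near_le _ _ (grad_continuous Cq).
have n6 := within_near cT cx0 w20.
have n7 := within_near cB cx0 w20.
have [rho' rho'0 hrho'] := near_ball (filterI n1 (filterI n2 (filterI n3 (filterI n4
  (filterI n5 (filterI n6 n7)))))).
have [rho [rho0 rhod rhor]] : exists rho, [/\ 0 < rho, rho <= d & rho <= rho'].
  by exists (Num.min d rho'); rewrite lt_min d0 rho'0 !ge_min !lexx orbT.
have {hrho'} hrho x : `|x - x0| < rho -> _ := fun h => hrho' x (lt_le_trans h rhor).
have [e [e0 e1 [e2 e3] [e4 e5]]] : exists e, [/\ 0 < e, e <= 1, e <= d / 16 /\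
    5 * e < eta * rho ^+ 2 & e <= d / 4 /\ e * K < w / 2].
  have p1 : 0 < eta * rho ^+ 2 by rewrite mulr_gt0// exprn_gt0.
  have p2 : 0 < eta * rho ^+ 2 / 6 by rewrite divr_gt0.
  have p3 : 0 < w / 4 by rewrite divr_gt0.
  have k1 := small_mul K p3.
  near (0 : R)^'+ => e; exists e.
  have e0 : 0 < e by [].
  have b1 : e <= d / 16 by near: e; apply: nbhs_right_le; rewrite divr_gt0.
  have b2 : e <= eta * rho ^+ 2 / 6 by near: e; apply: nbhs_right_le.
  have b3 : e * K <= w / 4 by near: e.
  split=> //; first by near: e; exact: nbhs_right_le.
    by split=> //; move: b2 p1; clear; lra.
  by split; [have := d0; move: b1; clear; lra|have := w0; move: b3; clear; lra].
pose h x := U x0 - psi x0 + psi x - eta * dot (x - x0) (x - x0).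
have ch : continuous h.
  have -> : h = fun x => psi x + quad (U x0 - psi x0 - eta * dot x0 x0)
      ((2 * eta) *: x0) (- eta) x.
    rewrite funeqE => x; rewrite /h /quad !dotE (dotC x x0); ring.
  by apply: (@Ck_continuous _ _ _ 2); apply: (CkD Cpsi); exact: quad_Ck.
have Uh x : closure (omega P) x -> U x <= h x.
  by move=> cx; have := strict x cx; rewrite /h; clear; lra.
have [r1 r10 hr1] := near0_right (upper_majorant hP ch e0 hU Uh).
have [r2 r20 hr2] := near0_right (profileP hP s Cpsi (@Ck_cst R _ _ 1 t0) hm d40 e0).
have [r3 r30 hr3] := near0_right (hK e e0 e1).
have [r4 r40 hr4] := near0_right (near_slab hP).
have [r5 r50 hr5] := near0_right (small_mul ((2 * G + 1) * (M5 + 1)) d40).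
have [r6 r60 hr6] := near0_right (small_mul (`|t0| + `|s| * G + 1) d40).
have [r7 r70 hr7] := near0_right (small_mul (2 * G) d0).
have /near_ball[r8 r80 hr8] : \forall x \near x0, `|psi x0 - psi x| <= e.
  by have /cvgrPdist_le/(_ _ e0) := @Ck_continuous _ _ _ _ _ Cpsi x0.
have [r [r0 [b1 b2 b3 b4] [b5 b6 b7 b8]]] : exists r, [/\ 0 < r,
    [/\ r < r1, r < r2, r < r3 & r < r4] & [/\ r < r5, r < r6, r < r7 & r < r8]].
  near (0 : R)^'+ => r; exists r; split; first by [].
    by split; near: r; apply: nbhs_right_lt.
  by split; near: r; apply: nbhs_right_lt.
have [_ U2] := hU x0 cx0.
have [eps [u [z1 [/andP[eps0 epsr] Su Kz1 z1x0 Uz1]]]] := U2 e r e0 r0.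
have [f [cf hf]] := hr2 eps eps0 (lt_trans epsr b2).
have con := hr3 eps eps0 (lt_trans epsr b3).
have he := hr4 eps eps0 (lt_trans epsr b4).
have maj z : closure (thin P eps) z -> usc_env (closure (thin P eps)) u z <= h (xpart z) + e.
  move=> Kz; have d20 : 0 < r1 by [].
  have := hr1 r r0 b1 eps u z; rewrite eps0 epsr; exact.
have [[bu subu] _] := Su.
have [z Kz mx] : exists2 z, closure (thin P eps) z & forall z', closure (thin P eps) z' ->
    usc_env (closure (thin P eps)) u z' - f z' <= usc_env (closure (thin P eps)) u z - f z.
  apply: usc_max; [exact: thin_compact hP eps|by exists z1|].
  move=> z' e' Kz' e'0; have e'20 : 0 < e' / 2 by rewrite divr_gt0.
  have /cvgrPdist_lt/(_ _ e'20) k1 := cf z'; have k2 := usc_env_usc bu Kz' e'20.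
  apply: filterS2 k1 k2 => z'' k1 k2 Kz''; have := k2 Kz''; move: k1.
  by rewrite ltr_norml => /andP[+ +]; clear; lra.
set V := usc_env (closure (thin P eps)) u in maj mx.
have [fz [wt [Q [dQ [mu [[Cw wf wz gw hw] [hmu hQ hdQ]]]]]]] := hf z Kz.
have [fz1 _] := hf z1 Kz1.
have [cx ybt] := thin_closureP hP Kz.
have Uz : U x0 - psi x0 + psi (xpart z) - 4 * e <= V z.
  have k1 := mx z1 Kz1; have k2 := usc_env_ge bu Kz1; rewrite -/V in k2.
  have := hr8 _ (lt_trans z1x0 b8).
  move: fz fz1; rewrite !ler_norml => /andP[+ +] /andP[+ +] /andP[+ +].
  by move: k1 k2 Uz1; clear; lra.
have Uz2 := maj z Kz.
have close : `|xpart z - x0| < rho.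
  apply: (bowl_lt eta0 rho0); move: Uz Uz2 e3; rewrite /h; clear; lra.
have := hrho _ close; move=> [m1 [m2 [m3 [m4 [m5 [m6 m7]]]]]].
have r_close : `|V z - U x0| < d.
  have dd := dotvv_ge0 (xpart z - x0).
  have dd' := mulr_ge0 (ltW eta0) dd.
  move: Uz Uz2 e2 m1 d0 dd'; rewrite /h ler_norml ltr_norml => u1 u2 u3 /andP[u4 u5] u6 u7.
  by apply/andP; move: u1 u2 u3 u4 u5 u6 u7; clear; split; lra.
have := m6 cx; have := m7 cx; rewrite T0 B0.
rewrite !ltr_norml => /andP[B1 B2] /andP[T1 T2].
have [conT conB] := con s (cst t0) z Q dQ Kz hQ hdQ.
have yG := thin_y_bound hP hG (ltW eps0) Kz.
have dQM : `|dQ| <= M5 + 1.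
  have := ler_normD (dQ - grad (slope P psi) (xpart z)) (grad (slope P psi) (xpart z)).
  by rewrite subrK; have := h5 _ cx; move: hdQ e1; clear; lra.
have sub := subu wt z Cw Kz.
have {}sub : sub_cond P eps (hess wt z) (grad wt z) (V z) z.
  apply: sub => z' Kz'; have := mx z' Kz'; rewrite -/V wz.
  by have := wf z'; clear; lra.
have z_close : `|z - pt x0 0| < d.
  rewrite -[z]pt_part ptN ptD; apply: le_lt_trans (_ : Num.max `|xpart z - x0| `|ypart z| < d).
    by apply: norm_pt_le; rewrite ?xpart_pt ?ypart_pt ?subr0 le_max lexx ?orbT.
  rewrite gt_max (lt_le_trans close rhod)/= (le_lt_trans yG)//.
  have := hr7 eps eps0 (lt_trans epsr b7).
  by have := mulr_gt0 eps0 G0; clear; lra.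
have ym : `|ypart z - eps * m| <= eps * (2 * G + 1).
  have mG : `|eps * m| <= eps * (G + 1).
    by rewrite normrM gtr0_norm// ler_pM2l// mE -opprD normrN ger0_norm// addr_ge0// ltW.
  by apply: le_trans (normB_le yG mG) _; rewrite -mulrDr ler_pM2l//; clear; lra.
have vM : `|(ypart z - eps * m) *: dQ| <= d / 4.
  rewrite normrZ; apply: le_trans (ler_pM (normr_ge0 _) (normr_ge0 _) ym dQM) _.
  by rewrite -mulrA; exact: hr5 eps eps0 (lt_trans epsr b5).
have p_close : `|grad wt z - pt (grad psi x0) (slope P psi x0)| < d.
  rewrite gw ptN ptD; apply: le_lt_trans (_ : d / 4 * 3 < d); last by move: d0; clear; lra.
  apply: norm_pt_le; rewrite ?xpart_pt ?ypart_pt.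
    rewrite addrAC; apply: le_trans (normD_le m2 vM) _; by move: d0; clear; lra.
  have k1 := hr6 eps eps0 (lt_trans epsr b6).
  have sy : `|s * ypart z| <= `|s| * (eps * G) by rewrite normrM ler_wpM2l.
  have et : `|eps * t0| <= eps * `|t0| by rewrite normrM gtr0_norm.
  have ee : e * eps <= eps by rewrite ler_piMl// ltW.
  have -> : Q + s * ypart z - slope P psi x0 = (Q - (slope P psi (xpart z) + eps * t0)) +
     (slope P psi (xpart z) - slope P psi x0) + (eps * t0 + s * ypart z) by ring.
  apply: le_trans (normD_le (normD_le hQ m4) (normD_le et sy)) _.
  by move: k1 ee d0; clear; lra.
have X_close : `|hess wt z - limit_hess P (hess psi x0) (grad psi x0) x0| < d.
  rewrite hw /limit_hess opp_block_mx add_block_mx -!linearB/= -!raddfB/= -(grad_slope x0 hP Cpsi).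
  apply: le_lt_trans (_ : d / 4 * 2 < d); last by move: d0; clear; lra.
  have cr : `|dQ - grad (slope P psi) x0| <= d / 4 * 2.
    have := normD_le hdQ m5; rewrite addrA subrK => k; apply: le_trans k _.
    by move: e4; clear; lra.
  apply: norm_block_le => //.
    rewrite addrAC; apply: le_trans (normD_le m3 (le_trans (norm_scalar_mx _) hmu)) _.
    by clear; lra.
  rewrite sE s0E addrAC subrr add0r gtr0_norm//; by move: d0; clear; lra.
have slabz : slab_points P z by exact: thin_in_cylinder he Kz.
have fails := nside _ _ _ z (hess_sym z Cw) slabz X_close p_close r_close z_close.
case: sub => [k|[[bz _] k]|[[_ yE] k]|[[_ yE] k]].
- by apply: fails; left.
- by apply: fails; right.
- move: k; rewrite leNgt gw => /negP; apply.
  have := conT yE; rewrite ler_norml => /andP[k1 _].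
  have k2 : 0 < eps * (T (xpart z) - e * K).
    by rewrite mulr_gt0// subr_gt0; move: T2 e5; clear; lra.
  by move: k1 k2; rewrite -/T; clear; lra.
- move: k; rewrite leNgt gw => /negP; apply.
  have := conB yE; rewrite ler_norml => /andP[k1 _].
  have k2 : 0 < eps * (- B (xpart z) - e * K).
    by rewrite mulr_gt0// subr_gt0; move: B1 e5; clear; lra.
  by move: k1 k2; rewrite -/B; clear; lra.
Unshelve. all: by end_near. Qed.

End Limit.

(** * Conclusion *)

Section Conclusion.
Context {R : realType} {N : nat}.
Implicit Types (P : problem R N) (U : 'rV[R]_N -> R) (x p : 'rV[R]_N) (X : 'M[R]_N) (e r : R).

Lemma upper_limit_bounded P U : admissible P ->
  (forall x, closure (omega P) x -> is_upper_limit P x (U x)) ->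
  exists M : R, forall x, closure (omega P) x -> `|U x| <= M.
Proof.
move=> hP hU; have [M nearM] := solutions_bounded hP.
have [d d0 hd] := near0_right nearM.
exists (M + 1) => x cx; have [U1 U2] := hU x cx.
have [r r0 hr] := U1 1 ltr01.
have rd0 : 0 < Num.min r d by rewrite lt_min r0.
have [eps [u [z [/andP[eps0 epsr] Su Kz zx gt]]]] := U2 1 _ ltr01 rd0.
move: epsr zx; rewrite !lt_min => /andP[epsr epsd] /andP[zr _].
have [_ /(_ u z Su Kz)] := hd eps eps0 epsd.
have := hr eps u z; rewrite eps0 epsr => /(_ isT Su Kz zr).
by move: gt; rewrite !ler_norml => k1 k2 /andP[k3 k4]; apply/andP; move: k1 k2 k3 k4; clear; split; lra.
Qed.

Lemma usc_env_upper_limit P U x : admissible P ->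
  (forall x, closure (omega P) x -> is_upper_limit P x (U x)) ->
  closure (omega P) x -> usc_env (closure (omega P)) U x = U x.
Proof.
move=> hP hU cx; have /bounded_onP bU := upper_limit_bounded hP hU.
apply/eqP; rewrite eq_le usc_env_ge// andbT; apply/ler_addgt0Pr => e e0.
apply: usc_env_le => //; have e20 : 0 < e / 2 by rewrite divr_gt0.
have [U1 _] := hU x cx; have [r r0 hr] := U1 _ e20.
have r20 : 0 < r / 2 by rewrite divr_gt0.
apply: filterS (nbhsx_ballx x _ r20) => y; rewrite -ball_normE/= distrC => yx cy.
have [_ U2] := hU y cy.
have [eps [u [z [/andP[eps0 epsr] Su Kz zy gt]]]] := U2 _ _ e20 r20.
have zx : `|xpart z - x| < r.
  rewrite -(subrK y (xpart z)) -addrA (le_lt_trans (ler_normD _ _))//.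
  by rewrite [r]splitr ltrD.
have epsr' : 0 < eps < r.
  by rewrite eps0 (lt_trans epsr)// gtr_pMr// invf_lt1// ltr1n.
by have := hr eps u z epsr' Su Kz zx; move: gt; lra.
Qed.

(** Used with the paraboloids that make the maximum of a test function strict; the limit
    condition is closed under convergence of the Hessian. *)
Lemma limit_cond_perturb P X p r x : admissible P -> symmx X -> closure (omega P) x ->
  (forall a : R, 0 < a -> limit_sub_cond (omega P) (limit_oper P) (lat P) (blat P) (X + a%:M) p r x) ->
  limit_sub_cond (omega P) (limit_oper P) (lat P) (blat P) X p r x.
Proof.
move=> hP sX cx h; apply: contrapT => nE.
have := limit_fails_side hP sX cx nE.
move=> /(side_cond_stable hP (limit_hess_sym _ _ _ sX) (slab_base cx))[d d0 stab].
set D := block_mx 1%:M (- (gamma0 P x)^T) (- gamma0 P x)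
    (dot (gamma0 P x) (gamma0 P x))%:M : 'M[R]_(N + 1).
have d20 : 0 < d / 2 by rewrite divr_gt0.
have [d' d'0 hd'] := near0_right (small_mul `|D| d20).
have a0 : 0 < d' / 2 by rewrite divr_gt0.
have ad : d' / 2 < d' by rewrite gtr_pMr// invf_lt1// ltr1n.
have sXa : symmx (X + (d' / 2)%:M) by rewrite /symmx linearD/= sX tr_scalar_mx.
apply: (stab (limit_hess P (X + (d' / 2)%:M) p x) (pt p (beta0 P x - dot (gamma0 P x) p)) r
  (pt x 0) (limit_hess_sym P p x sXa) (slab_base cx)); last 4 first.
- by rewrite subrr normr0.
- by rewrite subrr normr0.
- by rewrite subrr normr0.
- have := h _ a0; rewrite /limit_sub_cond limit_operE// => -[k|[bx k]].
    by left; rewrite xpart_pt ypart_pt.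
  by case: nE; right.
rewrite limit_hess_scalar addrAC subrr add0r normrZ gtr0_norm//.
by rewrite (le_lt_trans (hd' _ a0 ad))// gtr_pMr// invf_lt1// ltr1n.
Qed.

Theorem upper_limit_subsolution P U : admissible P ->
  (forall x, closure (omega P) x -> is_upper_limit P x (U x)) ->
  visc_sub (closure (omega P)) (limit_sub_cond (omega P) (limit_oper P) (lat P) (blat P)) U.
Proof.
move=> hP hU; split; first exact/bounded_onP/(upper_limit_bounded hP hU).
move=> phi x0 Cphi cx0 mx.
rewrite (usc_env_upper_limit hP hU cx0).
apply: limit_cond_perturb => //; first exact: hess_sym.
move=> a a0; have a20 : 0 < a / 2 by rewrite divr_gt0.
have [dphi _] := Cphi; have Cb := bowl_Ck 2 x0 (a / 2) 0; have [db _] := Cb.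
have := limit_strict (psi := fun x => phi x + bowl x0 (a / 2) 0 x) hP hU cx0 (CkD Cphi Cb) a20.
rewrite (hessD x0 Cphi Cb) (gradD (dphi x0) (db x0)) hess_bowl grad_bowl subrr scaler0 addr0.
have -> : 2 * (a / 2) = a by field.
apply=> x cx; have := mx x cx; rewrite !(usc_env_upper_limit hP hU)// bowl_at /bowl.
by clear; lra.
Qed.

(** The lower relaxed limit of a problem is minus the upper relaxed limit of the problem
    solved by [- u]. *)
Theorem relaxed_limits P : admissible P -> relaxed_limits_solve (omega P) (gtop P) (gbot P)
  (oper P) (vtop P) (vbot P) (btop P) (bbot P) (gamma0 P) (beta0 P) (ktop P) (kbot P)
  (ltop P) (lbot P) (lat P) (blat P).
Proof.
move=> hP; have hN := neg_admissible hP.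
have lowE : lower P = (fun x => - upper (neg P) x)%E by apply: funext => x; exact: lowerN.
split.
- by move=> x cx; have [] := upperP hP cx.
- move=> x cx; rewrite -/(lower P x) lowE fin_numN.
  by have [] := upperP hN cx.
- by apply: upper_limit_subsolution => // x cx; have [] := upperP hP cx.
have -> : fine \o lower_relaxed (omega P) (gtop P) (gbot P) (solutions P) =
    (fun x => - fine (upper (neg P) x)).
  by apply: funext => x /=; rewrite -/(lower P x) lowE fineN.
apply/visc_superN; under eq_fun do rewrite opprK.
have -> : opp_cond (limit_super_cond (omega P) (limit_oper P) (lat P) (blat P)) =
    limit_sub_cond (omega P) (limit_oper (neg P)) (lat P) (blat (neg P)).
  apply: funext => X; apply: funext => p; apply: funext => r; apply: funext => x.
  apply/propext; rewrite /opp_cond /limit_super_cond /limit_sub_cond limit_operN; last exact: beta0_C1.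
  rewrite oppr_le0.
  have lE : lateral_limit_super (lat P) (blat P) (- p) (- r) x <->
      lateral_limit_sub (lat P) (blat (neg P)) p r x.
    case: (lat P) => [g1 g2|] /=; last by rewrite lerNr.
    by rewrite dotNr lerNr.
  by split=> -[h|[bx /lE h]]; by [left|right].
apply: (@upper_limit_subsolution (neg P) (fun x => fine (upper (neg P) x)) hN).
by move=> x cx; have [] := upperP hN cx.
Qed.

End Conclusion.

Theorem theorem4 (R : realType) (N : nat) (N_ge1 : (1 <= N)%N)
    (Om : set 'rV[R]_N) (nu : 'rV[R]_N -> 'rV[R]_N)
    (Om_domain : bounded_domain Om) (Om_C1 : C1_boundary Om)
    (nu_normal : outward_unit_normal Om nu)
    (gp gm : 'rV[R]_N -> R) (gp_C1 : Ck 1 gp) (gm_C1 : Ck 1 gm)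
    (gm_lt_gp : forall x, closure Om x -> gm x < gp x)
    (F : 'M[R]_(N + 1) -> 'rV[R]_(N + 1) -> R -> 'rV[R]_N -> R -> R)
    (F_cont : {within [set w : 'M[R]_(N + 1) * 'rV[R]_(N + 1) * R * 'rV[R]_N * R |
                 [/\ symmx w.1.1.1.1, closure Om w.1.2 & -1 <= w.2 <= 1]],
        continuous (fun w : 'M[R]_(N + 1) * 'rV[R]_(N + 1) * R * 'rV[R]_N * R =>
          F w.1.1.1.1 w.1.1.1.2 w.1.1.2 w.1.2 w.2)})
    (alpha : R) (alpha_gt0 : 0 < alpha)
    (F_mono : forall (p : 'rV[R]_(N + 1)) (x : 'rV[R]_N) (y : R),
        closure Om x -> -1 <= y <= 1 ->
        forall (X Y : 'M[R]_(N + 1)) (r s : R),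
          symmx X -> symmx Y -> psd_ge X Y -> r <= s ->
          F X p r x y - alpha * r <= F Y p s x y - alpha * s)
    (gamma1p gamma1m : 'rV[R]_N -> R -> 'rV[R]_N)
    (betap betam : 'rV[R]_N -> R -> R)
    (gamma1p_cont : {within closure Om `*` `[-1, 1],
        continuous (fun w : 'rV[R]_N * R => gamma1p w.1 w.2)})
    (gamma1m_cont : {within closure Om `*` `[-1, 1],
        continuous (fun w : 'rV[R]_N * R => gamma1m w.1 w.2)})
    (betap_cont : {within closure Om `*` `[-1, 1],
        continuous (fun w : 'rV[R]_N * R => betap w.1 w.2)})
    (betam_cont : {within closure Om `*` `[-1, 1],
        continuous (fun w : 'rV[R]_N * R => betam w.1 w.2)})
    (gammao : 'rV[R]_N -> 'rV[R]_N) (betao : 'rV[R]_N -> R)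
    (gammao_C1 : Ck 1 gammao) (betao_C1 : Ck 1 betao)
    (gamma1p0 : forall x, closure Om x -> gamma1p x 0 = gammao x)
    (gamma1m0 : forall x, closure Om x -> - gamma1m x 0 = gammao x)
    (betap0 : forall x, closure Om x -> betap x 0 = betao x)
    (betam0 : forall x, closure Om x -> - betam x 0 = betao x)
    (kp km : 'rV[R]_N -> 'rV[R]_N) (lp lm : 'rV[R]_N -> R)
    (kp_cont : {within closure Om, continuous kp})
    (km_cont : {within closure Om, continuous km})
    (lp_cont : {within closure Om, continuous lp})
    (lm_cont : {within closure Om, continuous lm})
    (gamma1p_exp : forall e : R, 0 < e -> \forall y \near (0 : R),
        forall x, closure Om x ->
        enorm (gamma1p x y - (gammao x + y *: kp x)) <= e * `|y|)
    (gamma1m_exp : forall e : R, 0 < e -> \forall y \near (0 : R),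
        forall x, closure Om x ->
        enorm (gamma1m x y - (- gammao x + y *: km x)) <= e * `|y|)
    (betap_exp : forall e : R, 0 < e -> \forall y \near (0 : R),
        forall x, closure Om x ->
        `|betap x y - (betao x + lp x * y)| <= e * `|y|)
    (betam_exp : forall e : R, 0 < e -> \forall y \near (0 : R),
        forall x, closure Om x ->
        `|betam x y - (- betao x + lm x * y)| <= e * `|y|)
    (beta : 'rV[R]_N -> R -> R)
    (beta_cont : {within bdry Om `*` `[-1, 1],
        continuous (fun w : 'rV[R]_N * R => beta w.1 w.2)}) :
  (forall (gamma1 : 'rV[R]_N -> R -> 'rV[R]_N) (gamma2 : 'rV[R]_N -> R -> R),
     {within bdry Om `*` `[-1, 1],
        continuous (fun w : 'rV[R]_N * R => pt (gamma1 w.1 w.2) (gamma2 w.1 w.2))} ->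
     (forall x y, bdry Om x -> -1 <= y <= 1 -> 0 < dot (gamma1 x y) (nu x)) ->
     (forall x, bdry Om x -> gamma2 x 0 = 0) ->
     relaxed_limits_solve Om gp gm F gamma1p gamma1m betap betam
       gammao betao kp km lp lm (Oblique gamma1 gamma2) beta)
  /\
  relaxed_limits_solve Om gp gm F gamma1p gamma1m betap betam
    gammao betao kp km lp lm Dirichlet beta.

Proof.
pose P L := Problem Om nu gp gm F alpha gamma1p gamma1m betap betam gammao betao kp km lp lm
  L beta.
have adm L lat_ok := @Build_admissible R N (P L) Om_domain nu_normal gp_C1 gm_C1 gm_lt_gp
  F_cont alpha_gt0 F_mono gamma1p_cont gamma1m_cont betap_cont betam_cont gammao_C1 betao_C1
  kp_cont km_cont lp_cont lm_cont gamma1p_exp gamma1m_exp betap_exp betam_exp beta_cont lat_ok.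
split=> [gamma1 gamma2 gamma_cont gamma_pos gamma2_0|].
  exact: (relaxed_limits (adm (Oblique gamma1 gamma2) (And3 gamma_cont gamma_pos gamma2_0))).
exact: (relaxed_limits (adm Dirichlet I)).
Qed.
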